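(* Let $\mathcal H$ be a separable Hilbert space, let $M$ be an operator mean on $\mathcal P^\infty(\mathbb P)$ satisfying congruence invariance, i.e. $SM(\mu)S^*=M(S\mu S^* )$ for every $\mu\in\mathcal P^\infty(\mathbb P)$ and every invertible $S\in B(\mathcal H)$, and let $\sigma$ be any two-variable operator mean in the Kubo-Ando sense with $\sigma\ne\mathfrak l$. Then for every $\mu\in\mathcal P^\infty(\mathbb P)$, $$M_\sigma(\mu)\ge I\ \implies\ M_{\sigma_{1/r}}(\mu^r)\ge M_\sigma(\mu)\quad\text{for all } r\ge1,$$ $$M_\sigma(\mu)\le I\ \implies\ M_{\sigma_{1/r}}(\mu^r)\le M_\sigma(\mu)\quad\text{for all } r\ge1.$$
   Context: $\mathcal H$ is a separable Hilbert space, $B(\mathcal H)$ the bounded operators on it, $\mathbb P=\mathbb P(\mathcal H)$ is the set of positive invertible bounded operators on $\mathcal H$ with the operator norm topology, $A\le B$ means $B-A$ is positive semidefinite, and SOT is the strong operator topology. For $\varepsilon\in(0,1)$, $\Sigma_\varepsilon=\{A\in\mathbb P:\varepsilon I\le A\le\varepsilon^{-1}I\}$. $\mathcal P^\infty(\mathbb P)$ is the set of Borel (for the norm topology) probability measures $\mu$ on $\mathbb P$ with $\mu(\mathrm{supp}(\mu))=1$ and $\mathrm{supp}(\mu)\subset\Sigma_\varepsilon$ for some $\varepsilon\in(0,1)$. Stochastic order: $\mathcal U\subset\mathbb P$ is an upper set if $A\in\mathcal U$, $B\in\mathbb P$, $B\ge A$ imply $B\in\mathcal U$; $\mu\le\nu$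 means $\mu(\mathcal U)\le\nu(\mathcal U)$ for every norm-closed upper set $\mathcal U$. Monotone convergence: for $\mu,\mu_k\in\mathcal P^\infty(\mathbb P)$ ($k\in\mathbb N$), $\mu_k\nearrow\mu$ (resp. $\mu_k\searrow\mu$) means (a) $\mu_1\le\mu_2\le\cdots\le\mu$ (resp. $\mu_1\ge\mu_2\ge\cdots\ge\mu$); then all $\mu_k$ and $\mu$ are supported on a common $\Sigma_\varepsilon$; and (b) $\int f\,d\mu_k\to\int f\,d\mu$ for every bounded SOT-continuous real function $f$ on $\Sigma_\varepsilon$ (independent of the choice of such $\varepsilon$). An operator mean on $\mathcal P^\infty(\mathbb P)$ is a map $M:\mathcal P^\infty(\mathbb P)\to\mathbb P$ such that: (i) $\mu\le\nu$ implies $M(\mu)\le M(\nu)$; (ii) $M(\alpha.\mu)=\alpha M(\mu)$ for all $\alpha>0$, where $\alpha.\mu$ is the push-forward of $\mu$ by $A\mapsto\alpha A$; (iii) if $\mu_k\searrow\mu$ or $\mu_k\nearrow\mu$ then $M(\mu_k)\to M(\mu)$ in SOT; (iv) $M(\delta_I)=I$. A two-variable operator mean $\sigma$ in the Kubo-Ando sense is given on $\mathbb P\times\mathbb P$ by $A\sigma B=A^{1/2}f_\sigma(A^{-1/2}BA^{-1/2})A^{1/2}$, where its representing function $f_\sigma:(0,\infty)\to(0,\infty)$ is operator monotone with $f_\sigma(1)=1$; $\mathfrak l$ is the left trivial mean $X\,\mathfrak l\,Y=X$. For $0<s\le1$, $\sigma_s$ is the two-variable operator mean with representing function $x\mapsto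 f_\sigma(x^s)$. For $X\in\mathbb P$, $X\sigma\mu$ is the push-forward of $\mu$ by $A\mapsto X\sigma A$. Deformed operator mean: for an operator mean $M$ and $\sigma\ne\mathfrak l$, $M_\sigma(\mu)$ is the unique solution $X\in\mathbb P$ of $X=M(X\sigma\mu)$; it is known that this solution exists uniquely and that $M_\sigma$ is again an operator mean. $S\mu S^*$ and $\mu^r$ are the push-forwards of $\mu$ by $A\mapsto SAS^*$ and $A\mapsto A^r$. *)

(* Defs.v *)
From HB Require Import structures.
From mathcomp Require Import all_boot all_order all_algebra.
From mathcomp Require Import all_classical all_reals all_analysis.
From mathcomp Require Import complex.

Set Implicit Arguments.
Unset Strict Implicit.
Unset Printing Implicit Defensive.

Import Order.TTheory GRing.Theory Num.Theory.
Import numFieldNormedType.Exports.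

Local Open Scope classical_set_scope.
Local Open Scope ring_scope.
Local Open Scope complex_scope.

(** Complex Hilbert spaces. The norm of a normed module over [R[i]] takes
    values in [R[i]], where [0 <= z] means that [z] is a nonnegative real. *)
HB.mixin Record isHilbert (R : realType) H of CompleteNormedModule R[i] H := {
  hdot : {dot H for @Num.conj R[i]} ;
  hdot_norm : forall x : H, hdot x x = `|x| ^+ 2
}.

#[short(type="hilbertType")]
HB.structure Definition Hilbert (R : realType) :=
  {H of CompleteNormedModule R[i] H & isHilbert R H}.

Definition separable_space (T : topologicalType) :=
  exists D : set T, countable D /\ dense D.

Section operators.
Context {R : realType} {H : hilbertType R}.
Implicit Types A B S T : H -> H.

Definition bounded_op T :=
  linear T /\ exists c : R, forall x, `|T x| <= c%:C * `|x|.

Definition invertible_op S :=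
  bounded_op S /\ exists T, [/\ bounded_op T, cancel S T & cancel T S].

Definition opnorm T : R :=
  sup [set complex.Re `|T x| | x in [set x : H | `|x| <= 1]].

Definition psd_op T := forall x, 0 <= hdot (T x) x.

Definition op_le A B := psd_op (B \- A).

Definition adjoint S : H -> H :=
  xget 0 [set T | bounded_op T /\ forall x y, hdot (S x) y = hdot x (T y)].

(* only used for positive operators, whose spectrum is real *)
Definition spectrum A : set R :=
  [set t | ~ invertible_op (fun x => A x - t%:C *: x)].

Definition poly_op (p : {poly R}) A : H -> H :=
  fun x => \sum_(i < size p) (p`_i)%:C *: iter i A x.

(** Continuous functional calculus: [f(A)] is the limit in operator norm of
    [p(A)] for polynomials [p] converging to [f] uniformly on the spectrum. *)
Definition is_fcalc (f : R -> R) A T :=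
  bounded_op T /\
  forall e : R, 0 < e -> exists p : {poly R},
    (forall t, spectrum A t -> `|f t - p.[t]| <= e) /\
    opnorm (T \- poly_op p A) <= e.

Definition fcalc (f : R -> R) A : H -> H := xget 0 [set T | is_fcalc f A T].

Definition op_pow A (r : R) : H -> H := fcalc (fun t => t `^ r) A.

Definition posinv_op A := [/\ bounded_op A, psd_op A & invertible_op A].

End operators.

Record posop {R : realType} (H : hilbertType R) :=
  Posop { opfun :> H -> H ; _ : `[< posinv_op opfun >] }.

HB.instance Definition _ {R : realType} (H : hilbertType R) :=
  [isSub for @opfun R H].
HB.instance Definition _ {R : realType} (H : hilbertType R) :=
  [Choice of posop H by <:].

Section opnorm_metric.
Context {R : realType} {H : hilbertType R}.
Implicit Types A B C : posop H.

Lemma posop_bounded A : bounded_op A.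
Proof. by case: A => T /= /asboolP[]. Qed.

Lemma hnorm_ReE (x : H) : (complex.Re `|x|)%:C = `|x|.
Proof. by apply: RRe_real; exact: normr_real. Qed.

Lemma hnorm_Re_le (x : H) (c : R) :
  (complex.Re `|x| <= c) = (`|x| <= c%:C).
Proof. by rewrite -[in RHS]hnorm_ReE lecR. Qed.

Lemma opnorm_has_sup A B :
  has_sup [set complex.Re `|(A \- B) x| | x in [set x : H | `|x| <= 1]].
Proof.
split.
  by exists (complex.Re `|(A \- B) 0|); exists 0 => //=; rewrite normr0 ler01.
have [_ [a hA]] := posop_bounded A; have [_ [b hB]] := posop_bounded B.
exists (Num.max 0 a + Num.max 0 b) => _ [x /= x1 <-].
rewrite hnorm_Re_le rmorphD /=.
apply: (le_trans (ler_normB _ _)); apply: lerD.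
- apply: (le_trans (hA x)); apply: (@le_trans _ _ ((Num.max 0 a)%:C * `|x|)).
    by apply: ler_wpM2r => //; rewrite lecR le_max lexx orbT.
  by rewrite ler_piMr // (lecR 0) le_max lexx.
- apply: (le_trans (hB x)); apply: (@le_trans _ _ ((Num.max 0 b)%:C * `|x|)).
    by apply: ler_wpM2r => //; rewrite lecR le_max lexx orbT.
  by rewrite ler_piMr // (lecR 0) le_max lexx.
Qed.

Lemma opnorm_ub A B (x : H) : `|x| <= 1 ->
  complex.Re `|A x - B x| <= opnorm (A \- B).
Proof. by move=> x1; apply: (sup_upper_bound (opnorm_has_sup A B)); exists x. Qed.

Definition posop_dist A B : R := opnorm (A \- B).

Lemma posop_distxx A : posop_dist A A = 0.
Proof.
apply/eqP; rewrite eq_le; apply/andP; split.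
  apply: ge_sup; first by case: (opnorm_has_sup A A).
  by move=> _ [x _ <-] /=; rewrite subrr normr0.
have := @opnorm_ub A A 0; rewrite normr0 ler01 subrr normr0; exact.
Qed.

Lemma posop_dist_sym A B : posop_dist A B = posop_dist B A.
Proof.
by congr sup; apply/seteqP; split=> _ [x x1 <-]; exists x; rewrite //= distrC.
Qed.

Lemma posop_dist_triangle B A C :
  posop_dist A C <= posop_dist A B + posop_dist B C.
Proof.
apply: ge_sup; first by case: (opnorm_has_sup A C).
move=> _ [x x1 <-]; rewrite hnorm_Re_le rmorphD /=.
have -> : A x - C x = (A x - B x) + (B x - C x) by rewrite addrA subrK.
by apply: (le_trans (ler_normD _ _)); apply: lerD;
  rewrite -hnorm_Re_le; exact: opnorm_ub.
Qed.

Lemma posop_dist_positivity A B : posop_dist A B = 0 -> A = B.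
Proof.
move=> AB0; apply: val_inj; apply/funext => x /=.
have [->|x0] := eqVneq x 0.
  have [lA _] := posop_bounded A; have [lB _] := posop_bounded B.
  have := lA (-1) 0 0; have := lB (-1) 0 0.
  by rewrite scaler0 addr0 !scaleN1r !addNr => -> ->.
have nx0 : `|x| != 0 by rewrite normr_eq0.
have := @opnorm_ub A B (`|x|^-1 *: x).
rewrite normrZ normfV normr_id mulVf // lexx => /(_ isT).
rewrite -/(posop_dist A B) AB0 hnorm_Re_le normr_le0.
have [lA _] := posop_bounded A; have [lB _] := posop_bounded B.
have homo (T : H -> H) : linear T -> forall a u, T (a *: u) = a *: T u.
  move=> lT a u.
  have T0 : T 0 = 0 by have := lT (-1) 0 0; rewrite scaler0 addr0 scaleN1r addNr.
  by have := lT a u 0; rewrite T0 !addr0.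
rewrite (homo _ lA) (homo _ lB) -scalerBr scaler_eq0 invr_eq0 (negPf nx0) /= subr_eq0.
by move/eqP.
Qed.

Lemma posinv_op_id : posinv_op (@idfun H).
Proof.
have b : bounded_op (@idfun H).
  by split=> //; exists 1 => x; rewrite mul1r.
split; first exact: b.
  by move=> x; rewrite hdot_norm exprn_ge0.
by split; [exact: b|exists idfun; split].
Qed.

Definition posop1 : posop H := Posop (asboolT posinv_op_id).

End opnorm_metric.

(** The norm topology. *)
HB.instance Definition _ {R : realType} (H : hilbertType R) :=
  isMetric.Build R (posop H) (@posop_distxx R H) (@posop_dist_positivity R H)
    (@posop_dist_sym R H) (@posop_dist_triangle R H).
HB.instance Definition _ {R : realType} (H : hilbertType R) :=
  isPointed.Build (posop H) posop1.

Section operator_means.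
Context {R : realType} {H : hilbertType R}.

(** [posop H] with the strong operator topology. *)
Definition sot_posop : Type :=
  initial_topology (@opfun R H : posop H -> {ptws H -> H}).
HB.instance Definition _ := Topological.on sot_posop.

(** [posop H] with the Borel sigma-algebra of the norm topology. *)
Definition borel_posop : Type := g_sigma_algebraType (@open (posop H)).
HB.instance Definition _ := Measurable.on borel_posop.

(* [T] itself whenever it is positive and invertible, which holds in all the
   uses below *)
Definition to_posop (T : H -> H) : posop H := insubd posop1 T.

Definition Sigma (e : R) : set (posop H) :=
  [set A | op_le (fun x => e%:C *: x) A /\ op_le A (fun x => (e^-1)%:C *: x)].

Implicit Types mu nu : probability borel_posop R.

Definition supp mu : set (posop H) :=
  [set A | forall U : set (posop H), open U -> U A -> (0 < mu U)%E].

Definition Pinf mu :=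
  mu (supp mu) = 1%E /\ exists e : R, 0 < e < 1 /\ supp mu `<=` Sigma e.

Definition upper_set (U : set (posop H)) :=
  forall A B : posop H, U A -> op_le A B -> U B.

Definition sto_le mu nu :=
  forall U : set (posop H), closed U -> upper_set U -> (mu U <= nu U)%E.

Definition sot_continuous_on (D : set sot_posop) (f : sot_posop -> R) :=
  {within D, continuous f}.

Definition sto_weak_cvg (mu_ : nat -> probability borel_posop R) mu :=
  exists e : R, [/\ 0 < e < 1,
    forall k, supp (mu_ k) `<=` Sigma e,
    supp mu `<=` Sigma e &
    forall f : posop H -> R,
      sot_continuous_on (Sigma e) f ->
      (exists c : R, forall A, Sigma e A -> `|f A| <= c) ->
      (fun k => (\int[mu_ k]_(A in Sigma e) f A)%R) @ \oo -->
      (\int[mu]_(A in Sigma e) f A)%R].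

Definition sto_incr_cvg (mu_ : nat -> probability borel_posop R) mu :=
  [/\ forall k, sto_le (mu_ k) (mu_ k.+1), forall k, sto_le (mu_ k) mu
    & sto_weak_cvg mu_ mu].

Definition sto_decr_cvg (mu_ : nat -> probability borel_posop R) mu :=
  [/\ forall k, sto_le (mu_ k.+1) (mu_ k), forall k, sto_le mu (mu_ k)
    & sto_weak_cvg mu_ mu].

(* all the maps [g] used below are Borel; the other branch is a dummy *)
Definition push (g : posop H -> posop H) mu : probability borel_posop R :=
  match pselect (measurable_fun [set: borel_posop]
                   (g : borel_posop -> borel_posop)) with
  | left mg => distribution mu (mfun_Sub (mem_set mg))
  | right _ => mu
  end.

Definition scale_posop (a : R) (A : posop H) : posop H :=
  to_posop (fun x => a%:C *: A x).

Definition congr_posop (S : H -> H) (A : posop H) : posop H :=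
  to_posop (S \o A \o adjoint S).

Definition pow_posop (r : R) (A : posop H) : posop H := to_posop (op_pow A r).

(** A map on the set [Pinf] is represented by a total map on Borel probability
    measures, of which only the values on [Pinf] are ever constrained or used.
    A [probability] is a function on all sets, but by [om_mono] such a map
    only depends on the values of the measure on Borel sets. *)
Record operator_mean (M : probability borel_posop R -> posop H) : Prop := {
  om_mono : forall mu nu, Pinf mu -> Pinf nu -> sto_le mu nu ->
    op_le (M mu) (M nu) ;
  om_homo : forall (a : R) mu, 0 < a -> Pinf mu ->
    M (push (scale_posop a) mu) = scale_posop a (M mu) ;
  om_cvg : forall (mu_ : nat -> probability borel_posop R) mu,
    (forall k, Pinf (mu_ k)) -> Pinf mu ->
    sto_decr_cvg mu_ mu \/ sto_incr_cvg mu_ mu ->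
    (fun k => M (mu_ k) : sot_posop) @ \oo --> (M mu : sot_posop) ;
  om_id : M (dirac (posop1 : borel_posop)) = posop1 }.

Definition congruence_invariant (M : probability borel_posop R -> posop H) :=
  forall mu (S : H -> H), Pinf mu -> invertible_op S ->
    congr_posop S (M mu) = M (push (congr_posop S) mu).

(** The two-variable operator mean with representing function [f]. *)
Definition KA_mean (f : R -> R) (A B : posop H) : posop H :=
  to_posop (op_pow A 2^-1 \o
    fcalc f (op_pow A (- 2^-1) \o B \o op_pow A (- 2^-1)) \o op_pow A 2^-1).

Definition left_mean (A B : posop H) : posop H := A.

(** The (unique) solution [X] of [X = M (X sigma mu)], for [sigma] the mean with
    representing function [f]. *)
Definition deformed_mean (M : probability borel_posop R -> posop H)
    (f : R -> R) mu : posop H :=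
  xget posop1 [set X | X = M (push (KA_mean f X) mu)].

End operator_means.

Arguments sot_posop {R} H.
Arguments borel_posop {R} H.
Arguments left_mean {R H}.

(** As usual, operator monotonicity refers to operators on all Hilbert spaces;
    continuity, needed for the functional calculus, is then automatic (it
    already follows from monotonicity on matrices). *)
Definition operator_monotone {R : realType} (f : R -> R) :=
  {in [pred x | 0 < x], continuous f} /\
  forall (K : hilbertType R) (A B : posop K),
    op_le A B -> op_le (fcalc f A) (fcalc f B).

Definition representing_function {R : realType} (f : R -> R) :=
  [/\ forall x, 0 < x -> 0 < f x, operator_monotone f & f 1 = 1].

(** Representing function of [sigma_s]. *)
Definition KA_power {R : realType} (f : R -> R) (s : R) : R -> R :=
  fun x => f (x `^ s).

(* Main.v *)
(** Fixed points of [F X = M (X sigma mu)] are compared through the ratio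
    [a] of two positive operators. If [X <= a Y], the transformer inequality
    [C f(Z) C^* <= f(C Z C^* )] of Hansen, for contractions [C], gives
    [X sigma A <= a b (Y sigma A)] as soon as [f (t / a) <= b f t] on the
    relevant interval; [f] being strictly increasing, [b < 1] is possible when
    [a > 1]. Hence [X <= F X] and [F Y <= Y] imply [X <= Y], and iterating [F]
    from [e^-1 I] and [e I] produces two sequences whose ratio tends to [1],
    so that their common norm limit is the fixed point.

    If [X = M_sigma mu >= I], then [X^(-1/2)] is a contraction, and Hansen's
    inequality for the operator monotone function [t^(1/r)] gives
    [X^(-1/2) A X^(-1/2) <= (X^(-1/2) A^r X^(-1/2))^(1/r)]. Applying [f] and
    averaging, [X = M (X sigma mu) <= M (X sigma_(1/r) mu^r)], so [X] lies
    below the fixed point [M_(sigma_(1/r)) (mu^r)]. The case [X <= I] is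
    symmetric. *)
Require Import Defs.
From HB Require Import structures.
From mathcomp Require Import all_boot all_order all_algebra.
From mathcomp Require Import all_classical all_reals all_analysis.
From mathcomp Require Import complex.
From mathcomp Require Import ring lra.

Set Implicit Arguments.
Unset Strict Implicit.
Unset Printing Implicit Defensive.

Import Order.TTheory GRing.Theory Num.Theory.
Import numFieldNormedType.Exports.

Local Open Scope classical_set_scope.
Local Open Scope ring_scope.
Local Open Scope complex_scope.

(** * Real inner product *)

(** [deformed_mean] and [fcalc] are choices with a default value, so nothing can be said about them
    before a solution is exhibited and, for [fcalc], shown to be unique. For the calculus, [FC]
    replaces the spectrum by an interval: real inequalities on [[m, M]] become operator
    inequalities, and the key estimate, that the norm of [p(A)] is at most the supremum of [|p|],
    comes from factoring polynomials over [R[i]]. For the fixed point, the ratio argument needs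
    strict monotonicity, whereas operator monotonicity only gives [f s <= f t]; strictness comes
    from 2x2 matrices, which make a flat piece of [f] spread to the whole half-line. Both this and
    Hansen's inequality apply monotonicity on [hsum H], a Hilbert space other than [H]. That sigma
    differs from the left mean supplies a nonzero vector and a nonconstant [f]. Scalar factors cross
    [M] by homogeneity, so a ratio bound for [X sigma A], uniform over the support of [mu], becomes
    one for [F X]. *)

Lemma le_of_eq (R : realType) (a b : R) : a = b -> a <= b.
Proof. by move=> ->. Qed.

Section real_inner_product.
Context {R : realType} {H : hilbertType R}.
Implicit Types (x y z : H) (a b c r : R).

(** Real parts, so that estimates live in the ordered field [R], where [lra] and [nra] work. Nothing
    is lost: [nmE] recovers the norm, and [ip_il] the imaginary part of [hdot]. *)
Definition nm x : R := complex.Re `|x|.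
Definition ip x y : R := complex.Re (hdot x y).

Lemma ReD (u v : R[i]) : complex.Re (u + v) = complex.Re u + complex.Re v.
Proof. by case: u; case: v. Qed.

Lemma ReN (u : R[i]) : complex.Re (- u) = - complex.Re u.
Proof. by case: u. Qed.

Lemma ReMr r (u : R[i]) : complex.Re (r%:C * u) = r * complex.Re u.
Proof. by case: u => p q /=; rewrite mul0r subr0. Qed.

Lemma ipDl x y z : ip (x + y) z = ip x z + ip y z.
Proof. by rewrite /ip linearDl ReD. Qed.

Lemma ipC x y : ip x y = ip y x.
Proof.
rewrite /ip (@hermC _ _ _ _ hdot) /= expr0 mul1r.
by case: (hdot y x).
Qed.

Lemma ipDr x y z : ip x (y + z) = ip x y + ip x z.
Proof. by rewrite ipC ipDl !(ipC x). Qed.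

Lemma ipZl r x y : ip (r%:C *: x) y = r * ip x y.
Proof. by rewrite /ip linearZl_LR /= ReMr. Qed.

Lemma ipZr r x y : ip x (r%:C *: y) = r * ip x y.
Proof. by rewrite ipC ipZl ipC. Qed.

Lemma ipNl x y : ip (- x) y = - ip x y.
Proof. by rewrite /ip linearNl ReN. Qed.

Lemma ipNr x y : ip x (- y) = - ip x y.
Proof. by rewrite ipC ipNl ipC. Qed.

Lemma ip0l x : ip 0 x = 0.
Proof. by rewrite /ip linear0l. Qed.

Lemma ip0r x : ip x 0 = 0.
Proof. by rewrite ipC ip0l. Qed.

Lemma ip_il x y : ip ('i%C *: x) y = - complex.Im (hdot x y).
Proof.
rewrite /ip linearZl_LR /=.
by case: (hdot x y) => p q /=; rewrite mul0r mul1r add0r.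
Qed.

Lemma ip_i x y : ip x ('i%C *: y) = - ip ('i%C *: x) y.
Proof.
rewrite ipC !ip_il (@hermC _ _ _ _ hdot) /= expr0 mul1r.
by case: (hdot x y) => p q /=.
Qed.

Lemma nmE x : (nm x)%:C = `|x|.
Proof. exact: hnorm_ReE. Qed.

Lemma nm_ge0 x : 0 <= nm x.
Proof. by rewrite -(@lecR R) nmE; exact: normr_ge0. Qed.

Lemma ipxx x : ip x x = nm x ^+ 2.
Proof. by rewrite /ip hdot_norm -nmE -rmorphXn. Qed.

Lemma nm0 : nm 0 = 0.
Proof. by rewrite /nm normr0. Qed.

Lemma nm_eq0 x : nm x = 0 -> x = 0.
Proof. by move=> h; apply/normr0_eq0; rewrite -nmE h. Qed.

Lemma nmD x y : nm (x + y) <= nm x + nm y.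
Proof. by rewrite -lecR rmorphD /= !nmE ler_normD. Qed.

Lemma nmZ r x : nm (r%:C *: x) = `|r| * nm x.
Proof.
apply: (@complexI R); rewrite nmE normrZ rmorphM /= nmE; congr (_ * _).
by rewrite normc_def /= expr0n /= addr0 sqrtr_sqr.
Qed.

Lemma nmN x : nm (- x) = nm x.
Proof. by rewrite /nm normrN. Qed.

Lemma nmB x y : nm (x - y) = nm (y - x).
Proof. by rewrite -nmN opprB. Qed.

Lemma nmi x : nm ('i%C *: x) = nm x.
Proof.
apply: (@complexI R); rewrite !nmE normrZ.
by rewrite normc_def /= expr0n /= add0r expr1n sqrtr1 mul1r.
Qed.

Lemma nm2D x y : nm (x + y) ^+ 2 = nm x ^+ 2 + 2 * ip x y + nm y ^+ 2.
Proof. rewrite -!ipxx ipDl !ipDr (ipC y x); lra. Qed.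

Lemma nm2B x y : nm (x - y) ^+ 2 = nm x ^+ 2 - 2 * ip x y + nm y ^+ 2.
Proof. by rewrite nm2D ipNr nmN mulrN. Qed.

Lemma ler_sq a b : 0 <= b -> a ^+ 2 <= b ^+ 2 -> a <= b.
Proof.
move=> b0 h; case: (leP a 0) => [a0|a0]; first exact: le_trans b0.
by rewrite -(@ler_pXn2r _ 2%N) // nnegrE ltW.
Qed.

Lemma discr_le (p q s : R) : (forall t, 0 <= p * t ^+ 2 + 2 * q * t + s) ->
  0 <= p -> q ^+ 2 <= p * s.
Proof.
move=> h p0; have s0 : 0 <= s by have := h 0; rewrite expr0n /= !mulr0 !add0r.
move: p0; rewrite le_eqVlt => /orP[/eqP p0|p0].
  have [->|q0] := eqVneq q 0; first by rewrite expr0n /= -p0 mul0r.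
  (* With [p = 0] the polynomial is affine; at this point its value is [-1]. *)
  have := h (- (s + 1) / (2 * q)); rewrite -p0 mul0r add0r.
  rewrite mulrCA divff ?mulf_neq0 ?pnatr_eq0 //.
  by rewrite mulr1; lra.
have := h (- q / p); have -> : p * (- q / p) ^+ 2 + 2 * q * (- q / p) + s = (p * s - q ^+ 2) / p.
  by field; lra.
by rewrite pmulr_lge0 ?invr_gt0 // subr_ge0.
Qed.

Lemma ipCS x y : ip x y <= nm x * nm y.
Proof.
apply: ler_sq; first by rewrite mulr_ge0 ?nm_ge0.
rewrite exprMn; apply: discr_le; last exact: sqr_ge0.
move=> t; have := sqr_ge0 (nm (t%:C *: x + y)).
by rewrite -ipxx ipDl !ipDr !ipZl !ipZr !ipxx (ipC y x); lra.
Qed.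

Lemma ip_norm_le x y : `|ip x y| <= nm x * nm y.
Proof. by rewrite ler_norml ipCS andbT lerNl -ipNl -[nm x]nmN ipCS. Qed.

Lemma hcauchy (u : nat -> H) :
  (forall e, 0 < e -> exists N, forall n k, (N <= n)%N -> (N <= k)%N ->
     nm (u n - u k) <= e) ->
  exists l, forall e, 0 < e -> exists N, forall n, (N <= n)%N -> nm (u n - l) <= e.
Proof.
move=> hu.
have : cauchy (u @ \oo).
  apply: cauchy_exP => e e0.
  have e0' : 0 < complex.Re e.
    by move: e0; rewrite ltcE /= => /andP[].
  have eE : e = (complex.Re e)%:C.
    by move: e0; rewrite ltcE /= => /andP[/eqP h _]; case: e h {e0'} => p q /= ->.
  have [N hN] := hu (complex.Re e / 2) ltac:(by rewrite divr_gt0).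
  exists (u N); exists N => // n /= Nn.
  rewrite -ball_normE /= eE -nmE ltcR; apply: le_lt_trans (hN N n _ _) _ => //.
  by rewrite ltr_pdivrMr // ltr_pMr // ltr1n.
move/cauchy_cvgP => /cvg_ex[l hl]; exists l => e e0.
have e0' : 0 < e%:C by rewrite (ltcR 0).
move/cvgrPdist_le : hl => /(_ _ e0') [N _ hN]; exists N => n Nn.
by have := hN n Nn; rewrite -nmE nmB lecR.
Qed.

End real_inner_product.

(** * Polynomials of self-adjoint operators *)

Section bounded_operators.
Context {R : realType} {H : hilbertType R}.
Implicit Types (x y z : H) (a b c d r t : R) (A B S T : H -> H).

Definition nb c T := forall x, nm (T x) <= c * nm x.
(** For complex linear [T] this real symmetry already is self-adjointness: replacing [y] by [i y]
    yields the imaginary parts. *)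
Definition sa T := forall x y, ip (T x) y = ip x (T y).

Lemma linD T x y : linear T -> T (x + y) = T x + T y.
Proof. by move=> l; have := l 1 x y; rewrite !scale1r. Qed.

Lemma lin0 T : linear T -> T 0 = 0.
Proof. by move=> l; have := l (-1) 0 0; rewrite scaler0 addr0 scaleN1r addNr. Qed.

Lemma linZ T (k : R[i]) x : linear T -> T (k *: x) = k *: T x.
Proof. by move=> l; have := l k x 0; rewrite (lin0 l) !addr0. Qed.

Lemma linN T x : linear T -> T (- x) = - T x.
Proof. by move=> l; rewrite -scaleN1r (linZ _ _ l) scaleN1r. Qed.

Lemma linB T x y : linear T -> T (x - y) = T x - T y.
Proof. by move=> l; rewrite (linD _ _ l) (linN _ l). Qed.

Lemma bounded_opP T : bounded_op T <-> linear T /\ exists c, nb c T.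
Proof.
split=> -[l [c h]]; split=> //; exists c => x.
  by rewrite -lecR rmorphM /= !nmE.
by rewrite -!nmE -rmorphM /= lecR.
Qed.

Lemma bounded_op_lin T : bounded_op T -> linear T.
Proof. by case. Qed.

Lemma nbW c c' T : c <= c' -> nb c T -> nb c' T.
Proof. by move=> cc h x; apply: le_trans (h x) _; rewrite ler_wpM2r // nm_ge0. Qed.

Lemma bounded_op_nb T : bounded_op T -> exists c, 0 < c /\ nb c T.
Proof.
move=> /bounded_opP[_ [c h]]; exists (Num.max 1 c).
by rewrite lt_max ltr01; split=> //; apply: nbW h; rewrite le_max lexx orbT.
Qed.

Lemma bop_id : bounded_op (fun x : H => x).
Proof. by apply/bounded_opP; split=> //; exists 1 => x; rewrite mul1r. Qed.

Lemma bop_scale (k : R) : bounded_op (fun x : H => k%:C *: x).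
Proof.
apply/bounded_opP; split.
  by move=> a u v; rewrite scalerDr !scalerA mulrC.
by exists `|k| => x; rewrite nmZ.
Qed.

Lemma bop_comp S T : bounded_op S -> bounded_op T -> bounded_op (fun x => S (T x)).
Proof.
move=> bS bT; have [lS _] := bS; have [lT _] := bT.
have [c [c0 hc]] := bounded_op_nb bS; have [d [d0 hd]] := bounded_op_nb bT.
apply/bounded_opP; split; first by move=> a u v; rewrite lT lS.
exists (c * d) => x; apply: le_trans (hc _) _.
by rewrite -mulrA ler_wpM2l // ltW.
Qed.

Lemma bop_add S T : bounded_op S -> bounded_op T -> bounded_op (fun x => S x + T x).
Proof.
move=> bS bT; have [lS _] := bS; have [lT _] := bT.
have [c [c0 hc]] := bounded_op_nb bS; have [d [d0 hd]] := bounded_op_nb bT.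
apply/bounded_opP; split.
  by move=> a u v; rewrite lT lS scalerDr addrACA.
by exists (c + d) => x; apply: le_trans (nmD _ _) _; rewrite mulrDl lerD.
Qed.

Lemma bop_scalel (k : R) T : bounded_op T -> bounded_op (fun x => k%:C *: T x).
Proof. by move=> bT; exact: (bop_comp (bop_scale k) bT). Qed.

Lemma bop_opp T : bounded_op T -> bounded_op (fun x => - T x).
Proof.
move=> bT; have -> : (fun x => - T x) = (fun x => (-1)%:C *: T x).
  by apply/funext => x; rewrite rmorphN scaleN1r.
exact: bop_scalel.
Qed.

Lemma bop_sub S T : bounded_op S -> bounded_op T -> bounded_op (fun x => S x - T x).
Proof. by move=> bS bT; exact: (bop_add bS (bop_opp bT)). Qed.

(** Complex coefficients, because polynomials are split into linear factors over the closed field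
    [R[i]]. *)
Definition cpoly (p : {poly R[i]}) A : H -> H :=
  fun x => \sum_(i < size p) p`_i *: iter i A x.

Lemma cpoly_widen n (p : {poly R[i]}) A x : (size p <= n)%N ->
  cpoly p A x = \sum_(i < n) p`_i *: iter i A x.
Proof.
move=> h; rewrite /cpoly (big_ord_widen n (fun i => p`_i *: iter i A x)) //.
rewrite big_mkcond /=; apply: eq_bigr => i _; case: ltnP => // hi.
by rewrite nth_default // scale0r.
Qed.

Lemma poly_opE p A : poly_op p A = cpoly (map_poly (real_complex R) p) A.
Proof.
apply/funext => x; rewrite /poly_op /cpoly size_map_poly.
by apply: eq_bigr => i _; rewrite coef_map.
Qed.

Lemma cpoly0 A x : cpoly 0 A x = 0.
Proof. by rewrite /cpoly size_poly0 big_ord0. Qed.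

Lemma cpolyD p p' A x : cpoly (p + p') A x = cpoly p A x + cpoly p' A x.
Proof.
pose n := maxn (size p) (size p').
rewrite !(@cpoly_widen n) ?leq_maxl ?leq_maxr ?size_polyD //.
by rewrite -big_split; apply: eq_bigr => i _; rewrite coefD scalerDl.
Qed.

Lemma cpolyZ k p A x : cpoly (k *: p) A x = k *: cpoly p A x.
Proof.
rewrite !(@cpoly_widen (size p)) ?size_scale_leq //.
by rewrite scaler_sumr; apply: eq_bigr => i _; rewrite coefZ scalerA.
Qed.

Lemma cpolyMX p A x : cpoly (p * 'X) A x = cpoly p A (A x).
Proof.
rewrite (@cpoly_widen (size p).+1); last first.
  by apply: leq_trans (size_polyMleq _ _) _; rewrite size_polyX addn2.
rewrite big_ord_recl coefMX /= scale0r add0r /cpoly; apply: eq_bigr => i _.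
by rewrite coefMX -iterSr.
Qed.

Lemma cpolyC k A x : cpoly k%:P A x = k *: x.
Proof.
by rewrite (@cpoly_widen 1) ?size_polyC_leq1 // big_ord1 coefC.
Qed.

Lemma cpoly_comm p A x : linear A -> cpoly p A (A x) = A (cpoly p A x).
Proof.
move=> lA; elim/poly_ind: p x => [|p c IH] x; first by rewrite !cpoly0 (lin0 lA).
by rewrite !cpolyD !cpolyMX !cpolyC IH (linD _ _ lA) (linZ _ _ lA) IH.
Qed.

Lemma cpolyM p p' A x : linear A -> cpoly (p * p') A x = cpoly p A (cpoly p' A x).
Proof.
move=> lA; elim/poly_ind: p x => [|p c IH] x; first by rewrite mul0r !cpoly0.
rewrite mulrDl -mulrA -commr_polyX mulrA !cpolyD !cpolyMX IH cpolyC.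
by rewrite cpoly_comm // mul_polyC cpolyZ.
Qed.

Lemma poly_op0 A x : poly_op 0 A x = 0.
Proof. by rewrite poly_opE map_poly0 cpoly0. Qed.

Lemma poly_opC r A x : poly_op r%:P A x = r%:C *: x.
Proof. by rewrite poly_opE map_polyC cpolyC. Qed.

Lemma poly_opD p p' A x : poly_op (p + p') A x = poly_op p A x + poly_op p' A x.
Proof. by rewrite !poly_opE rmorphD cpolyD. Qed.

Lemma poly_opMX p A x : poly_op (p * 'X) A x = poly_op p A (A x).
Proof. by rewrite !poly_opE rmorphM /= map_polyX cpolyMX. Qed.

Lemma poly_opM p p' A x : linear A ->
  poly_op (p * p') A x = poly_op p A (poly_op p' A x).
Proof. by move=> lA; rewrite !poly_opE rmorphM cpolyM. Qed.

Lemma poly_opN p A x : poly_op (- p) A x = - poly_op p A x.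
Proof. by rewrite !poly_opE rmorphN -scaleN1r cpolyZ scaleN1r. Qed.

Lemma poly_opB p p' A x : poly_op (p - p') A x = poly_op p A x - poly_op p' A x.
Proof. by rewrite poly_opD poly_opN. Qed.

Lemma poly_opX A x : poly_op 'X A x = A x.
Proof. by rewrite -['X]mul1r poly_opMX poly_opC scale1r. Qed.

Lemma poly_op_comm p A x : linear A -> poly_op p A (A x) = A (poly_op p A x).
Proof. by move=> lA; rewrite !poly_opE cpoly_comm. Qed.

Lemma bop_poly p A : bounded_op A -> bounded_op (poly_op p A).
Proof.
move=> bA; elim/poly_ind: p => [|p r IH].
  have -> : poly_op 0 A = (fun x => 0%:C *: x).
    by apply/funext => x; rewrite poly_op0 scale0r.
  exact: bop_scale.
have -> : poly_op (p * 'X + r%:P) A = (fun x => poly_op p A (A x) + r%:C *: x).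
  by apply/funext => x; rewrite poly_opD poly_opMX poly_opC.
by apply: bop_add; [exact: bop_comp|exact: bop_scale].
Qed.

Lemma sa_poly p A : linear A -> sa A -> sa (poly_op p A).
Proof.
move=> lA hA; elim/poly_ind: p => [|p r IH] x y.
  by rewrite !poly_op0 ip0l ip0r.
by rewrite !poly_opD !poly_opMX !poly_opC ipDl ipDr IH hA poly_op_comm // ipZl ipZr.
Qed.

(* approximate point spectrum *)
Definition asp A t := forall d, 0 < d ->
  exists x, nm (A x - t%:C *: x) < d * nm x.

Lemma sa_ip_i0 A x : linear A -> sa A -> ip (A x) ('i%C *: x) = 0.
Proof.
move=> lA hA; have := ip_i x (A x); rewrite -(linZ _ _ lA) -hA (ipC _ (A x)); lra.
Qed.

(** With [z = p + i r], the cross term between [(A - p) x] and [i r x] vanishes by self-adjointness,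
    which leaves [|(A - p) x|^2 + r^2 |x|^2] for the squared norm. *)
Lemma bbelow_nonreal A (z : R[i]) : linear A -> sa A ->
  forall x, `|complex.Im z| * nm x <= nm (A x - z *: x).
Proof.
move=> lA hA x; apply: ler_sq; first exact: nm_ge0.
case: z => p r /=; rewrite exprMn real_normK ?num_real //.
have -> : A x - (p +i* r) *: x = (A x - p%:C *: x) - r%:C *: ('i%C *: x).
  rewrite -addrA -opprD scalerA -scalerDl; congr (_ - _ *: _).
  by apply/eqP; rewrite eq_complex /=; apply/andP; split; apply/eqP; ring.
rewrite nm2B ipZr nmZ nmi ipDl ipNl ipZl (sa_ip_i0 _ lA hA).
have := ip_i x x; rewrite (ipC _ x) => h.
rewrite exprMn real_normK ?num_real //.
have := sqr_ge0 (nm (A x - p%:C *: x)); have -> : ip x ('i *: x) = 0 by lra.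
lra.
Qed.

Lemma bbelow_prod A (zs : seq R[i]) : linear A -> sa A ->
  (forall w : R[i], w \in zs -> complex.Im w = 0 -> ~ asp A (complex.Re w)) ->
  exists d, 0 < d /\
    forall x, d * nm x <= nm (cpoly (\prod_(w <- zs) ('X - w%:P)) A x).
Proof.
move=> lA hA; elim: zs => [|z zs IH] h.
  exists 1; rewrite ltr01; split=> // x.
  by rewrite big_nil cpolyC scale1r mul1r.
have [w wzs|d [d0 hd]] := IH; first by apply: h; rewrite inE wzs orbT.
have [k [k0 hk]] : exists k, 0 < k /\ forall x, k * nm x <= nm (A x - z *: x).
  have [z0|z0] := eqVneq (complex.Im z) 0; last first.
    by exists `|complex.Im z|; rewrite normr_gt0 z0; split=> //; exact: bbelow_nonreal.
  have := h z (mem_head _ _) z0; rewrite /asp.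
  move=> /existsNP[k /not_implyP[k0 hk]]; exists k; split=> // x.
  rewrite leNgt; apply/negP => hx; apply: hk; exists x.
  by case: z z0 hx {h} => p q /= ->.
exists (k * d); rewrite mulr_gt0 //; split=> // x.
rewrite big_cons cpolyM // cpolyD -polyCN cpolyC -[X in cpoly X]mul1r cpolyMX.
rewrite -[1]/(1%:P) cpolyC scale1r scaleNr.
by apply: le_trans (hk _); rewrite -mulrA ler_wpM2l // ltW.
Qed.

(** A product of operators bounded below is bounded below. If [p(A)] is not, one of its linear
    factors is not, and by [bbelow_nonreal] the root of that factor is real. *)
Lemma asp_root A (p : {poly R[i]}) : linear A -> sa A -> p != 0 ->
  (forall d, 0 < d -> exists x, nm (cpoly p A x) < d * nm x) ->
  exists t, root p t%:C /\ asp A t.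
Proof.
move=> lA hA p0 hp; apply: contrapT => hn.
have [zs pE] := closed_field_poly_normal p.
have [z zzs z0 az|d [d0 hd]] := @bbelow_prod A zs lA hA.
  apply: hn; exists (complex.Re z); split=> //.
  have -> : (complex.Re z)%:C = z by case: z z0 {zzs az} => u v /= ->.
  by rewrite pE rootZ ?lead_coef_eq0 // root_prod_XsubC.
have l0 : 0 < complex.Re `|lead_coef p|.
  by rewrite -ltcR RRe_real ?normr_real // normr_gt0 lead_coef_eq0.
have [x] := hp (complex.Re `|lead_coef p| * d) (mulr_gt0 l0 d0).
rewrite {1}pE cpolyZ => hx.
have := hd x; rewrite leNgt => /negP; apply.
rewrite -(ltr_pM2l l0) mulrA; apply: le_lt_trans hx.
by rewrite -lecR rmorphM /= !nmE normrZ.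
Qed.

(** [b] is the norm of [B]. Expanding the square gives [nm (B (B x) - b^2 x)^2 <= b^2 (b^2 nm x^2 -
    nm (B x)^2)], so a vector that nearly attains the norm is an approximate eigenvector of
    [B^2]. *)
Lemma sa_norm_asp B c : linear B -> sa B -> (exists k, nb k B) -> 0 <= c ->
  ~ nb c B -> exists b, [/\ c < b, nb b B &
    forall d, 0 < d -> exists x, nm (B (B x) - (b ^+ 2)%:C *: x) < d * nm x].
Proof.
move=> lB hB [k hk] c0 hc.
pose E := [set a | 0 <= a /\ nb a B].
have E0 : E !=set0.
  exists (Num.max 0 k); split; first by rewrite le_max lexx.
  by apply: nbW hk; rewrite le_max lexx orbT.
have lbE : has_lbound E by exists 0 => a [].
have iE : has_inf E by [].
pose b := inf E.
have b0 : 0 <= b by apply: lb_le_inf => // a [].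
have nbb : nb b B.
  move=> x; have [x0|x0] := eqVneq (nm x) 0.
    by rewrite x0 mulr0 (nm_eq0 x0) (lin0 lB) nm0.
  have x0' : 0 < nm x by rewrite lt_def x0 nm_ge0.
  rewrite -ler_pdivrMr //; apply: lb_le_inf => // a [_ ha].
  by rewrite ler_pdivrMr.
have cb : c < b.
  rewrite ltNge; apply/negP => bc; apply: hc; exact: nbW nbb.
have bp : 0 < b by exact: le_lt_trans cb.
exists b; split=> // d d0.
(* Since [b + b' <= 2 b], this gap gives [b^2 (b^2 - b'^2) <= d^2]; the maximum with [0] allows
   squaring [b' nm x < nm (B x)]. *)
pose b' := Num.max 0 (b - d ^+ 2 / (2 * b ^+ 3)).
have dd : 0 < d ^+ 2 / (2 * b ^+ 3) by rewrite divr_gt0 ?mulr_gt0 ?exprn_gt0.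
have b'b : b' < b by rewrite /b' gt_max bp /=; lra.
have b'0 : 0 <= b' by rewrite /b' le_max lexx.
have : ~ nb b' B.
  move=> h; have : b <= b' by apply: ge_inf => //; split.
  by rewrite leNgt b'b.
move=> /existsNP[x /negP]; rewrite -ltNge => hx; exists x.
have x0 : 0 < nm x.
  rewrite lt_def nm_ge0 andbT; apply/eqP => x0.
  by move: hx; rewrite x0 (nm_eq0 x0) (lin0 lB) nm0 mulr0 ltxx.
rewrite -(@ltr_pXn2r _ 2%N) // ?nnegrE ?nm_ge0 ?mulr_ge0 ?nm_ge0 ?ltW //.
rewrite nm2B ipZr hB ipxx nmZ !exprMn real_normK ?num_real //.
have h1 : nm (B (B x)) ^+ 2 <= b ^+ 2 * nm (B x) ^+ 2.
  by rewrite -exprMn ler_pXn2r ?nnegrE ?nm_ge0 ?mulr_ge0 ?nm_ge0.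
have h2 : b' ^+ 2 * nm x ^+ 2 < nm (B x) ^+ 2.
  by rewrite -exprMn ltr_pXn2r ?nnegrE ?nm_ge0 ?mulr_ge0 ?nm_ge0.
have h3 : b ^+ 2 * (b ^+ 2 - b' ^+ 2) <= d ^+ 2.
  have h4 : b - b' <= d ^+ 2 / (2 * b ^+ 3).
    have : b - d ^+ 2 / (2 * b ^+ 3) <= b' by rewrite /b' le_max lexx orbT.
    lra.
  have -> : d ^+ 2 = b ^+ 2 * (2 * b) * (d ^+ 2 / (2 * b ^+ 3)).
    by field; lra.
  have -> : b ^+ 2 * (b ^+ 2 - b' ^+ 2) = b ^+ 2 * (b + b') * (b - b') by ring.
  apply: ler_pM => //; [|lra|].
    by rewrite mulr_ge0 ?exprn_ge0 //; lra.
  by rewrite ler_wpM2l ?exprn_ge0 //; lra.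
have h5 : b ^+ 2 * (b ^+ 2 - b' ^+ 2) * nm x ^+ 2 <= d ^+ 2 * nm x ^+ 2.
  by rewrite ler_wpM2r ?exprn_ge0 // ltW.
have h6 : b ^+ 2 * (b' ^+ 2 * nm x ^+ 2) < b ^+ 2 * nm (B x) ^+ 2.
  by rewrite ltr_pM2l ?exprn_gt0.
move: h1 h5 h6; set p1 := nm (B (B x)) ^+ 2; set p2 := nm (B x) ^+ 2.
by set p3 := nm x ^+ 2; lra.
Qed.

(* If [b] is the norm of [p(A)], then [p^2 - b^2] is not bounded below at [A];
   splitting it into linear factors yields [t] in the approximate point spectrum
   with [p(t)^2 = b^2]. *)
Lemma nb_poly A p c : bounded_op A -> sa A -> 0 <= c ->
  (forall t, asp A t -> `|p.[t]| <= c) -> nb c (poly_op p A).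
Proof.
move=> bA hA c0 hp; have [lA _] := bA; apply: contrapT => hn.
have [lB [k hk]] := (bounded_opP _).1 (bop_poly p bA).
have [b [cb nbb hb]] := sa_norm_asp lB (sa_poly p lA hA) (ex_intro _ k hk) c0 hn.
have b0 : 0 < b by exact: le_lt_trans cb.
suff [t [pt at_]] : exists t, p.[t] ^+ 2 = b ^+ 2 /\ asp A t.
  have := hp t at_; rewrite leNgt => /negP; apply.
  have -> // : `|p.[t]| = b.
  apply/eqP; rewrite -(@eqrXn2 _ 2%N) // ?ltW // -pt real_normK ?num_real //.
(* If [p^2] is the constant [b^2] there is nothing to factor, and any point of [asp A] will do. One
   exists: [0] if [A = 0], otherwise a root of [X^2 - a^2] with [a] the norm of [A]. *)
have [r0|r0] := eqVneq (p * p - (b ^+ 2)%:P) 0.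
  suff [t at_] : exists t, asp A t.
    exists t; split=> //; apply/eqP; rewrite -subr_eq0.
    by have := congr1 (horner^~ t) r0; rewrite /= !hornerE => <-.
  have [x hx] := hb 1 ltr01.
  have x0 : 0 < nm x.
    rewrite lt_def nm_ge0 andbT; apply/eqP => x0; move: hx.
    by rewrite x0 (nm_eq0 x0) mulr0 ltNge nm_ge0.
  have [nA|nA] := pselect (nb 0 A).
    exists 0 => d d0; exists x; rewrite scale0r subr0.
    by apply: le_lt_trans (nA x) _; rewrite mul0r mulr_gt0.
  have [kA [_ nkA]] := bounded_op_nb bA.
  have [a [a0 _ ha]] := sa_norm_asp lA hA (ex_intro _ kA nkA) (lexx _) nA.
  have X2 : ('X * 'X - ((a ^+ 2)%:C)%:P : {poly R[i]}) != 0.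
    rewrite -size_poly_gt0 -expr2 size_XnsubC //.
  have [|t [_ at_]] := asp_root lA hA X2; last by exists t.
  move=> d /ha[y hy]; exists y; congr (_ < _) : hy; congr nm.
  rewrite cpolyD cpolyMX -polyCN cpolyC -['X]mul1r cpolyMX -[1]/(1%:P) cpolyC.
  by rewrite scale1r scaleNr.
have r0' : map_poly (real_complex R) (p * p - (b ^+ 2)%:P) != 0.
  by rewrite map_poly_eq0.
have [|t [rt at_]] := asp_root lA hA r0'.
  move=> d /hb[y hy]; exists y; congr (_ < _) : hy; congr nm.
  by rewrite -poly_opE poly_opB poly_opM // poly_opC.
exists t; split=> //; move: rt; rewrite fmorph_root /root !hornerE subr_eq0.
by move/eqP.
Qed.

End bounded_operators.

(** * Weierstrass approximation *)

Section weierstrass.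
Context {R : realType}.
Implicit Types (a b c d e x y : R) (f g : R -> R).

(** Two-sided limits at the endpoints too: every function used is continuous beyond the interval. *)
Definition cont_on a b f := forall x, a <= x <= b -> {for x, continuous f}.

Lemma contP f x : {for x, continuous f} -> forall e, 0 < e ->
  exists d, 0 < d /\ forall y, `|y - x| < d -> `|f y - f x| <= e.
Proof.
move=> /cvgrPdist_le h e /h /nbhs_ballP[d /= d0 hd]; exists d; split=> // y yx.
by rewrite distrC; apply: hd; rewrite /ball /= distrC.
Qed.

(** Heine-Cantor by a supremum [s] of the [c] for which [[a, c]] has a modulus. Two close points lie
    both below some such [c] near [s], or both near [s]; so a modulus exists up to [s + d / 2],
    which must reach [b]. *)
Lemma cont_on_unif a b f : a <= b -> cont_on a b f -> forall e, 0 < e ->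
  exists d, 0 < d /\ forall x y, a <= x <= b -> a <= y <= b -> `|x - y| < d ->
    `|f x - f y| <= e.
Proof.
move=> ab cf e e0.
pose good c := exists d, 0 < d /\ forall x y, a <= x <= c -> a <= y <= c ->
  `|x - y| < d -> `|f x - f y| <= e.
pose S := [set c | a <= c <= b /\ good c].
have e20 : 0 < e / 2 by rewrite divr_gt0.
have Sa : S a.
  split; first by rewrite lexx.
  exists 1; split=> // x y hx hy _.
  have -> : x = a by lra.
  have -> : y = a by lra.
  by rewrite subrr normr0 ltW.
have supS : has_sup S by split; [exists a|exists b => c [/andP[]]].
pose s := sup S.
have as_ : a <= s by apply: (sup_upper_bound supS).
have sb : s <= b by apply: ge_sup; [exists a|move=> c [/andP[]]].
have [d [d0 hd]] := contP (cf s ltac:(by rewrite as_ sb)) e20.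
have [c Sc cs] := sup_adherent (divr_gt0 d0 (ltr0Sn R 1)) supS.
have {Sc}[/andP[ac cb] [k [k0 hk]]] := Sc.
have goodm : good (Num.min b (s + d / 2)).
  exists (Num.min k (d / 2)); split; first by rewrite lt_min k0 divr_gt0.
  move=> x y /andP[ax]; rewrite le_min => /andP[xb xs] /andP[ay].
  rewrite le_min => /andP[yb ys]; rewrite lt_min => /andP[xyk xyd].
  have [/andP[xc yc]|] := boolP ((x <= c) && (y <= c)).
    by apply: hk => //; apply/andP.
  rewrite negb_and -!ltNge => /orP hxy.
  move: xyd; rewrite ltr_norml => /andP[xy1 xy2]; rewrite -/s in cs.
  have dx : `|x - s| < d by rewrite ltr_norml; apply/andP; case: hxy => ?; split; lra.
  have dy : `|y - s| < d by rewrite ltr_norml; apply/andP; case: hxy => ?; split; lra.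
  have := hd x dx; have := hd y dy; rewrite !ler_norml.
  by move=> /andP[? ?] /andP[? ?]; apply/andP; split; lra.
have bs : b <= s + d / 2.
  rewrite leNgt; apply/negP => h.
  have : Num.min b (s + d / 2) <= s.
    apply: (sup_upper_bound supS); split=> //.
    by rewrite le_min ab ge_min lexx /=; lra.
  by rewrite (min_r (ltW h)) => h1; lra.
by move: goodm; rewrite min_l.
Qed.

(** Close points cost [e]; at distance at least [d], the oscillation [B] is at most
    [B / d^2 * (x - y)^2]. A quadratic error is what the Bernstein expectation evaluates exactly. *)
Lemma cont_on_quad a b f : a <= b -> cont_on a b f -> forall e, 0 < e ->
  exists K, 0 <= K /\ forall x y, a <= x <= b -> a <= y <= b ->
    `|f x - f y| <= e + K * (x - y) ^+ 2.
Proof.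
move=> ab cf e e0; have [d [d0 hd]] := cont_on_unif ab cf e0.
have cw : {within `[a, b], continuous f}.
  apply: continuous_in_subspaceT => x; rewrite inE /= in_itv /= => h; exact: cf.
have [c _ hc] := EVT_max ab cw; have [c' _ hc'] := EVT_min ab cw.
pose B := f c - f c'.
have hB x y : a <= x <= b -> a <= y <= b -> `|f x - f y| <= B.
  move=> hx hy; have := hc x; have := hc y; have := hc' x; have := hc' y.
  rewrite !in_itv /= => /(_ hy) h1 /(_ hx) h2 /(_ hy) h3 /(_ hx) h4.
  by rewrite ler_norml /B; apply/andP; split; lra.
have haa : a <= a <= b by rewrite lexx ab.
have B0 : 0 <= B := le_trans (normr_ge0 _) (hB a a haa haa).
exists (B / d ^+ 2); split; first by rewrite divr_ge0 // exprn_ge0 // ltW.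
move=> x y hx hy; have [xyd|xyd] := ltP `|x - y| d.
  apply: le_trans (hd _ _ hx hy xyd) _.
  by rewrite lerDl mulr_ge0 ?sqr_ge0 // divr_ge0 // exprn_ge0 // ltW.
apply: le_trans (hB _ _ hx hy) _.
apply: (@le_trans _ _ (B / d ^+ 2 * (x - y) ^+ 2)); last by rewrite lerDr ltW.
rewrite mulrAC ler_pdivlMr ?exprn_gt0 // ler_wpM2l //.
by rewrite -[X in _ <= X]real_normK ?num_real // ler_pXn2r // nnegrE // ltW.
Qed.

(** Bernstein polynomials, through Pascal's rule: [(bern n phi).[x]] is the
    expectation of [phi] under the binomial law with parameters [n], [x]. *)
Fixpoint bern (n : nat) (phi : nat -> R) : {poly R} :=
  if n is m.+1 then (1 - 'X) * bern m phi + 'X * bern m (fun k => phi k.+1)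
  else (phi 0%N)%:P.

Lemma bern_mono n (phi psi : nat -> R) x : 0 <= x <= 1 ->
  (forall k, (k <= n)%N -> phi k <= psi k) -> (bern n phi).[x] <= (bern n psi).[x].
Proof.
move=> /andP[x0 x1]; elim: n phi psi => [|n IH] phi psi h /=.
  by rewrite !hornerE h.
rewrite !hornerE; apply: lerD; apply: ler_wpM2l => //.
- by rewrite subr_ge0.
- by apply: IH => k kn; apply: h; exact: leqW.
- by apply: IH => k kn; apply: h.
Qed.

(** Variance plus squared bias of the binomial law. The centre [c] is arbitrary because the second
    branch of the recursion shifts it to [c - 1]. *)
Lemma bern_quad n (u K c x : R) :
  (bern n (fun k => u + K * (k%:R - c) ^+ 2)).[x] =
  u + K * (n%:R * x * (1 - x) + (n%:R * x - c) ^+ 2).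
Proof.
elim: n c => [|n IH] c /=; first by rewrite hornerE /=; ring.
rewrite !hornerE IH.
have -> : (fun k : nat => u + K * (k.+1%:R - c) ^+ 2) =
          (fun k : nat => u + K * (k%:R - (c - 1)) ^+ 2).
  by apply/funext => k; rewrite -natr1; ring.
by rewrite IH -natr1; ring.
Qed.

Lemma weierstrass01 g :
  (forall e, 0 < e -> exists K, 0 <= K /\
     forall x y, 0 <= x <= 1 -> 0 <= y <= 1 ->
     `|g x - g y| <= e + K * (x - y) ^+ 2) ->
  forall e, 0 < e -> exists p : {poly R}, forall x, 0 <= x <= 1 ->
    `|g x - p.[x]| <= e.
Proof.
move=> hg e e0; have e20 : 0 < e / 2 by rewrite divr_gt0.
have [K [K0 hK]] := hg _ e20.
(* Makes [K / n <= e / 2], where [K / n] bounds [K] times the variance [x (1 - x) / n] of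
   [k / n]. *)
pose n := (Num.truncn (2 * K / e)).+1.
have n0 : (0 : R) < n%:R by rewrite ltr0n.
have hn : K / n%:R <= e / 2.
  have hn : 2 * K / e < n%:R by exact: truncnS_gt.
  rewrite ler_pdivrMr //; move: hn; rewrite ltr_pdivrMr // => hn.
  by rewrite mulrAC ler_pdivlMr //; lra.
exists (bern n (fun k => g (k%:R / n%:R))) => x x01.
have /andP[x0 x1] := x01.
have hk k : (k <= n)%N -> `|g (k%:R / n%:R) - g x| <=
    e / 2 + K / n%:R ^+ 2 * (k%:R - n%:R * x) ^+ 2.
  move=> kn; apply: le_trans (hK _ _ _ x01) _.
    by rewrite divr_ge0 //= ler_pdivrMr // mul1r ler_nat.
  by rewrite le_eqVlt; apply/orP; left; apply/eqP; field; lra.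
have hup : (bern n (fun k => g (k%:R / n%:R))).[x] <=
    (g x + e / 2) + K / n%:R ^+ 2 * (n%:R * x * (1 - x) + (n%:R * x - n%:R * x) ^+ 2).
  rewrite -bern_quad; apply: bern_mono => // k kn.
  by have := hk k kn; rewrite ler_norml => /andP[_]; lra.
have hdn : (g x - e / 2) + - (K / n%:R ^+ 2) * (n%:R * x * (1 - x) + (n%:R * x - n%:R * x) ^+ 2)
    <= (bern n (fun k => g (k%:R / n%:R))).[x].
  rewrite -bern_quad; apply: bern_mono => // k kn.
  by have := hk k kn; rewrite ler_norml => /andP[+ _]; lra.
have key : K / n%:R ^+ 2 * (n%:R * x * (1 - x) + (n%:R * x - n%:R * x) ^+ 2) <= e / 2.
  rewrite subrr expr0n /= addr0; apply: le_trans hn.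
  have -> : K / n%:R ^+ 2 * (n%:R * x * (1 - x)) = K / n%:R * (x * (1 - x)).
    by field; lra.
  by rewrite ler_piMr ?divr_ge0 //; nra.
by rewrite ler_norml; apply/andP; split; lra.
Qed.

Lemma weierstrass a b f : a <= b -> cont_on a b f -> forall e, 0 < e ->
  exists p : {poly R}, forall x, a <= x <= b -> `|f x - p.[x]| <= e.
Proof.
move=> ab cf e e0; have [bE|ba] := eqVneq b a.
  exists (f a)%:P => x hx; have -> : x = a by move: hx; rewrite bE; lra.
  by rewrite hornerC subrr normr0 ltW.
have ab' : 0 < b - a by rewrite subr_gt0 lt_def ba.
pose g x := f (a + (b - a) * x).
have [||p hp] := @weierstrass01 g _ e => //.
  move=> d d0; have [K [K0 hK]] := cont_on_quad ab cf d0.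
  exists (K * (b - a) ^+ 2); split; first by rewrite mulr_ge0 // exprn_ge0 // ltW.
  move=> x y hx hy; apply: le_trans (hK _ _ _ _) _; [nra|nra|].
  by rewrite le_eqVlt; apply/orP; left; apply/eqP; ring.
exists (p \Po ((b - a)^-1 *: ('X - a%:P))) => x hx.
rewrite horner_comp !hornerE.
have := hp ((b - a)^-1 * (x - a)); rewrite /g.
have -> : a + (b - a) * ((b - a)^-1 * (x - a)) = x by field; lra.
apply; apply/andP; split; first by rewrite mulr_ge0 ?invr_ge0 ?(ltW ab') //; lra.
by rewrite mulrC ler_pdivrMr //; lra.
Qed.

End weierstrass.

(** * Functional calculus *)

Section operator_limits.
Context {R : realType} {H : hilbertType R}.
Implicit Types (x y : H) (a b c d e t m M : R) (A B S T : H -> H).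

Lemma nmZc (k : R[i]) x : nm (k *: x) = complex.Re `|k| * nm x.
Proof.
apply: (@complexI R); rewrite nmE normrZ rmorphM /= nmE; congr (_ * _).
Qed.

Lemma nm_eps0 x : (forall e, 0 < e -> nm x <= e) -> x = 0.
Proof.
move=> h; apply: nm_eq0; apply/eqP; rewrite eq_le nm_ge0 andbT.
by apply/ler_addgt0Pr => e e0; rewrite add0r; exact: h.
Qed.

Lemma nb_eps c T : (forall e, 0 < e -> nb (c + e) T) -> nb c T.
Proof.
move=> h x; apply/ler_addgt0Pr => e e0.
have n0 := nm_ge0 x.
have h0 : 0 < e / (nm x + 1) by rewrite divr_gt0 //; lra.
apply: le_trans (h _ h0 x) _; rewrite mulrDl lerD2l mulrAC ler_pdivrMr; last by lra.
by rewrite ler_wpM2l ?ltW //; lra.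
Qed.

Lemma nbD c d S T : nb c S -> nb d T -> nb (c + d) (fun x => S x + T x).
Proof. by move=> hc hd x; apply: le_trans (nmD _ _) _; rewrite mulrDl lerD. Qed.

Lemma nbM c d S T : 0 <= c -> nb c S -> nb d T -> nb (c * d) (fun x => S (T x)).
Proof.
by move=> c0 hc hd x; apply: le_trans (hc _) _; rewrite -mulrA ler_wpM2l.
Qed.

Lemma nb_sym c S T : nb c (fun x => S x - T x) -> nb c (fun x => T x - S x).
Proof. by move=> h x; rewrite nmB. Qed.

Lemma nb_tri c d S T U : nb c (fun x => S x - T x) -> nb d (fun x => T x - U x) ->
  nb (c + d) (fun x => S x - U x).
Proof.
move=> h1 h2 x; have -> : S x - U x = (S x - T x) + (T x - U x) by rewrite addrA subrK.
exact: nbD h1 h2 x.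
Qed.

Lemma nb0_eq S T : nb 0 (fun x => S x - T x) -> S = T.
Proof.
move=> h; apply/funext => x; apply/eqP; rewrite -subr_eq0; apply/eqP/nm_eq0/eqP.
by rewrite eq_le nm_ge0 andbT -[0](mul0r (nm x)).
Qed.

Lemma op_lim (T : nat -> H -> H) : (forall n, bounded_op (T n)) ->
  (forall e, 0 < e -> exists N, forall n k, (N <= n)%N -> (N <= k)%N ->
     nb e (fun x => T n x - T k x)) ->
  exists L, bounded_op L /\ forall e, 0 < e -> exists N, forall n, (N <= n)%N ->
     nb e (fun x => L x - T n x).
Proof.
move=> bT hT.
have hx x : exists l, forall e, 0 < e -> exists N, forall n, (N <= n)%N -> nm (T n x - l) <= e.
  apply: hcauchy => e e0; have n0 := nm_ge0 x.
  have h0 : 0 < e / (nm x + 1) by rewrite divr_gt0 //; lra.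
  have [N hN] := hT _ h0; exists N => n k nN kN.
  apply: le_trans (hN n k nN kN x) _; rewrite mulrAC ler_pdivrMr; last by lra.
  by rewrite ler_wpM2l ?ltW //; lra.
have [L hL] := choice hx.
have nbL e : 0 < e -> exists N, forall n, (N <= n)%N -> nb e (fun x => L x - T n x).
  move=> e0; have [N hN] := hT _ e0; exists N => n nN x.
  apply/ler_addgt0Pr => d d0; have [N' hN'] := hL x _ d0.
  pose k := maxn N N'.
  have -> : L x - T n x = (T k x - T n x) - (T k x - L x) by rewrite opprB addrCA addrAC subrr add0r addrC.
  apply: le_trans (nmD _ _) _; rewrite nmN; apply: lerD.
    by apply: hN => //; exact: leq_maxl.
  by apply: hN'; exact: leq_maxr.
have lL : linear L.
  move=> a x y; apply/eqP; rewrite -subr_eq0; apply/eqP/nm_eps0 => e e0.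
  pose C := nm (a *: x + y) + complex.Re `|a| * nm x + nm y + 1.
  have a0 : 0 <= complex.Re `|a|.
    by rewrite -lecR RRe_real ?normr_real //; exact: normr_ge0.
  have n1 := nm_ge0 x; have n2 := nm_ge0 y; have n3 := nm_ge0 (a *: x + y).
  have n4 : 0 <= complex.Re `|a| * nm x by rewrite mulr_ge0.
  have C0 : 0 < C by rewrite /C; lra.
  have [N hN] := nbL _ (divr_gt0 e0 C0); have h := hN N (leqnn _).
  have lT := bounded_op_lin (bT N).
  have -> : L (a *: x + y) - (a *: L x + L y) =
    (L (a *: x + y) - T N (a *: x + y)) - (a *: (L x - T N x) + (L y - T N y)).
    by rewrite lT scalerBr addrACA -opprD opprB addrA subrK.
  apply: le_trans (nmD _ _) _; rewrite nmN.
  apply: le_trans (lerD (h _) (nmD _ _)) _; rewrite nmZc.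
  have h1 := h y; have h2 := ler_wpM2l a0 (h x).
  rewrite [leRHS](_ : e = e / C * C); last by rewrite divfK // lt0r_neq0.
  rewrite mulrCA in h2; have k0 : 0 <= e / C by rewrite ltW // divr_gt0.
  move: h1 h2 k0; set k := e / C; set u := nm (L x - _); set v := nm (L y - _).
  rewrite /C; lra.
exists L; split=> //; apply/bounded_opP; split=> //.
have [N hN] := nbL 1 ltr01; have [c [_ hc]] := bounded_op_nb (bT N).
exists (1 + c) => x; have := nbD (hN N (leqnn _)) hc x.
by rewrite subrK.
Qed.

Lemma sa_lim T : (forall e, 0 < e -> exists S, sa S /\ nb e (fun x => T x - S x)) -> sa T.
Proof.
move=> h.
have le x y : ip (T x) y <= ip x (T y).
  apply/ler_addgt0Pr => e e0.
  have n0 := nm_ge0 x; have n1 := nm_ge0 y.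
  have h0 : 0 < e / (2 * (nm x * nm y) + 1) by rewrite divr_gt0 // ltr_wpDl ?mulr_ge0.
  have [S [sS hp]] := h _ h0.
  have h1 := ipCS (T x - S x) y; have h2 := ipCS x (- (T y - S y)).
  have h3 := sS x y.
  rewrite ipDl ipNl in h1; rewrite ipNr ipDr ipNr nmN in h2.
  have h4 := ler_wpM2r n1 (hp x); have h5 := ler_wpM2l n0 (hp y).
  have : e / (2 * (nm x * nm y) + 1) * (2 * (nm x * nm y)) <= e.
    rewrite mulrAC ler_pdivrMr ?ltr_wpDl ?mulr_ge0 //.
    by rewrite ler_wpM2l ?(ltW e0) // lerDl.
  move: h4 h5; set k := e / _; set u := nm (T x - _); set v := nm (T y - _); lra.
by move=> x y; apply: le_anti; rewrite le /= ipC (ipC _ y) le.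
Qed.

End operator_limits.

(** * Continuous functional calculus on an interval *)

Section functional_calculus.
Context {R : realType} {H : hilbertType R}.
Implicit Types (x y : H) (a b c d e t m M : R) (A S T : H -> H) (f g : R -> R).

Definition bd m M A := [/\ bounded_op A, sa A &
  forall x, m * nm x ^+ 2 <= ip (A x) x <= M * nm x ^+ 2].

Lemma bdW m M m' M' A : m' <= m -> M <= M' -> bd m M A -> bd m' M' A.
Proof.
move=> mm MM [bA hA h]; split=> // x; have /andP[h1 h2] := h x.
have n0 := sqr_ge0 (nm x); apply/andP; split; nra.
Qed.

(** For [t < m], an approximate eigenvector with error below [(m - t) * nm x] contradicts
    [(m - t) * nm x ^+ 2 <= ip (A x - t x) x] by Cauchy-Schwarz; likewise above [M]. *)
Lemma asp_bd m M A t : bd m M A -> asp A t -> m <= t <= M.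
Proof.
move=> [bA hA hb] at_; apply/andP; split; rewrite leNgt; apply/negP => tm.
  have [|x hx] := at_ (m - t); first by rewrite subr_gt0.
  have nx : 0 < nm x.
    by have := nm_ge0 (A x - t%:C *: x); have := nm_ge0 x; nra.
  have := ipCS (A x - t%:C *: x) x; rewrite ipDl ipNl ipZl ipxx.
  have /andP[+ _] := hb x; move: hx.
  by set u := nm _; set v := nm x in nx *; set w := ip _ _; nra.
have [|x hx] := at_ (t - M); first by rewrite subr_gt0.
have nx : 0 < nm x.
  by have := nm_ge0 (A x - t%:C *: x); have := nm_ge0 x; nra.
have := ipCS (- (A x - t%:C *: x)) x; rewrite nmN ipNl ipDl ipNl ipZl ipxx.
have /andP[_] := hb x; move: hx.
by set u := nm _; set v := nm x in nx *; set w := ip _ _; nra.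
Qed.

Lemma nb_poly_itv m M A p c : bd m M A -> 0 <= c ->
  (forall t, m <= t <= M -> `|p.[t]| <= c) -> nb c (poly_op p A).
Proof.
move=> bA c0 h; have [b1 hA _] := bA; apply: nb_poly => // t /(asp_bd bA); exact: h.
Qed.

Lemma poly_itv_bounded m M (p : {poly R}) :
  exists B : R, 0 <= B /\ forall t, m <= t <= M -> `|p.[t]| <= B.
Proof.
elim/poly_ind: p => [|p c [B [B0 hB]]].
  by exists 0; split=> // t _; rewrite horner0 normr0.
exists (B * (`|m| + `|M|) + `|c|); split.
  by rewrite addr_ge0 // mulr_ge0 // addr_ge0.
move=> t ht; rewrite !hornerE; apply: le_trans (ler_normD _ _) _.
rewrite lerD2r normrM ler_pM // ?hB //.
have /andP[h1 h2] := ht; have := ler_norm M; have := ler_norm (- m).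
have := normr_ge0 M; have := normr_ge0 m.
by rewrite normrN ler_norml => *; apply/andP; split; lra.
Qed.

(* [T = f(A)], with the spectrum of [A] replaced by an interval containing it *)
Definition FC m M f A T := bounded_op T /\ forall e, 0 < e ->
  exists p : {poly R}, (forall t, m <= t <= M -> `|f t - p.[t]| <= e) /\
    nb e (fun x => T x - poly_op p A x).

Lemma FC_ext m M f g A T : (forall t, m <= t <= M -> f t = g t) ->
  FC m M f A T -> FC m M g A T.
Proof.
move=> fg [bT h]; split=> // e /h[p [hp hT]]; exists p; split=> // t ht.
by rewrite -fg ?hp.
Qed.

Lemma FC_poly m M p A : bounded_op A -> FC m M (horner p) A (poly_op p A).
Proof.
move=> bA; split; first exact: bop_poly.
move=> e e0; exists p; split=> [t _|x]; rewrite subrr ?normr0 ?nm0 ?(ltW e0) //.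
by rewrite mulr_ge0 ?nm_ge0 ?(ltW e0).
Qed.

Lemma FC_bounded m M f A T : FC m M f A T ->
  exists B : R, 0 <= B /\ forall t, m <= t <= M -> `|f t| <= B.
Proof.
move=> [_ h]; have [p [hp _]] := h 1 ltr01.
have [B [B0 hB]] := poly_itv_bounded m M p.
exists (B + 1); split; first by lra.
move=> t ht; have := hp t ht; have := hB t ht.
have := ler_normD (p.[t]) (f t - p.[t]); rewrite addrC subrK; lra.
Qed.

Lemma FC_norm m M f A T c : bd m M A -> FC m M f A T -> 0 <= c ->
  (forall t, m <= t <= M -> `|f t| <= c) -> nb c T.
Proof.
move=> bA [bT h] c0 hc; apply: nb_eps => e e0.
have e20 : 0 < e / 2 by rewrite divr_gt0.
have [p [hp hT]] := h _ e20.
have hpA : nb (c + e / 2) (poly_op p A).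
  apply: (nb_poly_itv bA) => [|t ht]; first by lra.
  have := hp t ht; have := hc t ht.
  have := ler_normB (f t) (f t - p.[t]); rewrite opprB addrC subrK; lra.
move=> x; have := nbD hT hpA x; rewrite subrK.
have -> // : e / 2 + (c + e / 2) = c + e by lra.
Qed.

Lemma FC_add m M f g A S T : FC m M f A S -> FC m M g A T ->
  FC m M (fun t => f t + g t) A (fun x => S x + T x).
Proof.
move=> [bS hS] [bT hT]; split; first exact: bop_add.
move=> e e0; have e20 : 0 < e / 2 by rewrite divr_gt0.
have [p [hp hpS]] := hS _ e20; have [q [hq hqT]] := hT _ e20.
exists (p + q); split=> [t ht|x].
  rewrite hornerD opprD addrACA; apply: le_trans (ler_normD _ _) _.
  by have := hp t ht; have := hq t ht; lra.
rewrite poly_opD opprD addrACA.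
have := nbD hpS hqT x; have -> // : e / 2 + e / 2 = e by lra.
Qed.

Lemma FC_mul m M f g A S T : bd m M A -> FC m M f A S -> FC m M g A T ->
  FC m M (fun t => f t * g t) A (fun x => S (T x)).
Proof.
move=> bA fS gT; have [bS hS] := fS; have [bT hT] := gT.
have lA : linear A by case: bA => -[].
split; first exact: bop_comp.
have [F [F0 hF]] := FC_bounded fS; have [G [G0 hG]] := FC_bounded gT.
(* [d <= 1] keeps [|q|] below [G + 1]; the quotient makes the two errors [F * d] and [d * (G + 1)]
   add up to at most [e]. *)
move=> e e0; pose d := Num.min 1 (e / (F + G + 1)).
have FG : 0 < F + G + 1 by lra.
have d0 : 0 < d by rewrite lt_min ltr01 divr_gt0.
have d1 : d <= 1 by rewrite ge_min lexx.
have de : F * d + d * (G + 1) <= e.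
  have : d <= e / (F + G + 1) by rewrite ge_min lexx orbT.
  by rewrite ler_pdivlMr //; lra.
have [p [hp hpS]] := hS _ d0; have [q [hq hqT]] := hT _ d0.
have hq1 t : m <= t <= M -> `|q.[t]| <= G + 1.
  move=> ht; have := hq t ht; have := hG t ht.
  have := ler_normB (g t) (g t - q.[t]); rewrite opprB addrC subrK; lra.
exists (p * q); split=> [t ht|x].
  have -> : f t * g t - (p * q).[t] = f t * (g t - q.[t]) + (f t - p.[t]) * q.[t].
    by rewrite hornerM; ring.
  apply: le_trans (ler_normD _ _) _; rewrite !normrM; apply: le_trans de.
  by apply: lerD; apply: ler_pM; rewrite ?normr_ge0 ?hF ?hq ?hp ?hq1.
rewrite poly_opM //.
have -> : S (T x) - poly_op p A (poly_op q A x) =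
   S (T x - poly_op q A x) + (S (poly_op q A x) - poly_op p A (poly_op q A x)).
  by rewrite (linB _ _ (bounded_op_lin bS)) addrA subrK.
apply: le_trans (ler_wpM2r (nm_ge0 x) de).
apply: (nbD (nbM F0 (FC_norm bA fS F0 hF) hqT) (nbM (ltW d0) hpS _)).
by apply: (nb_poly_itv bA) => //; lra.
Qed.

Lemma FC_cst m M c A : bounded_op A -> FC m M (fun=> c) A (fun x => c%:C *: x).
Proof.
move=> bA; have := @FC_poly m M c%:P A bA.
have -> : poly_op c%:P A = (fun x => c%:C *: x) by apply/funext => x; rewrite poly_opC.
by apply: FC_ext => t _; rewrite hornerC.
Qed.

Lemma FC_id m M A : bounded_op A -> FC m M (fun t => t) A A.
Proof.
move=> bA; have := @FC_poly m M 'X A bA.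
have -> : poly_op 'X A = A by apply/funext => x; rewrite poly_opX.
by apply: FC_ext => t _; rewrite hornerX.
Qed.

Lemma FC_scale m M f A T c : bd m M A -> FC m M f A T ->
  FC m M (fun t => c * f t) A (fun x => c%:C *: T x).
Proof. by move=> bA fT; apply: (FC_mul bA (FC_cst _ _ _ _) fT); case: bA. Qed.

Lemma FC_opp m M f A T : bd m M A -> FC m M f A T ->
  FC m M (fun t => - f t) A (fun x => - T x).
Proof.
move=> bA fT; have := FC_scale (-1) bA fT.
have -> : (fun x => (-1)%:C *: T x) = (fun x => - T x).
  by apply/funext => x; rewrite rmorphN scaleN1r.
by apply: FC_ext => t _; rewrite mulN1r.
Qed.

Lemma FC_minus m M f g A S T : bd m M A -> FC m M f A S -> FC m M g A T ->
  FC m M (fun t => f t - g t) A (fun x => S x - T x).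
Proof. by move=> bA fS gT; exact: (FC_add fS (FC_opp bA gT)). Qed.

Lemma FC_unique m M f A S T : bd m M A -> FC m M f A S -> FC m M f A T -> S = T.
Proof.
move=> bA fS fT; apply: nb0_eq; apply: (FC_norm bA (FC_minus bA fS fT)) => // t _.
by rewrite subrr normr0.
Qed.

Lemma FC_sa m M f A T : bd m M A -> FC m M f A T -> sa T.
Proof.
move=> [bA hA _] [bT h]; apply: sa_lim => e /h[p [_ hp]].
by exists (poly_op p A); split=> //; apply: sa_poly => //; exact: bounded_op_lin.
Qed.

Lemma nb_ip c T x : nb c T -> `|ip (T x) x| <= c * nm x ^+ 2.
Proof.
move=> h; apply: le_trans (ip_norm_le _ _) _.
by rewrite expr2 mulrA ler_wpM2r ?nm_ge0.
Qed.

(** No square root of [f] is taken: [0 <= f <= B] gives [|f - B| <= B], so [T - B] has norm at most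
    [B], and [ip (T x) x] is at least [B nm x^2 - B nm x^2]. *)
Lemma FC_ge0 m M f A T : bd m M A -> FC m M f A T ->
  (forall t, m <= t <= M -> 0 <= f t) -> forall x, 0 <= ip (T x) x.
Proof.
move=> bA fT f0 x; have [B [B0 hB]] := FC_bounded fT.
have bA1 : bounded_op A by case: bA.
have hn : forall t, m <= t <= M -> `|f t - B| <= B.
  move=> t ht; have := hB t ht; have := f0 t ht.
  by rewrite !ler_norml => ? /andP[? ?]; apply/andP; split; lra.
have := nb_ip x (FC_norm bA (FC_minus bA fT (FC_cst m M B bA1)) B0 hn).
by rewrite ipDl ipNl ipZl ipxx ler_norml => /andP[+ _]; lra.
Qed.

Lemma FC_le m M f g A S T : bd m M A -> FC m M f A S -> FC m M g A T ->
  (forall t, m <= t <= M -> f t <= g t) -> forall x, ip (S x) x <= ip (T x) x.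
Proof.
move=> bA fS gT fg x; have := FC_ge0 bA (FC_minus bA gT fS).
by move=> /(_ _ x); rewrite ipDl ipNl subr_ge0; apply=> t /fg; rewrite subr_ge0.
Qed.

Lemma FC_bd m M m' M' f A T : bd m M A -> FC m M f A T ->
  (forall t, m <= t <= M -> m' <= f t <= M') -> bd m' M' T.
Proof.
move=> bA fT h; have bA1 : bounded_op A by case: bA.
split; [by case: fT|exact: FC_sa bA fT|move=> x].
have := FC_le bA (FC_cst m M m' bA1) fT; have := FC_le bA fT (FC_cst m M M' bA1).
move=> h1 h2; have := h1 _ x; have := h2 _ x.
rewrite !ipZl !ipxx => -> => [->//|] t /h /andP[] //.
Qed.

Lemma FC_exists m M f A : m <= M -> bd m M A -> cont_on m M f -> exists T, FC m M f A T.
Proof.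
move=> mM bA cf; have bA1 : bounded_op A by case: bA.
have hw (n : nat) : exists p : {poly R}, forall t, m <= t <= M -> `|f t - p.[t]| <= n.+1%:R^-1.
  by apply: weierstrass => //; rewrite invr_gt0 ltr0n.
have [p hp] := choice hw.
have hinv e : 0 < e -> exists N, forall n, (N <= n)%N -> n.+1%:R^-1 <= e.
  move=> e0; exists (Num.truncn e^-1) => n Nn.
  rewrite invf_ple ?posrE ?ltr0n //; apply: ltW; apply: lt_le_trans (truncnS_gt _) _.
  by rewrite ler_nat ltnS.
have [|e e0|T [bT hT]] := @op_lim _ _ (fun n => poly_op (p n) A).
- by move=> n; exact: bop_poly.
- have e20 : 0 < e / 2 by rewrite divr_gt0.
  have [N hN] := hinv _ e20; exists N => n k nN kN.
  have -> : (fun x => poly_op (p n) A x - poly_op (p k) A x) = poly_op (p n - p k) A.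
    by apply/funext => x; rewrite poly_opB.
  apply: (nb_poly_itv bA) => [|t ht]; first exact: ltW.
  have -> : (p n - p k).[t] = (f t - (p k).[t]) - (f t - (p n).[t]) by rewrite !hornerE; ring.
  apply: le_trans (ler_normB _ _) _.
  by have := le_trans (hp n t ht) (hN n nN); have := le_trans (hp k t ht) (hN k kN); lra.
exists T; split=> // e e0; have [N hN] := hinv _ e0; have [N' hN'] := hT _ e0.
exists (p (maxn N N')); split=> [t ht|].
  by apply: le_trans (hp _ _ ht) _; apply: hN; exact: leq_maxl.
by apply: hN'; exact: leq_maxr.
Qed.

Lemma FC_horner m M f A T (p : {poly R}) : bd m M A -> FC m M f A T ->
  FC m M (fun t => p.[f t]) A (poly_op p T).
Proof.
move=> bA fT; have bA1 : bounded_op A by case: bA.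
elim/poly_ind: p => [|p c IH].
  have := FC_cst m M 0 bA1.
  have -> : (fun x : H => 0%:C *: x) = poly_op 0 T.
    by apply/funext => x; rewrite poly_op0 scale0r.
  by apply: FC_ext => t _; rewrite horner0.
have := FC_add (FC_mul bA IH fT) (FC_cst m M c bA1).
have -> : (fun x => poly_op p T (T x) + c%:C *: x) = poly_op (p * 'X + c%:P) T.
  by apply/funext => x; rewrite poly_opD poly_opMX poly_opC.
by apply: FC_ext => t _; rewrite !hornerE.
Qed.

Lemma FC_comp m M m' M' f g A S T : bd m M A -> FC m M g A S ->
  (forall t, m <= t <= M -> m' <= g t <= M') -> FC m' M' f S T ->
  FC m M (fun t => f (g t)) A T.
Proof.
move=> bA gS hg [bT hT]; split=> // e e0; have e20 : 0 < e / 2 by rewrite divr_gt0.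
have [p [hp hpT]] := hT _ e20.
have [_ /(_ _ e20)[q [hq hqT]]] := FC_horner p bA gS.
have eE : e = e / 2 + e / 2 by lra.
exists q; split=> [t ht|]; last by rewrite eE; exact: nb_tri hpT hqT.
have -> : f (g t) - q.[t] = (f (g t) - p.[g t]) + (p.[g t] - q.[t]) by ring.
apply: le_trans (ler_normD _ _) _; rewrite eE lerD //; first exact: hp (hg _ ht).
exact: hq.
Qed.

(** Induction on [p * 'X + r] through [p(A) A - p(A') A' = (p(A) - p(A')) A + p(A') (A - A')]; the
    constants depend on [p] and [c] only. *)
Lemma poly_op_lip (p : {poly R}) c : 0 <= c -> exists B K : R, [/\ 0 <= B, 0 <= K,
  forall A, bounded_op A -> nb c A -> nb B (poly_op p A) &
  forall A A' d, bounded_op A -> bounded_op A' -> nb c A -> nb c A' -> 0 <= d ->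
    nb d (fun x => A x - A' x) -> nb (K * d) (fun x => poly_op p A x - poly_op p A' x)].
Proof.
move=> c0; elim/poly_ind: p => [|p r [B [K [B0 K0 hB hK]]]].
  exists 0, 0; split=> // [A _ _ x|A A' d _ _ _ _ _ _ x]; rewrite !poly_op0 ?subr0 nm0.
    by rewrite mul0r.
  by rewrite !mul0r.
exists (B * c + `|r|), (K * c + B); split=> [|||A A' d bA bA' nA nA' d0 hd x].
- by rewrite addr_ge0 ?mulr_ge0.
- by rewrite addr_ge0 ?mulr_ge0.
- move=> A bA nA; have h := nbD (nbM B0 (hB A bA nA) nA) (_ : nb `|r| (fun x : H => r%:C *: x)).
  by move=> x; rewrite poly_opD poly_opMX poly_opC; apply: h => y; rewrite nmZ.
rewrite !poly_opD !poly_opMX !poly_opC opprD addrACA subrr addr0.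
have -> : poly_op p A (A x) - poly_op p A' (A' x) =
  (poly_op p A (A x) - poly_op p A' (A x)) + poly_op p A' (A x - A' x).
  by rewrite (linB _ _ (bounded_op_lin (bop_poly _ bA'))) addrA subrK.
have -> : (K * c + B) * d = K * d * c + B * d by ring.
apply: (nbD (nbM _ (hK A A' d bA bA' nA nA' d0 hd) nA) (nbM B0 (hB A' bA' nA') hd) x).
by rewrite mulr_ge0.
Qed.

Lemma bd_nb m M A : bd m M A -> nb (`|m| + `|M|) A.
Proof.
move=> bA; have [bA1 _ _] := bA.
apply: (FC_norm bA (FC_id m M bA1)) => [|t /andP[h1 h2]]; first by rewrite addr_ge0.
have := ler_norm M; have := ler_norm (- m); have := normr_ge0 M; have := normr_ge0 m.
by rewrite normrN ler_norml => *; apply/andP; split; lra.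
Qed.

(** One Weierstrass polynomial serves all operators between [m] and [M], so [d] is uniform over
    them: two errors [e / 3] come from replacing [f] by [p], the third from [poly_op_lip]. *)
Lemma FC_continuous m M f : m <= M -> cont_on m M f -> forall e, 0 < e ->
  exists d, 0 < d /\ forall A A' T T', bd m M A -> bd m M A' ->
    FC m M f A T -> FC m M f A' T' ->
    nb d (fun x => A x - A' x) -> nb e (fun x => T x - T' x).
Proof.
move=> mM cf e e0; have e30 : 0 < e / 3 by rewrite divr_gt0.
have [p hp] := weierstrass mM cf e30.
have c0 : 0 <= `|m| + `|M| by rewrite addr_ge0.
have [B [K [B0 K0 _ hK]]] := poly_op_lip p c0.
exists (e / 3 / (K + 1)); split; first by rewrite divr_gt0 //; lra.
move=> A A' T T' bA bA' fT fT' hd.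
have [bA1 _ _] := bA; have [bA1' _ _] := bA'.
have h1 : nb (e / 3) (fun x => T x - poly_op p A x).
  by apply: (FC_norm bA (FC_minus bA fT (FC_poly m M p bA1))) => //; exact: ltW.
have h2 : nb (e / 3) (fun x => T' x - poly_op p A' x).
  by apply: (FC_norm bA' (FC_minus bA' fT' (FC_poly m M p bA1'))) => //; exact: ltW.
have d0 : 0 <= e / 3 / (K + 1) by rewrite ltW // divr_gt0 //; lra.
have h3 := hK A A' _ bA1 bA1' (bd_nb bA) (bd_nb bA') d0 hd.
have h4 := nb_tri (nb_tri h1 h3) (nb_sym h2).
apply: nbW h4; have : K * (e / 3 / (K + 1)) <= e / 3.
  by rewrite mulrCA ger_pMr // ler_pdivrMr; lra.
lra.
Qed.

Lemma asp_spectrum A t : asp A t -> spectrum A t.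
Proof.
move=> at_ [bA [S [bS SK _]]]; have [c [c0 hc]] := bounded_op_nb bS.
have [x] := at_ _ (divr_gt0 ltr01 c0); rewrite div1r ltNge => /negP; apply.
by rewrite mulrC ler_pdivrMr // mulrC -{1}[x]SK.
Qed.

Lemma cont_on_subinv m M t : ~~ (m <= t <= M) -> cont_on m M (fun s => (s - t)^-1).
Proof.
move=> ht x hx; apply: cvgV.
  by apply/eqP => xt; move: ht; rewrite (_ : t = x) ?hx //; lra.
by apply: cvgB; [exact: cvg_id|exact: cvg_cst].
Qed.

(** The inverse is the functional calculus of [(s - t)^-1], continuous on [[m, M]] because [t] lies
    outside. *)
Lemma bd_invertible m M A t : m <= M -> bd m M A -> ~~ (m <= t <= M) ->
  invertible_op (fun x => A x - t%:C *: x).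
Proof.
move=> mM bA ht; have [bA1 _ _] := bA.
have [S fS] := FC_exists mM bA (cont_on_subinv ht).
have fA : FC m M (fun s => s - t) A (fun x => A x - t%:C *: x).
  exact: (FC_minus bA (FC_id m M bA1) (FC_cst m M t bA1)).
have h1 : FC m M (fun=> 1) A (fun x => x).
  have := FC_cst m M 1 bA1; have -> // : (fun x : H => 1%:C *: x) = (fun x => x).
  by apply/funext => x; rewrite scale1r.
have nz s : m <= s <= M -> s - t != 0.
  move=> hs; apply/eqP => st; move: ht.
  by rewrite (_ : t = s) ?hs //; lra.
split; first by case: fA.
exists S; split; first by case: fS.
- have e : (fun x => S (A x - t%:C *: x)) = (fun x => x).
    apply: (FC_unique bA _ h1); apply: FC_ext (FC_mul bA fS fA) => s /nz s0.
    by rewrite mulVf.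
  by move=> x; have := congr1 (fun F : H -> H => F x) e.
- have e : (fun x => A (S x) - t%:C *: S x) = (fun x => x).
    apply: (FC_unique bA _ h1); apply: FC_ext (FC_mul bA fA fS) => s /nz s0.
    by rewrite mulfV.
  by move=> x; have := congr1 (fun F : H -> H => F x) e.
Qed.

Lemma spectrum_bd m M A t : m <= M -> bd m M A -> spectrum A t -> m <= t <= M.
Proof. by move=> mM bA st; apply: contrapT => /negP ht; apply/st/(bd_invertible mM bA). Qed.

Lemma opnorm_le T c : 0 <= c -> nb c T -> opnorm T <= c.
Proof.
move=> c0 h; apply: ge_sup.
  by exists (complex.Re `|T 0|), 0 => //=; rewrite normr0 ler01.
move=> _ [x /= x1 <-]; apply: le_trans (h x) _.
by rewrite ler_piMr // -lecR nmE.
Qed.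

Lemma opnorm_nb T c : bounded_op T -> opnorm T <= c -> nb c T.
Proof.
move=> bT h x; have lT := bounded_op_lin bT; have [k [k0 hk]] := bounded_op_nb bT.
have [x0|x0] := eqVneq (nm x) 0; first by rewrite x0 (nm_eq0 x0) (lin0 lT) nm0 mulr0.
have n0 : 0 < nm x by rewrite lt_def x0 nm_ge0.
pose y := (nm x)^-1%:C *: x.
have y1 : nm y = 1 by rewrite nmZ gtr0_norm ?invr_gt0 // mulVf.
have : nm (T y) <= c.
  apply: le_trans h; apply: sup_upper_bound; last first.
    by exists y => //=; rewrite -nmE y1.
  split; first by exists (nm (T y)), y => //=; rewrite -nmE y1.
  exists k => _ [z /= z1 <-]; apply: le_trans (hk z) _.
  by rewrite ger_pMr // -lecR nmE.
by rewrite (linZ _ _ lT) nmZ gtr0_norm ?invr_gt0 // mulrC ler_pdivrMr.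
Qed.

(** [fcalc] picks an arbitrary limit, approximated on the spectrum only. [T] is a candidate because
    the spectrum lies in [[m, M]]; all candidates agree because the spectrum contains [asp A], where
    [nb_poly] controls norms. *)
Lemma fcalcE m M f A T : m <= M -> bd m M A -> FC m M f A T -> fcalc f A = T.
Proof.
move=> mM bA fT; have [bT hT] := fT; have [bA1 sA _] := bA.
have isT : is_fcalc f A T.
  split=> // e e0; have [p [hp hpT]] := hT _ e0; exists p; split.
    by move=> t /(spectrum_bd mM bA); exact: hp.
  by apply: opnorm_le => //; exact: ltW.
rewrite /fcalc; case: xgetP => [S _ [bS hS]|/(_ T)//]; apply: nb0_eq.
apply: nb_eps => e e0; rewrite add0r.
have e40 : 0 < e / 4 by rewrite divr_gt0.
have [p [hp hpT]] := hT _ e40; have [q [hq hqS]] := hS _ e40.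
have h1 : nb (e / 4) (fun x => S x - poly_op q A x).
  by apply: opnorm_nb hqS; apply: bop_sub => //; exact: bop_poly.
have h2 : nb (e / 2) (fun x => poly_op q A x - poly_op p A x).
  have -> : (fun x => poly_op q A x - poly_op p A x) = poly_op (q - p) A.
    by apply/funext => x; rewrite poly_opB.
  apply: nb_poly => //; first by lra.
  move=> t at_; have := hp t (asp_bd bA at_); have := hq t (asp_spectrum at_).
  have -> : (q - p).[t] = (f t - p.[t]) - (f t - q.[t]) by rewrite !hornerE; ring.
  by have := ler_normB (f t - p.[t]) (f t - q.[t]); lra.
have := nb_tri (nb_tri h1 h2) (nb_sym hpT).
by have -> : e / 4 + e / 2 + e / 4 = e by lra.
Qed.

Lemma FC_fcalc m M f A : m <= M -> bd m M A -> cont_on m M f -> FC m M f A (fcalc f A).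
Proof.
move=> mM bA cf; have [T fT] := FC_exists mM bA cf.
by rewrite (fcalcE mM bA fT).
Qed.

End functional_calculus.

(** The relation [W A = B W] passes to polynomials, then to limits. With two spaces allowed, [W] can
    be a unitary, a coordinate embedding into [hsum], or a contraction exchanging its two defect
    operators. *)
Lemma FC_intertwine {R : realType} {H K : hilbertType R} (W : H -> K) (m M : R)
    (f : R -> R) (A : H -> H) (B : K -> K) (S : H -> H) (T : K -> K) :
  linear W -> (exists c, forall x, nm (W x) <= c * nm x) ->
  (forall x, W (A x) = B (W x)) -> bd m M A -> bd m M B ->
  FC m M f A S -> FC m M f B T -> forall x, W (S x) = T (W x).
Proof.
move=> lW [c0 hc0] WA bA bB [bS hS] fT x; have [bB1 _ _] := bB.
have [c [c1 hc]] : exists c, 0 <= c /\ forall x, nm (W x) <= c * nm x.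
  exists (Num.max 0 c0); split; first by rewrite le_max lexx.
  move=> y; apply: le_trans (hc0 y) _; rewrite ler_wpM2r ?nm_ge0 //.
  by rewrite le_max lexx orbT.
have WB y z : W (y - z) = W y - W z.
  by have := lW (-1) z y; rewrite !scaleN1r ![- _ + _]addrC.
have Wp (p : {poly R}) y : W (poly_op p A y) = poly_op p B (W y).
  elim/poly_ind: p y => [|p k IH] y.
    by rewrite !poly_op0 -[0 in LHS](subrr 0) WB subrr.
  rewrite !poly_opD !poly_opMX !poly_opC -WA -IH.
  by rewrite addrC lW addrC.
apply/eqP; rewrite -subr_eq0; apply/eqP/nm_eps0 => e e0.
have n0 := nm_ge0 x; have n1 := nm_ge0 (W x).
pose C := c * nm x + nm (W x) + 1.
have C0 : 0 < C by rewrite /C ltr_wpDl // addr_ge0 // mulr_ge0.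
have [p [hp hpS]] := hS _ (divr_gt0 e0 C0).
have k0 : 0 <= e / C by rewrite ltW // divr_gt0.
have h2 : nb (e / C) (fun y => T y - poly_op p B y).
  exact: (FC_norm bB (FC_minus bB fT (FC_poly m M p bB1))).
have -> : W (S x) - T (W x) = W (S x - poly_op p A x) - (T (W x) - poly_op p B (W x)).
  by rewrite WB Wp opprB addrA subrK.
apply: le_trans (nmD _ _) _; rewrite nmN.
apply: le_trans (lerD (hc _) (h2 _)) _.
have h3 := ler_wpM2l c1 (hpS x).
rewrite [leRHS](_ : e = e / C * C); last by rewrite divfK // lt0r_neq0.
rewrite mulrCA in h3; move: h3 k0; set k := e / C; set u := nm (S x - _).
by rewrite /C; lra.
Qed.

(** * Positive invertible operators *)

Section positive_operators.
Context {R : realType} {H : hilbertType R}.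
Implicit Types (x y : H) (a b c d e t m M r s : R) (S T : H -> H) (f g : R -> R).
Implicit Types A B X : posop H.

(** A complex quadratic form with real values is Hermitian: expand [hdot (T (x + y)) (x + y)], take
    the imaginary part, then replace [y] by [i y]. *)
Lemma psd_opP T : linear T -> psd_op T <-> (sa T /\ forall x, 0 <= ip (T x) x).
Proof.
move=> lT; split=> [h|[sT h] x].
  have hI x : complex.Im (hdot (T x) x) = 0.
    by have := h x; rewrite lecE /= => /andP[/eqP->].
  split; last by move=> x; have := h x; rewrite lecE /= => /andP[].
  have him x y : ip ('i%C *: T x) y = - ip ('i%C *: T y) x.
    have := hI (x + y); rewrite (linD _ _ lT) !(linearDl, linearDr).
    move/(congr1 (fun u => - u)); rewrite oppr0.
    have ImD (u v : R[i]) : complex.Im (u + v) = complex.Im u + complex.Im v.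
      by case: u; case: v.
    by rewrite !ImD !hI !ip_il; lra.
  move=> x y; have := him x ('i%C *: y).
  rewrite (linZ _ _ lT) ip_i scalerA.
  have -> : 'i%C * 'i%C = -1 :> R[i] by rewrite -expr2 sqr_i.
  by rewrite scaleN1r ipNl scalerA -expr2 sqr_i scaleN1r ipNl (ipC x) => /eqP; rewrite eqr_opp => /eqP; lra.
rewrite lecE /= (h x : 0 <= complex.Re _) andbT; apply/eqP.
have := ip_il (T x) x; rewrite -[LHS]opprK -ip_i (sa_ip_i0 x lT sT); lra.
Qed.

Lemma op_leP S T : linear S -> linear T -> sa S -> sa T ->
  op_le S T <-> forall x, ip (S x) x <= ip (T x) x.
Proof.
move=> lS lT sS sT; rewrite /op_le psd_opP; last first.
  by move=> a u v; rewrite /= lS lT scalerBr opprD addrACA.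
split=> [[_ h] x|h]; first by have := h x; rewrite /= ipDl ipNl subr_ge0.
split=> [x y|x] /=; first by rewrite ipDl ipDr ipNl ipNr sS sT.
by rewrite ipDl ipNl subr_ge0.
Qed.

(* Cauchy-Schwarz for the form [ip (T x) y] *)
Lemma psd_sq T c x : linear T -> sa T -> (forall x, 0 <= ip (T x) x <= c * nm x ^+ 2) ->
  nm (T x) ^+ 2 <= c * ip (T x) x.
Proof.
move=> lT sT h; have [T0|T0] := eqVneq (nm (T x)) 0.
  have := h x; rewrite T0 (nm_eq0 T0) ip0l mulr0 expr0n //.
have n0 : 0 < nm (T x) ^+ 2 by rewrite exprn_gt0 // lt_def T0 nm_ge0.
have : ip (T x) (T x) ^+ 2 <= ip (T x) x * ip (T (T x)) (T x).
  apply: discr_le => [t|]; last by have /andP[] := h x.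
  have /andP[+ _] := h (t%:C *: x + T x).
  rewrite lT ipDl !ipDr !ipZl !ipZr (sT (T x) x); lra.
have /andP[h1 h2] := h (T x); have /andP[h3 _] := h x.
rewrite ipxx => h4; rewrite -(ler_pM2r n0); apply: le_trans h4 _.
by rewrite [c * _]mulrC -mulrA ler_wpM2l.
Qed.

(** If the inverse is bounded by [d], then [nm x <= d * nm (A x)], and [psd_sq] bounds [nm (A x)^2]
    by [c * ip (A x) x]; hence [m = 1 / (d^2 c)]. *)
Lemma posop_bd A : exists m M, [/\ 0 < m, m <= M & bd m M A].
Proof.
case: A => A /= /asboolP[bA pA [_ [S [bS SK _]]]].
have lA := bounded_op_lin bA; have [sA hA] := (psd_opP lA).1 pA.
have [c [c0 hc]] := bounded_op_nb bA; have [d [d0 hd]] := bounded_op_nb bS.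
have hu x : 0 <= ip (A x) x <= c * nm x ^+ 2.
  by rewrite hA; have := nb_ip x hc; rewrite ler_norml => /andP[].
pose m := (d ^+ 2 * c)^-1.
have m0 : 0 < m by rewrite invr_gt0 mulr_gt0 // exprn_gt0.
have hl x : m * nm x ^+ 2 <= ip (A x) x.
  have := psd_sq x lA sA hu; have := hd (A x); rewrite SK => h1 h2.
  rewrite mulrC ler_pdivrMr ?mulr_gt0 ?exprn_gt0 //.
  have : nm x ^+ 2 <= d ^+ 2 * nm (A x) ^+ 2.
    by rewrite -exprMn ler_pXn2r // nnegrE ?mulr_ge0 ?nm_ge0 ?ltW.
  move=> h3; apply: le_trans h3 _; rewrite [leRHS](_ : _ = d ^+ 2 * (c * ip (A x) x)); last by ring.
  by rewrite ler_wpM2l ?exprn_ge0 ?(ltW d0).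
(* On the zero space [m <= c] may fail, hence the maximum. *)
exists m, (Num.max m c); split; rewrite ?le_max ?lexx //; split=> // x.
rewrite hl; have /andP[_ h] := hu x; apply: le_trans h _.
by rewrite ler_wpM2r ?sqr_ge0 // le_max lexx orbT.
Qed.

Lemma bd_posinv m M T : 0 < m -> m <= M -> bd m M T -> posinv_op T.
Proof.
move=> m0 mM bT; have [b1 sT h] := bT; split=> //.
  apply/psd_opP; [exact: bounded_op_lin|split=> // x].
  by have /andP[+ _] := h x; apply: le_trans; rewrite mulr_ge0 ?sqr_ge0 // ltW.
have := @bd_invertible _ _ m M T 0 mM bT.
have -> : (fun x => T x - 0%:C *: x) = T by apply/funext => x; rewrite scale0r subr0.
by apply; rewrite leNgt m0.
Qed.

Lemma to_posopE m M T : 0 < m -> m <= M -> bd m M T -> to_posop T = T :> (H -> H).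
Proof.
move=> m0 mM bT; rewrite /to_posop -[LHS]/(val _) insubdK //.
by rewrite -topredE /=; apply/asboolP; exact: bd_posinv bT.
Qed.

Lemma posop_sa A : sa A.
Proof. by have [m [M [_ _ []]]] := posop_bd A. Qed.

Lemma posop_lin A : linear A.
Proof. by have [m [M [_ _ [[]]]]] := posop_bd A. Qed.

Lemma posop_leP A B : op_le A B <-> forall x, ip (A x) x <= ip (B x) x.
Proof. by apply: op_leP; try exact: posop_lin; exact: posop_sa. Qed.

Lemma sa_scale c : sa (fun x : H => c%:C *: x).
Proof. by move=> x y; rewrite ipZl ipZr. Qed.

Lemma op_le_scalel c A : op_le (fun x => c%:C *: x) A <-> forall x, c * nm x ^+ 2 <= ip (A x) x.
Proof.
rewrite op_leP; [|exact: bounded_op_lin (bop_scale c)|exact: posop_lin|exact: sa_scale|exact: posop_sa].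
by split=> h x; have := h x; rewrite ipZl ipxx.
Qed.

Lemma op_le_scaler c A : op_le A (fun x => c%:C *: x) <-> forall x, ip (A x) x <= c * nm x ^+ 2.
Proof.
rewrite op_leP; [|exact: posop_lin|exact: bounded_op_lin (bop_scale c)|exact: posop_sa|exact: sa_scale].
by split=> h x; have := h x; rewrite ipZl ipxx.
Qed.

Lemma SigmaP e A : Sigma e A <-> bd e e^-1 A.
Proof.
rewrite /Sigma /=; split=> [[/op_le_scalel h1 /op_le_scaler h2]|[_ _ h]].
  by split; [exact: posop_bounded|exact: posop_sa|move=> x; rewrite h1 h2].
by split; [apply/op_le_scalel|apply/op_le_scaler] => x; have /andP[] := h x.
Qed.

Lemma posop_le_anti A B : op_le A B -> op_le B A -> A = B.
Proof.
move=> /posop_leP h1 /posop_leP h2; apply: val_inj; apply: nb0_eq.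
have lA := posop_lin A; have lB := posop_lin B.
have bAB : bd 0 0 (fun x => A x - B x).
  split; first by apply: bop_sub; exact: posop_bounded.
    by move=> x y; rewrite ipDl ipDr ipNl ipNr !posop_sa.
  by move=> x; rewrite mul0r ipDl ipNl; apply/andP; split; have := h1 x; have := h2 x; lra.
by have := bd_nb bAB; rewrite normr0 addr0.
Qed.

Lemma posop_le_trans A B X : op_le A B -> op_le B X -> op_le A X.
Proof. by rewrite !posop_leP => h1 h2 x; exact: le_trans (h2 x). Qed.

Lemma posop_le_refl A : op_le A A.
Proof. by rewrite posop_leP. Qed.

Lemma posop_distP A B c : 0 <= c -> posop_dist A B <= c <-> nb c (fun x => A x - B x).
Proof.
move=> c0; split; last exact: opnorm_le.
by move=> h; apply: opnorm_nb h; apply: bop_sub; exact: posop_bounded.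
Qed.

Lemma cont_powR a r : 0 < a -> {for a, continuous (fun t : R => t `^ r)}.
Proof.
move=> a0; apply: differentiable_continuous; apply/derivable1_diffP.
by apply: derivable_powR; rewrite in_itv /= a0.
Qed.

Lemma cont_on_powR m M r : 0 < m -> cont_on m M (fun t => t `^ r).
Proof. by move=> m0 x /andP[mx _]; apply: cont_powR; exact: lt_le_trans mx. Qed.

Lemma op_powE m M T r : 0 < m -> m <= M -> bd m M T ->
  FC m M (fun t => t `^ r) T (op_pow T r).
Proof. by move=> m0 mM bT; apply: FC_fcalc => //; exact: cont_on_powR. Qed.

Lemma powR_pos_bounds m M r : 0 < m -> m <= M -> exists k K, [/\ 0 < k, k <= K &
  forall t, m <= t <= M -> k <= t `^ r <= K].
Proof.
move=> m0 mM; have M0 : 0 < M by exact: lt_le_trans mM.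
have [r0|r0] := leP 0 r.
  exists (m `^ r), (M `^ r); split; [exact: powR_gt0|by apply: ge0_ler_powR => //; rewrite nnegrE ltW|].
  move=> t /andP[mt tM]; apply/andP; split; apply: ge0_ler_powR => //; rewrite nnegrE ?ltW //.
  - exact: lt_le_trans mt.
  - exact: lt_le_trans mt.
have nr : 0 <= - r by rewrite oppr_ge0 ltW.
have hE t : t `^ r = (t `^ (- r))^-1 by rewrite -powRN opprK.
exists (M `^ r), (m `^ r); split; first exact: powR_gt0.
  rewrite !hE lef_pV2 ?posrE ?powR_gt0 //.
  by apply: ge0_ler_powR => //; rewrite nnegrE ltW.
move=> t /andP[mt tM]; have t0 : 0 < t by exact: lt_le_trans mt.
rewrite !hE !lef_pV2 ?posrE ?powR_gt0 //.
by apply/andP; split; apply: ge0_ler_powR => //; rewrite nnegrE ltW.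
Qed.

Lemma pow_bd m M T r : 0 < m -> m <= M -> bd m M T ->
  exists k K, [/\ 0 < k, k <= K & bd k K (op_pow T r)].
Proof.
move=> m0 mM bT; have [k [K [k0 kK h]]] := powR_pos_bounds r m0 mM.
by exists k, K; split=> //; exact: (FC_bd bT (op_powE r m0 mM bT)).
Qed.

Lemma op_powD A r s x : op_pow A r (op_pow A s x) = op_pow A (r + s) x.
Proof.
have [m [M [m0 mM bA]]] := posop_bd A.
suff -> : op_pow A (r + s) = (fun x => op_pow A r (op_pow A s x)) by [].
apply: (FC_unique bA (op_powE _ m0 mM bA)).
apply: FC_ext (FC_mul bA (op_powE r m0 mM bA) (op_powE s m0 mM bA)) => t /andP[mt _].
by rewrite powRD //; apply/implyP => _; rewrite gt_eqF // (lt_le_trans m0).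
Qed.

Lemma op_pow0 A x : op_pow A 0 x = x.
Proof.
have [m [M [m0 mM bA]]] := posop_bd A; have [b1 _ _] := bA.
have -> : op_pow A 0 = (fun x => 1%:C *: x); last by rewrite scale1r.
apply: (FC_unique bA (op_powE _ m0 mM bA)).
by apply: FC_ext (FC_cst m M 1 b1) => t _; rewrite powRr0.
Qed.

Lemma op_pow1 A x : op_pow A 1 x = A x.
Proof.
have [m [M [m0 mM bA]]] := posop_bd A; have [b1 _ _] := bA.
suff -> : op_pow A 1 = A by [].
apply: (FC_unique bA (op_powE _ m0 mM bA)).
by apply: FC_ext (FC_id m M b1) => t /andP[mt _]; rewrite powRr1 // ltW // (lt_le_trans m0).
Qed.

Lemma op_pow_bop A r : bounded_op (op_pow A r).
Proof. by have [m [M [m0 mM bA]]] := posop_bd A; case: (op_powE r m0 mM bA). Qed.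

Lemma op_pow_sa A r : sa (op_pow A r).
Proof. by have [m [M [m0 mM bA]]] := posop_bd A; exact: FC_sa bA (op_powE r m0 mM bA). Qed.

Lemma pow_posopE A r : pow_posop r A = op_pow A r :> (H -> H).
Proof.
have [m [M [m0 mM bA]]] := posop_bd A; have [k [K [k0 kK bp]]] := pow_bd r m0 mM bA.
exact: to_posopE bp.
Qed.

Lemma op_pow_pow A r s x : op_pow (pow_posop r A) s x = op_pow A (r * s) x.
Proof.
have [m [M [m0 mM bA]]] := posop_bd A; have [k [K [k0 kK h]]] := powR_pos_bounds r m0 mM.
have bp : bd k K (pow_posop r A) by rewrite pow_posopE; exact: FC_bd bA (op_powE r m0 mM bA) h.
have := op_powE s k0 kK bp; rewrite {1}pow_posopE => fs.
suff -> : op_pow (pow_posop r A) s = op_pow A (r * s) by [].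
have h1 := FC_comp bA (op_powE r m0 mM bA) h fs.
by apply: (FC_unique bA h1); apply: FC_ext (op_powE (r * s) m0 mM bA) => t _; rewrite powRrM.
Qed.

Lemma posop_sqr_half A x : op_pow A 2^-1 (op_pow A 2^-1 x) = A x.
Proof. by rewrite op_powD -op_pow1; congr op_pow; lra. Qed.

Lemma op_powK A r x : op_pow A r (op_pow A (- r) x) = x.
Proof. by rewrite op_powD subrr op_pow0. Qed.

Lemma op_powNK A r x : op_pow A (- r) (op_pow A r x) = x.
Proof. by rewrite op_powD addNr op_pow0. Qed.

Lemma bd_congr m M T (C D : H -> H) a b : 0 <= m -> 0 <= M -> bd m M T -> bounded_op C -> bounded_op D ->
  (forall x y, ip (C x) y = ip x (D y)) ->
  (forall x, a * nm x ^+ 2 <= nm (D x) ^+ 2 <= b * nm x ^+ 2) ->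
  bd (m * a) (M * b) (fun x => C (T (D x))).
Proof.
move=> m0 M0 [bT sT hT] bC bD CD hab; split.
- by apply: bop_comp => //; exact: bop_comp.
- by move=> x y; rewrite CD sT (ipC x) CD ipC.
- move=> x; rewrite CD; have /andP[h1 h2] := hT (D x); have /andP[h3 h4] := hab x.
  rewrite -!mulrA; apply/andP; split.
    by apply: le_trans h1; rewrite ler_wpM2l.
  by apply: le_trans h2 _; rewrite ler_wpM2l.
Qed.

End positive_operators.

(** * Orthogonal sum of two copies of a Hilbert space *)

(** A separate name, because the pair type carries the maximum norm, which comes from no inner
    product. Operator monotonicity on this space is monotonicity for 2x2 block operators over
    [H]. *)
Definition hsum {R : realType} (H : hilbertType R) : Type := (H * H)%type.

Section hilbert_sum.
Context {R : realType} {H : hilbertType R}.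

HB.instance Definition _ := GRing.Lmodule.copy (hsum H) (H * H)%type.

Implicit Types u v w : hsum H.

Definition hsum_nm u : R := Num.sqrt (nm u.1 ^+ 2 + nm u.2 ^+ 2).

Lemma hsum_nm2 u : hsum_nm u ^+ 2 = nm u.1 ^+ 2 + nm u.2 ^+ 2.
Proof. by rewrite sqr_sqrtr // addr_ge0 ?sqr_ge0. Qed.

Lemma hsum_nm_ge0 u : 0 <= hsum_nm u. Proof. exact: sqrtr_ge0. Qed.

Lemma hsum_nmD u v : ((hsum_nm (u + v))%:C <= (hsum_nm u)%:C + (hsum_nm v)%:C)%R.
Proof.
rewrite -rmorphD /= lecR; apply: ler_sq; first by rewrite addr_ge0 ?hsum_nm_ge0.
rewrite hsum_nm2 /= !nm2D.
have : ip u.1 v.1 + ip u.2 v.2 <= hsum_nm u * hsum_nm v; last first.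
  have := hsum_nm2 u; have := hsum_nm2 v; nra.
apply: ler_sq; first by rewrite mulr_ge0 ?hsum_nm_ge0.
rewrite exprMn !hsum_nm2; have h1 := ip_norm_le u.1 v.1; have h2 := ip_norm_le u.2 v.2.
have : `|ip u.1 v.1 + ip u.2 v.2| <= nm u.1 * nm v.1 + nm u.2 * nm v.2.
  by apply: le_trans (ler_normD _ _) _; exact: lerD.
have nn := normr_ge0 (ip u.1 v.1 + ip u.2 v.2).
rewrite -(real_normK (num_real (ip u.1 v.1 + ip u.2 v.2))) => h.
have : `|ip u.1 v.1 + ip u.2 v.2| ^+ 2 <= (nm u.1 * nm v.1 + nm u.2 * nm v.2) ^+ 2.
  by rewrite ler_pXn2r // nnegrE ?addr_ge0 ?mulr_ge0 ?nm_ge0.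
move=> h3; apply: le_trans h3 _.
have := sqr_ge0 (nm u.1 * nm v.2 - nm u.2 * nm v.1); nra.
Qed.

Lemma hsum_nmZ (k : R[i]) u : ((hsum_nm (k *: u))%:C = `|k| * (hsum_nm u)%:C)%R.
Proof.
have -> : `|k| = (complex.Re `|k|)%:C by rewrite RRe_real ?normr_real.
have k0 : 0 <= complex.Re `|k|.
  by rewrite -lecR RRe_real ?normr_real //; exact: normr_ge0.
rewrite -rmorphM /=; congr (_%:C); apply/eqP.
rewrite -(@eqrXn2 _ 2%N) ?hsum_nm_ge0 ?mulr_ge0 ?hsum_nm_ge0 //.
by rewrite exprMn !hsum_nm2 /= !nmZc !exprMn mulrDr.
Qed.

Lemma hsum_nm_eq0 u : (hsum_nm u)%:C = 0 -> u = 0.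
Proof.
move=> /complexI h; have := hsum_nm2 u; rewrite h expr0n /=.
have := sqr_ge0 (nm u.1); have := sqr_ge0 (nm u.2) => h1 h2 h3.
have /eqP : nm u.1 ^+ 2 = 0 by lra.
have /eqP : nm u.2 ^+ 2 = 0 by lra.
rewrite !sqrf_eq0 => /eqP/nm_eq0 e2 /eqP/nm_eq0 e1.
by case: u e1 e2 {h h1 h2 h3} => a b /= -> ->.
Qed.

HB.instance Definition _ := Lmodule_isNormed.Build R[i] (hsum H)
  hsum_nmD hsum_nmZ hsum_nm_eq0.

Lemma hsum_normE u : `|u| = (hsum_nm u)%:C.
Proof. by []. Qed.

Lemma hsum_nm_fst u : nm u.1 <= hsum_nm u.
Proof.
apply: ler_sq; rewrite ?hsum_nm_ge0 // hsum_nm2; have := sqr_ge0 (nm u.2); lra.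
Qed.

Lemma hsum_nm_snd u : nm u.2 <= hsum_nm u.
Proof.
apply: ler_sq; rewrite ?hsum_nm_ge0 // hsum_nm2; have := sqr_ge0 (nm u.1); lra.
Qed.

Lemma hsum_nm_le u : hsum_nm u <= nm u.1 + nm u.2.
Proof.
have := nm_ge0 u.1; have := nm_ge0 u.2 => h1 h2.
apply: ler_sq; first by lra.
rewrite hsum_nm2; nra.
Qed.

Lemma hsum_complete (F : set_system (hsum H)) : ProperFilter F -> cauchy F -> cvg F.
Proof.
move=> FF /cauchyP cF.
have proj (g : hsum H -> H) : (forall u v, `|g u - g v| <= `|u - v|) -> cvg (g @ F).
  move=> hg; apply: cauchy_cvg; apply: cauchy_exP => e e0.
  have [u Fu] := cF e e0; exists (g u); rewrite /nbhs /=.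
  apply: filterS Fu => v; rewrite -!ball_normE /=; apply: le_lt_trans; exact: hg.
have /cvg_ex[/= l1 h1] : cvg ((fun u : hsum H => u.1) @ F).
  by apply: proj => u v; rewrite hsum_normE -nmE lecR; exact: (hsum_nm_fst (u - v)).
have /cvg_ex[/= l2 h2] : cvg ((fun u : hsum H => u.2) @ F).
  by apply: proj => u v; rewrite hsum_normE -nmE lecR; exact: (hsum_nm_snd (u - v)).
apply/cvg_ex; exists ((l1, l2) : hsum H); apply/cvgrPdist_le => e e0.
have e20 : 0 < e / 2 by rewrite divr_gt0.
move/cvgrPdist_le : h1 => /(_ _ e20) h1; move/cvgrPdist_le : h2 => /(_ _ e20) h2.
apply: filterS2 h1 h2 => u /= u1 u2; rewrite hsum_normE.
apply: (@le_trans _ _ (nm (l1 - u.1) + nm (l2 - u.2))%:C).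
  by rewrite lecR; exact: (hsum_nm_le (((l1, l2) : hsum H) - u)).
by rewrite rmorphD /= !nmE [e]splitr lerD.
Qed.

HB.instance Definition _ := Uniform_isComplete.Build (hsum H) hsum_complete.

Definition hsum_dot u v : R[i] := hdot u.1 v.1 + hdot u.2 v.2.

Lemma hsum_dotl v : zmod_morphism (hsum_dot ^~ v).
Proof. by move=> u w; rewrite /hsum_dot /= !linearBl opprD addrACA. Qed.

Lemma hsum_dotr u : zmod_morphism (hsum_dot u).
Proof. by move=> v w; rewrite /hsum_dot /= !linearBr opprD addrACA. Qed.

Lemma hsum_dotZl v : scalable_for *%R (hsum_dot ^~ v).
Proof. by move=> k u; rewrite /hsum_dot /= !linearZl_LR /= mulrDr. Qed.

Lemma hsum_dotZr u : scalable_for (@Num.conj R[i] \; *%R) (hsum_dot u).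
Proof. by move=> k v; rewrite /hsum_dot /= !linearZr_LR /= mulrDr. Qed.

HB.instance Definition _ := isBilinear.Build R[i] (hsum H) (hsum H) R[i] *%R
  (@Num.conj R[i] \; *%R) hsum_dot hsum_dotl hsum_dotr hsum_dotZl hsum_dotZr.

Lemma hsum_dotC u v : hsum_dot u v = (-1) ^+ false * Num.conj (hsum_dot v u).
Proof.
rewrite expr0 mul1r /hsum_dot rmorphD /=.
by rewrite (@hermC _ _ _ _ hdot u.1) (@hermC _ _ _ _ hdot u.2) /= expr0 !mul1r.
Qed.

HB.instance Definition _ := isHermitianSesquilinear.Build R[i] (hsum H) false
  (@Num.conj R[i]) hsum_dot hsum_dotC.

Lemma hsum_dot_norm u : hsum_dot u u = `|u| ^+ 2.
Proof.
by rewrite /hsum_dot !hdot_norm hsum_normE -rmorphXn /= hsum_nm2 rmorphD /= !rmorphXn /= !nmE.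
Qed.

Lemma hsum_dot_gt0 u : u != 0 -> 0 < hsum_dot u u.
Proof. by move=> u0; rewrite hsum_dot_norm exprn_gt0 // normr_gt0. Qed.

HB.instance Definition _ := isDotProduct.Build R[i] (hsum H) hsum_dot hsum_dot_gt0.

HB.instance Definition _ := isHilbert.Build R (hsum H) hsum_dot_norm.

Lemma hsum_ipE u v : ip u v = ip u.1 v.1 + ip u.2 v.2.
Proof. by rewrite /ip -ReD. Qed.

Lemma hsum_nm2E u : nm u ^+ 2 = nm u.1 ^+ 2 + nm u.2 ^+ 2.
Proof. by rewrite -!ipxx hsum_ipE. Qed.

End hilbert_sum.

(** * The Loewner-Heinz inequality *)

Section loewner_heinz.
Context {R : realType} {H : hilbertType R}.
Implicit Types (x y : H) (a b c d e t m M r s : R) (P Q S T : H -> H).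
Implicit Types A B : posop H.

Lemma nb_adj S T : (forall x y, ip (S x) y = ip x (T y)) -> nb 1 S -> nb 1 T.
Proof.
move=> ST hS x; rewrite mul1r.
have : nm (T x) ^+ 2 <= nm (T x) * nm x.
  rewrite -ipxx -ST; apply: le_trans (ipCS _ _) _.
  by rewrite ler_wpM2r ?nm_ge0 // -[X in _ <= X]mul1r.
have := nm_ge0 (T x); rewrite le_eqVlt => /orP[/eqP<- _|h0]; first exact: nm_ge0.
by rewrite expr2 ler_pM2l.
Qed.

(* [n |-> nm (P^n x)] is log-convex, so a bounded one cannot increase *)
Lemma power_bounded_contraction P c : sa P ->
  (forall n x, nm (iter n P x) <= c * nm x) -> nb 1 P.
Proof.
move=> sP hc x; rewrite mul1r leNgt; apply/negP => hx.
have x0 : 0 < nm x.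
  rewrite lt_def nm_ge0 andbT; apply/eqP => x0; have := hc 1%N x.
  by rewrite /= x0 mulr0 leNgt -x0 hx.
pose r := nm (P x) / nm x.
have r1 : 1 < r by rewrite ltr_pdivlMr // mul1r.
have step n : 0 < nm (iter n P x) /\ r * nm (iter n P x) <= nm (iter n.+1 P x).
  elim: n => [|n [h0 h1]]; first by split=> //=; rewrite divfK // gt_eqF.
  have r0 : 0 < r by lra.
  have h2 : 0 < nm (iter n.+1 P x) by apply: lt_le_trans h1; rewrite mulr_gt0.
  split=> //; rewrite -(ler_pM2l h0).
  apply: (@le_trans _ _ (nm (iter n.+1 P x) ^+ 2)).
    by rewrite expr2 mulrA ler_pM2r // mulrC.
  by rewrite -ipxx /= sP; exact: ipCS.
(* Bernoulli's inequality for [r^n], enough to outgrow [c]. *)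
have grow n : (1 + n%:R * (r - 1)) * nm x <= nm (iter n P x).
  elim: n => [|n IH]; first by rewrite mul0r addr0 mul1r.
  have [_] := step n; apply: le_trans.
  have n0 : (0 : R) <= n%:R by [].
  apply: (@le_trans _ _ (r * ((1 + n%:R * (r - 1)) * nm x))); last by rewrite ler_pM2l //; lra.
  rewrite mulrA ler_pM2r // -natr1.
  by have := mulr_ge0 n0 (sqr_ge0 (r - 1)); lra.
have [n hn] : exists n : nat, c < 1 + n%:R * (r - 1).
  exists (Num.truncn (c / (r - 1))).+1.
  have : c / (r - 1) < (Num.truncn (c / (r - 1))).+1%:R by exact: truncnS_gt.
  by rewrite ltr_pdivrMr ?subr_gt0 //; lra.
have := le_trans (grow n) (hc n x); rewrite ler_pM2r // => h.
by have := lt_le_trans hn h; rewrite ltxx.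
Qed.

Lemma op_pow_nm2 A r x : nm (op_pow A (r / 2) x) ^+ 2 = ip (op_pow A r x) x.
Proof. by rewrite -ipxx op_pow_sa op_powD ipC -splitr. Qed.

Let good A B s := forall x, ip (op_pow A s x) x <= ip (op_pow B s x) x.

(* Pedersen: [B^(-u/2) A^u B^(-u/2)] is similar to a product of two contractions. *)
Lemma op_pow_mid A B s t : good A B s -> good A B t -> good A B ((s + t) / 2).
Proof.
move=> gs gt; set u := (s + t) / 2.
have V r : good A B r -> nb 1 (fun x => op_pow A (r / 2) (op_pow B (- (r / 2)) x)).
  move=> gr x; rewrite mul1r; apply: ler_sq; first exact: nm_ge0.
  by rewrite op_pow_nm2; apply: le_trans (gr _) _; rewrite -op_pow_nm2 op_powK.
have V' r : good A B r -> nb 1 (fun x => op_pow B (- (r / 2)) (op_pow A (r / 2) x)).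
  by move=> gr; apply: nb_adj (V r gr) => x y; rewrite !op_pow_sa.
pose Q x := op_pow B (- (s / 2)) (op_pow A (s / 2) (op_pow A (t / 2) (op_pow B (- (t / 2)) x))).
have nQ : nb 1 Q by have := nbM ler01 (V' _ gs) (V _ gt); rewrite mul1r.
(* The exponent [(s - t) / 4] turns the outer powers [- s / 2] and [- t / 2] of [Q] into two equal
   ones, [- u / 2]. So [P = W Q W'] is self-adjoint, and its powers are bounded because those of [Q]
   are. *)
pose W := op_pow B ((s - t) / 4); pose W' := op_pow B (- ((s - t) / 4)).
pose P x := op_pow B (- (u / 2)) (op_pow A u (op_pow B (- (u / 2)) x)).
have PE x : P x = W (Q (W' x)).
  rewrite /P /Q /W /W' !op_powD.
  congr (op_pow B _ (op_pow A _ (op_pow B _ x))); rewrite /u; lra.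
have itP n x : iter n P x = W (iter n Q (W' x)).
  elim: n => [|n IH] /=; first by rewrite /W /W' op_powK.
  by rewrite IH PE /W /W' op_powNK.
have nQn n : nb 1 (iter n Q).
  elim: n => [|n IH] x /=; first by rewrite mul1r.
  by rewrite mul1r; apply: le_trans (nQ _) _; rewrite mul1r -[X in _ <= X]mul1r.
have [w [w0 hw]] := bounded_op_nb (op_pow_bop B ((s - t) / 4)).
have [w' [w0' hw']] := bounded_op_nb (op_pow_bop B (- ((s - t) / 4))).
have sP : sa P by move=> x y; rewrite /P !op_pow_sa.
have hP : nb 1 P.
  apply: (@power_bounded_contraction P (w * w') sP) => n x; rewrite itP.
  apply: le_trans (hw _) _; rewrite -mulrA ler_wpM2l ?(ltW w0) //.
  by apply: le_trans (nQn n _) _; rewrite mul1r.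
move=> x; have := nb_ip (op_pow B (u / 2) x) hP.
rewrite /P op_powNK op_pow_sa op_powNK op_pow_nm2 mul1r.
by apply: le_trans; exact: ler_norm.
Qed.

Lemma powR_le_near m M k s r t : 1 <= k -> M <= k -> k^-1 <= m -> 0 < m -> m <= t <= M ->
  t `^ s <= k `^ `|s - r| * t `^ r.
Proof.
move=> k1 Mk km m0 /andP[mt tM]; have t0 : 0 < t by exact: lt_le_trans mt.
have k0 : 0 < k by exact: lt_le_trans k1.
have -> : t `^ s = t `^ (s - r) * t `^ r.
  by rewrite -powRD ?subrK //; apply/implyP => _; rewrite gt_eqF.
rewrite ler_wpM2r ?powR_ge0 //; have [h|h] := leP 0 (s - r).
  rewrite ger0_norm //; apply: ge0_ler_powR => //; rewrite ?nnegrE ?(ltW t0) ?(ltW k0) //.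
  exact: le_trans Mk.
rewrite ltr0_norm //.
have -> : t `^ (s - r) = t^-1 `^ (- (s - r)).
  by rewrite -powR_inv1 ?(ltW t0) // -powRrM mulN1r opprK.
apply: ge0_ler_powR; rewrite ?nnegrE ?invr_ge0 ?(ltW t0) ?(ltW k0) //.
  by rewrite oppr_ge0 ltW.
by rewrite invf_ple ?posrE //; exact: le_trans mt.
Qed.

(** With [k] above the bounds of [A], [B] and their inverses, passing between the exponents [s] and
    [r] costs a factor [k^|s - r|] on each side, which tends to [1]. *)
Lemma op_pow_good_closed A B s : (forall d, 0 < d -> exists r, `|s - r| <= d /\ good A B r) ->
  good A B s.
Proof.
move=> h x.
have [m [M [m0 mM bA]]] := posop_bd A; have [m' [M' [m0' mM' bB]]] := posop_bd B.
pose k := Num.max 1 (Num.max (Num.max M M') (Num.max m^-1 m'^-1)).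
have k1 : 1 <= k by rewrite le_max lexx.
have k0 : 0 < k by exact: lt_le_trans k1.
have hM : M <= k by rewrite /k !le_max lexx !orbT.
have hM' : M' <= k by rewrite /k !le_max lexx !orbT.
have hm : k^-1 <= m by rewrite invf_ple ?posrE // /k !le_max lexx !orbT.
have hm' : k^-1 <= m' by rewrite invf_ple ?posrE // /k !le_max lexx !orbT.
have near C m1 M1 r1 r2 y : 0 < m1 -> m1 <= M1 -> bd m1 M1 (C : posop H) -> M1 <= k -> k^-1 <= m1 ->
    ip (op_pow C r1 y) y <= k `^ `|r1 - r2| * ip (op_pow C r2 y) y.
  move=> m10 mM1 bC h1 h2; rewrite -ipZl.
  apply: (FC_le bC (op_powE r1 m10 mM1 bC) (FC_scale _ bC (op_powE r2 m10 mM1 bC))) => t ht.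
  exact: (powR_le_near _ _ k1 h1 h2 m10 ht).
have q0 : 0 <= ip (op_pow B s x) x by rewrite -op_pow_nm2 sqr_ge0.
apply/ler_addgt0Pr => e e0.
pose e' := e / (ip (op_pow B s x) x + 1).
have e'0 : 0 < e' by rewrite divr_gt0 //; lra.
have [d [d0 hd]] := contP (@continuous_expR R 0) e'0.
have lk : 0 <= ln k by rewrite ln_ge0.
(* Ensures [2 |s - r| ln k < d], the range in which [exp] is within [e'] of [1]. *)
pose d' := d / (4 * (ln k + 1)).
have d'0 : 0 < d' by rewrite divr_gt0 // mulr_gt0 //; lra.
have [r [sr gr]] := h _ d'0.
have kk : k `^ `|s - r| * k `^ `|r - s| <= 1 + e'.
  rewrite (distrC r) -powRD; last by apply/implyP => _; rewrite gt_eqF.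
  rewrite /powR gt_eqF //.
  have := hd ((`|s - r| + `|s - r|) * ln k); rewrite subr0 expR0.
  have -> : `|(`|s - r| + `|s - r|) * ln k| < d.
    rewrite ger0_norm ?mulr_ge0 ?addr_ge0 //.
    have : `|s - r| * (4 * (ln k + 1)) <= d by rewrite -ler_pdivlMr // mulr_gt0 //; lra.
    by have := mulr_ge0 (normr_ge0 (s - r)) lk; have := normr_ge0 (s - r); lra.
  by move=> /(_ isT); rewrite ler_norml => /andP[_]; lra.
apply: le_trans (near A _ _ s r x m0 mM bA hM hm) _.
apply: le_trans (ler_wpM2l (powR_ge0 _ _) (gr x)) _.
apply: le_trans (ler_wpM2l (powR_ge0 _ _) (near B _ _ r s x m0' mM' bB hM' hm')) _.
rewrite mulrA; apply: le_trans (ler_wpM2r q0 kk) _.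
have : e' * (ip (op_pow B s x) x + 1) = e by rewrite divfK // gt_eqF //; lra.
lra.
Qed.

(** The good exponents form a closed, midpoint-convex set containing [0] and [1]. If [s] were bad,
    the nearest good exponents [a < s < b] would have a good midpoint strictly between them. *)
Lemma loewner_heinz A B s : op_le A B -> 0 <= s <= 1 -> good A B s.
Proof.
move=> /posop_leP AB /andP[s0 s1]; apply: contrapT => ngs.
have g0 : good A B 0 by move=> x; rewrite !op_pow0.
have g1 : good A B 1 by move=> x; rewrite !op_pow1.
pose S := [set r | 0 <= r <= s /\ good A B r].
pose S' := [set r | s <= r <= 1 /\ good A B r].
have hS : has_sup S by split; [exists 0; split; rewrite ?lexx|exists s => r [/andP[]]].
have hS' : has_inf S' by split; [exists 1; split; rewrite ?lexx ?s1|exists s => r [/andP[]]].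
pose a := sup S; pose b := inf S'.
have ga : good A B a.
  apply: op_pow_good_closed => d d0; have [r Sr ar] := sup_adherent d0 hS.
  exists r; split; last by case: Sr.
  have := sup_upper_bound hS Sr; rewrite -/a in ar * => ra.
  by rewrite ger0_norm; lra.
have gb : good A B b.
  apply: op_pow_good_closed => d d0; have [r Sr br] := inf_adherent d0 hS'.
  exists r; split; last by case: Sr.
  have := ge_inf hS'.2 Sr; rewrite -/b in br * => rb.
  by rewrite ler0_norm; lra.
have as_ : a <= s by apply: ge_sup; [case: hS|move=> r [/andP[]]].
have sb : s <= b by apply: lb_le_inf; [case: hS'|move=> r [/andP[]]].
have a0 : 0 <= a by apply: (sup_upper_bound hS); split; rewrite ?lexx.
have b1 : b <= 1 by apply: (ge_inf hS'.2); split; rewrite ?lexx ?s1.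
have as' : a < s.
  by rewrite lt_neqAle as_ andbT; apply/eqP => e; apply: ngs; rewrite -e.
have sb' : s < b.
  by rewrite lt_neqAle sb andbT; apply/eqP => e; apply: ngs; rewrite e.
have gm := op_pow_mid ga gb.
have [h|h] := leP ((a + b) / 2) s.
  have : (a + b) / 2 <= a by apply: (sup_upper_bound hS); split=> //; apply/andP; split; lra.
  lra.
have : b <= (a + b) / 2 by apply: (ge_inf hS'.2); split=> //; apply/andP; split; lra.
lra.
Qed.

End loewner_heinz.

Lemma powR_operator_monotone (R : realType) (s : R) : 0 <= s <= 1 ->
  operator_monotone (fun t : R => t `^ s).
Proof.
move=> hs; split; first by move=> x; rewrite inE /= => x0; exact: cont_powR.
move=> K A B AB; rewrite -/(op_pow A s) -/(op_pow B s).
apply/op_leP; try exact: op_pow_sa; try exact: bounded_op_lin (op_pow_bop _ _).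
exact: loewner_heinz.
Qed.

(** * Block operators *)

Section fcalc_lemmas.
Context {R : realType}.
Implicit Types (H K : hilbertType R) (f : R -> R) (m M e t : R).

Definition pcont f := {in [pred x | 0 < x], continuous f}.

Lemma pcont_on f m M : pcont f -> 0 < m -> cont_on m M f.
Proof. by move=> cf m0 x /andP[mx _]; apply: cf; rewrite inE /=; exact: lt_le_trans mx. Qed.

Lemma fFC H f m M (T : H -> H) : pcont f -> 0 < m -> m <= M -> bd m M T ->
  FC m M f T (fcalc f T).
Proof. by move=> cf m0 mM bT; apply: FC_fcalc => //; exact: pcont_on. Qed.

Lemma fcalc_sa H f m M (T : H -> H) : pcont f -> 0 < m -> m <= M -> bd m M T -> sa (fcalc f T).
Proof. by move=> cf m0 mM bT; exact: FC_sa bT (fFC cf m0 mM bT). Qed.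

Lemma fcalc_bop H f m M (T : H -> H) : pcont f -> 0 < m -> m <= M -> bd m M T ->
  bounded_op (fcalc f T).
Proof. by move=> cf m0 mM bT; case: (fFC cf m0 mM bT). Qed.

Lemma bd_scale H e : bd e e (fun x : H => e%:C *: x).
Proof.
split; [exact: bop_scale|exact: sa_scale|].
by move=> x; rewrite ipZl ipxx lexx.
Qed.

Lemma fcalc_scalar H f e : pcont f -> 0 < e ->
  fcalc f (fun x : H => e%:C *: x) = (fun x => (f e)%:C *: x).
Proof.
move=> cf e0; have be := @bd_scale H e.
apply: (fcalcE (lexx e) be); apply: FC_ext (FC_cst e e (f e) (bop_scale e)) => t.
by move=> /andP[h1 h2]; congr f; lra.
Qed.

Lemma opmon_fcalc H f m M m' M' (A B : H -> H) : operator_monotone f ->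
  0 < m -> m <= M -> bd m M A -> 0 < m' -> m' <= M' -> bd m' M' B ->
  (forall x, ip (A x) x <= ip (B x) x) ->
  forall x, ip (fcalc f A x) x <= ip (fcalc f B x) x.
Proof.
move=> [cf hf] m0 mM bA m0' mM' bB AB.
have eA := to_posopE m0 mM bA; have eB := to_posopE m0' mM' bB.
have := hf H (to_posop A) (to_posop B); rewrite eA eB => h.
apply/op_leP; rewrite ?eA ?eB.
- exact: bounded_op_lin (fcalc_bop cf m0 mM bA).
- exact: bounded_op_lin (fcalc_bop cf m0' mM' bB).
- exact: fcalc_sa cf m0 mM bA.
- exact: fcalc_sa cf m0' mM' bB.
- by apply: h; apply/op_leP => //; [case: bA => -[]|case: bB => -[]|case: bA|case: bB].
Qed.

Lemma fcalc_unitary H f m M (T W W' : H -> H) : pcont f -> 0 < m -> m <= M -> bd m M T ->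
  bounded_op W -> bounded_op W' -> (forall x y, ip (W x) y = ip x (W' y)) ->
  cancel W W' -> cancel W' W ->
  bd m M (fun x => W (T (W' x))) /\
  forall x, ip (fcalc f (fun x => W (T (W' x))) x) x = ip (fcalc f T (W' x)) (W' x).
Proof.
move=> cf m0 mM bT bW bW' ad WK W'K.
have nW x : nm (W' x) ^+ 2 = nm x ^+ 2 by rewrite -!ipxx -ad W'K.
have bB : bd m M (fun x => W (T (W' x))).
  rewrite -[m]mulr1 -[M]mulr1.
  apply: (@bd_congr _ _ m M T W W' 1 1) => //; [exact: ltW|lra|by move=> x; rewrite nW mul1r lexx].
split=> // x.
have [c [c0 hc]] := bounded_op_nb bW'.
have := @FC_intertwine _ _ _ W' m M f _ _ _ _ (bounded_op_lin bW') (ex_intro _ c hc) _ bB bT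
  (fFC cf m0 mM bB) (fFC cf m0 mM bT).
by move=> /(_ (fun x => WK _) x) <-; rewrite -ad W'K.
Qed.

End fcalc_lemmas.

Section block_operators.
Context {R : realType} {H : hilbertType R}.
Implicit Types (x y : H) (u v : hsum H) (a b c d e t m M : R) (A B C D E T : H -> H).

Definition blk A B C D : hsum H -> hsum H :=
  fun u => (A u.1 + B u.2, C u.1 + D u.2).

Definition diag A B : hsum H -> hsum H := fun u => (A u.1, B u.2).

Lemma nm_fst u : nm u.1 <= nm u.
Proof. apply: ler_sq; rewrite ?nm_ge0 // hsum_nm2E; have := sqr_ge0 (nm u.2); lra. Qed.

Lemma nm_snd u : nm u.2 <= nm u.
Proof. apply: ler_sq; rewrite ?nm_ge0 // hsum_nm2E; have := sqr_ge0 (nm u.1); lra. Qed.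

Lemma nm_pair x y : nm ((x, y) : hsum H) <= nm x + nm y.
Proof.
have := nm_ge0 x; have := nm_ge0 y => h1 h2.
by apply: ler_sq; [lra|rewrite hsum_nm2E /=; nra].
Qed.

Lemma bop_blk A B C D : bounded_op A -> bounded_op B -> bounded_op C -> bounded_op D ->
  bounded_op (blk A B C D).
Proof.
move=> bA bB bC bD.
have [a [a0 ha]] := bounded_op_nb bA; have [b [b0 hb]] := bounded_op_nb bB.
have [c [c0 hc]] := bounded_op_nb bC; have [d [d0 hd]] := bounded_op_nb bD.
apply/bounded_opP; split.
  move=> k u v; rewrite /blk /=; apply: (f_equal2 pair) => /=.
    by rewrite (bounded_op_lin bA) (bounded_op_lin bB) scalerDr addrACA.
  by rewrite (bounded_op_lin bC) (bounded_op_lin bD) scalerDr addrACA.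
exists (a + b + (c + d)) => u; apply: le_trans (nm_pair _ _) _; rewrite mulrDl.
have hu1 k T : 0 < k -> nb k T -> nm (T u.1) <= k * nm u.
  by move=> k0 hT; apply: le_trans (hT _) _; rewrite ler_pM2l // nm_fst.
have hu2 k T : 0 < k -> nb k T -> nm (T u.2) <= k * nm u.
  by move=> k0 hT; apply: le_trans (hT _) _; rewrite ler_pM2l // nm_snd.
by apply: lerD; apply: le_trans (nmD _ _) _; rewrite mulrDl lerD // ?hu1 ?hu2.
Qed.

Lemma blk_adj A A' B B' C C' D D' :
  (forall x y, ip (A x) y = ip x (A' y)) -> (forall x y, ip (B x) y = ip x (B' y)) ->
  (forall x y, ip (C x) y = ip x (C' y)) -> (forall x y, ip (D x) y = ip x (D' y)) ->
  forall u v, ip (blk A B C D u) v = ip u (blk A' C' B' D' v).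
Proof.
move=> hA hB hC hD u v; rewrite !hsum_ipE /= !ipDl !ipDr hA hB hC hD; lra.
Qed.

Lemma bd_diag m M A B : bd m M A -> bd m M B -> bd m M (diag A B).
Proof.
move=> [bA sA hA] [bB sB hB]; split.
- have -> : diag A B = blk A (fun=> 0) (fun=> 0) B.
    by apply/funext => u; rewrite /blk addr0 add0r.
  have b0 : bounded_op (fun _ : H => 0 : H).
    by apply/bounded_opP; split; [move=> k u v; rewrite scaler0 addr0|exists 0 => x; rewrite nm0 mul0r].
  exact: bop_blk.
- by move=> u v; rewrite !hsum_ipE /= sA sB.
- move=> u; rewrite hsum_ipE hsum_nm2E /= !mulrDr.
  have /andP[h1 h2] := hA u.1; have /andP[h3 h4] := hB u.2.
  by rewrite !lerD.
Qed.

(** Each coordinate embedding intertwines a diagonal entry with [diag A B]; linearity adds the two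
    columns. *)
Lemma fcalc_diag f m M A B u : pcont f -> 0 < m -> m <= M -> bd m M A -> bd m M B ->
  fcalc f (diag A B) u = (fcalc f A u.1, fcalc f B u.2).
Proof.
move=> cf m0 mM bA bB; have bD := bd_diag bA bB.
have [lA lB] : linear A /\ linear B by case: bA => -[? _] _ _; case: bB => -[? _] _ _.
have lD : linear (fcalc f (diag A B)) by exact: bounded_op_lin (fcalc_bop cf m0 mM bD).
have h1 x : ((fcalc f A x, 0) : hsum H) = fcalc f (diag A B) (x, 0).
  apply: (@FC_intertwine _ _ _ (fun x : H => (x, 0) : hsum H) m M f A (diag A B)) => //.
  - by move=> k y z; apply: (f_equal2 pair) => //=; rewrite scaler0 addr0.
  - by exists 1 => y; apply: le_trans (nm_pair _ _) _; rewrite nm0 addr0 mul1r.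
  - by move=> y; rewrite /diag /= (lin0 lB).
  - exact: fFC.
  - exact: fFC.
have h2 x : ((0, fcalc f B x) : hsum H) = fcalc f (diag A B) (0, x).
  apply: (@FC_intertwine _ _ _ (fun x : H => (0, x) : hsum H) m M f B (diag A B)) => //.
  - by move=> k y z; apply: (f_equal2 pair) => //=; rewrite scaler0 addr0.
  - by exists 1 => y; apply: le_trans (nm_pair _ _) _; rewrite nm0 add0r mul1r.
  - by move=> y; rewrite /diag /= (lin0 lA).
  - exact: fFC.
  - exact: fFC.
have -> : u = ((u.1, 0) : hsum H) + ((0, u.2) : hsum H).
  by case: u => x y; apply: (f_equal2 pair); rewrite /= ?addr0 ?add0r.
rewrite (linD _ _ lD) -h1 -h2.
by apply: (f_equal2 pair); rewrite /= ?addr0 ?add0r.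
Qed.

End block_operators.

(** * Hansen's inequality *)

Section hansen.
Context {R : realType} {H : hilbertType R}.
Implicit Types (x y : H) (u v : hsum H) (a b c d e t m M : R) (A C E T : H -> H).

Lemma defect_bd C C' : bounded_op C -> bounded_op C' ->
  (forall x y, ip (C x) y = ip x (C' y)) -> nb 1 C -> bd 0 1 (fun x => x - C' (C x)).
Proof.
move=> bC bC' ad nC; have ad' y z : ip (C' y) z = ip y (C z) by rewrite ipC -ad ipC.
split.
- by apply: bop_sub; [exact: bop_id|exact: bop_comp].
- by move=> x y; rewrite ipDl ipDr ipNl ipNr -ad ad'.
- move=> x; rewrite mul0r mul1r ipDl ipNl ipxx ad' ipxx.
  have h := nC x; rewrite mul1r in h.
  have : nm (C x) ^+ 2 <= nm x ^+ 2 by rewrite ler_pXn2r // nnegrE nm_ge0.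
  by have := sqr_ge0 (nm (C x)) => h1 h2; apply/andP; split; lra.
Qed.

Lemma cont_on_sqrt a b : cont_on a b (@Num.sqrt R).
Proof. by move=> x _; exact: sqrt_continuous. Qed.

(** The defect of a contraction may be singular, so its root comes from [FC] on [[0, 1]] and not
    from [op_pow], whose bounds ask for [0 < m]. *)
Lemma defect_sqrt T : bd 0 1 T -> exists E,
  [/\ FC 0 1 (@Num.sqrt R) T E, bounded_op E, sa E, nb 1 E & forall x, E (E x) = T x].
Proof.
move=> bT; have [b1 _ _] := bT.
have [E fE] := FC_exists ler01 bT (@cont_on_sqrt 0 1); exists E; split=> //.
- by case: fE.
- exact: FC_sa bT fE.
- apply: (FC_norm bT fE) => // t /andP[t0 t1]; rewrite ger0_norm ?sqrtr_ge0 //.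
  by rewrite -sqrtr1 ler_wsqrtr.
- move=> x; suff -> : T = (fun x => E (E x)) by [].
  apply: (FC_unique bT (FC_id 0 1 b1)); apply: FC_ext (FC_mul bT fE fE) => t /andP[t0 _].
  by rewrite -expr2 sqr_sqrtr.
Qed.

(** Weighted arithmetic-geometric inequality: an off-diagonal block is absorbed into the diagonal,
    with a weight [d] as small as desired in one corner. *)
Lemma ip_cross_le T c d x y : sa T -> nb c T -> 0 <= c -> 0 < d ->
  2 * ip (T x) y <= d * nm x ^+ 2 + c ^+ 2 / d * nm y ^+ 2.
Proof.
move=> sT nT c0 d0; have h : ip (T x) y <= c * nm x * nm y.
  by apply: le_trans (ipCS _ _) _; rewrite ler_wpM2r ?nm_ge0.
have := sqr_ge0 (d * nm x - c * nm y) => h2.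
rewrite -(ler_pM2l d0).
have -> : d * (d * nm x ^+ 2 + c ^+ 2 / d * nm y ^+ 2) = (d * nm x) ^+ 2 + (c * nm y) ^+ 2.
  by field; lra.
have : d * (2 * ip (T x) y) <= d * (2 * (c * nm x * nm y)) by rewrite ler_pM2l //; lra.
move: h2; set p := nm x; set q := nm y; set w := ip _ _; lra.
Qed.

(* The unitary dilation [U = [[C, E'], [E, - C']]] of the contraction [C]
   compresses [diag A e] to [C A C' + e (1 - C C')] in the first corner. *)
Lemma hansen_eps f m M (A C C' : H -> H) m' M' e : operator_monotone f ->
  (forall t, 0 < t -> 0 <= f t) -> 0 < m -> m <= M -> bd m M A ->
  bounded_op C -> bounded_op C' -> (forall x y, ip (C x) y = ip x (C' y)) ->
  nb 1 C -> 0 < m' -> m' <= M' -> bd m' M' (fun x => C (A (C' x))) -> 0 < e ->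
  forall x, ip (fcalc f A (C' x)) (C' x) <=
    ip (fcalc f (fun x => C (A (C' x)) + (3 * e)%:C *: x) x) x.
Proof.
move=> opf f0 m0 mM bA bC bC' ad nC m0' mM' bZ e0 x; have [cf _] := opf.
have ad' y z : ip (C' y) z = ip y (C z) by rewrite ipC -ad ipC.
have nC' : nb 1 C' by exact: nb_adj ad nC.
have lC := bounded_op_lin bC; have lC' := bounded_op_lin bC'.
have bP := defect_bd bC bC' ad nC; have bQ := defect_bd bC' bC ad' nC'.
have [E [fE bE sE nE EE]] := defect_sqrt bP; have [E' [fE' bE' sE' nE' EE']] := defect_sqrt bQ.
have [c [c0 hc]] := bounded_op_nb bC; have [c' [c0' hc']] := bounded_op_nb bC'.
(* [C (1 - C' C) = (1 - C C') C] passes to the square roots; this commutation makes [U] unitary. *)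
have CE y : C (E y) = E' (C y).
  apply: (FC_intertwine lC (ex_intro _ c hc) _ bP bQ fE fE') => z.
  by rewrite (linB _ _ lC).
have C'E y : C' (E' y) = E (C' y).
  apply: (FC_intertwine lC' (ex_intro _ c' hc') _ bQ bP fE' fE) => z.
  by rewrite (linB _ _ lC').
pose U := blk C E' E (fun y => - C' y); pose U' := blk C' E E' (fun y => - C y).
have bU : bounded_op U by apply: bop_blk => //; exact: bop_opp.
have bU' : bounded_op U' by apply: bop_blk => //; exact: bop_opp.
have adU u v : ip (U u) v = ip u (U' v).
  by apply: blk_adj => // y z; rewrite ipNl ipNr ad'.
have lE := bounded_op_lin bE; have lE' := bounded_op_lin bE'.
have UK : cancel U U'.
  move=> [u1 u2]; apply: (f_equal2 pair) => /=.
    rewrite (linD _ _ lC') (linD _ _ lE) (linN _ lE) EE C'E.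
    by rewrite addrACA subrr addr0 addrC subrK.
  rewrite (linD _ _ lC) (linD _ _ lE') (linN _ lC) EE' CE opprD opprK.
  by rewrite addrACA subrr add0r subrK.
have U'K : cancel U' U.
  move=> [u1 u2]; apply: (f_equal2 pair) => /=.
    rewrite (linD _ _ lC) (linD _ _ lE') (linN _ lE') EE' CE.
    by rewrite addrACA subrr addr0 addrC subrK.
  rewrite (linD _ _ lC') (linD _ _ lE) (linN _ lC') EE C'E opprD opprK.
  by rewrite addrACA subrr add0r subrK.
(* The second diagonal entry is [e] and not [0], because monotonicity is available for invertible
   operators. *)
pose lo := Num.min m e; pose hi := Num.max M e.
have lo0 : 0 < lo by rewrite lt_min m0.
have lohi : lo <= hi by rewrite ge_min; apply/orP; left; rewrite le_max mM.
have bA' : bd lo hi A by apply: bdW bA; rewrite ?ge_min ?le_max lexx.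
have be : bd lo hi (fun y : H => e%:C *: y).
  by apply: bdW (bd_scale H e); rewrite ?ge_min ?le_max lexx orbT.
have bD := bd_diag bA' be.
have [bB fB] := fcalc_unitary cf lo0 lohi bD bU bU' adU UK U'K.
(* Second corner of the upper bound: [M] for the compressed [A], the cross term at weight [e], and
   [2 e] from the entry [e]; adding [m'] secures [m' <= L]. The first corner collects [e + 2 e],
   hence the [3 * e] of the statement. *)
pose L := M + (`|m| + `|M|) ^+ 2 / e + 2 * e + m'.
have k0 : 0 <= `|m| + `|M| by rewrite addr_ge0.
have L0 : 0 <= (`|m| + `|M|) ^+ 2 / e by rewrite divr_ge0 ?sqr_ge0 ?(ltW e0).
have M0 : 0 < M by exact: lt_le_trans mM.
have Lm : m' <= L by rewrite /L; lra.
pose Z' y := C (A (C' y)) + (3 * e)%:C *: y.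
have bZ' : bd m' (M' + 3 * e) Z'.
  have [b1 s1 h1] := bZ; split; first by apply: bop_add => //; exact: bop_scale.
    by move=> y z; rewrite ipDl ipDr s1 ipZl ipZr.
  move=> y; rewrite ipDl ipZl ipxx; have /andP[h2 h3] := h1 y.
  have h4 : 0 <= e * nm y ^+ 2 by rewrite mulr_ge0 ?sqr_ge0 // ltW.
  by apply/andP; split; lra.
pose hi' := Num.max (M' + 3 * e) L.
have mhi : m' <= hi' by rewrite le_max Lm orbT.
have bZ2 : bd m' hi' Z' by apply: bdW bZ' => //; rewrite le_max lexx.
have bL : bd m' hi' (fun y : H => L%:C *: y).
  by apply: bdW (bd_scale H L) => //; rewrite le_max lexx orbT.
have bG := bd_diag bZ2 bL.
have BG u : ip (U (diag A (fun y : H => e%:C *: y) (U' u))) u <=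
            ip (diag Z' (fun y : H => L%:C *: y) u) u.
  rewrite adU !hsum_ipE /= /Z' !ipZl !ipDl !ipZl !ipxx.
  have [bA1 sA hA] := bA; have lA := bounded_op_lin bA1.
  rewrite (linD _ _ lA) !ipDl !ipDr ad.
  have h1 := @ip_cross_le A _ _ (C' u.1) (E u.2) sA (bd_nb bA) k0 e0.
  have h1' : ip (A (E u.2)) (C' u.1) = ip (A (C' u.1)) (E u.2) by rewrite sA ipC.
  have sqle (T : H -> H) y : nb 1 T -> nm (T y) ^+ 2 <= nm y ^+ 2.
    by move=> nT; have := nT y; rewrite mul1r => ?; rewrite ler_pXn2r // nnegrE nm_ge0.
  have /andP[_ h2] := hA (E u.2).
  have h3 := sqle _ u.1 nC'; have h4 := sqle _ u.2 nE; have h5 := sqle _ u.1 nE'.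
  have h6 := sqle _ u.2 nC.
  have h7 : nm (E' u.1 - C u.2) ^+ 2 <= 2 * nm u.1 ^+ 2 + 2 * nm u.2 ^+ 2.
    have := sqr_ge0 (nm (E' u.1 + C u.2)); rewrite nm2B nm2D; lra.
  rewrite -ipxx ipDl !ipDr in h7.
  have h8 := ler_wpM2l (ltW e0) h3; have h9 := ler_wpM2l (ltW e0) h7.
  have h10 := ler_wpM2l (ltW M0) h4.
  have h11 : (`|m| + `|M|) ^+ 2 / e * nm (E u.2) ^+ 2 <= (`|m| + `|M|) ^+ 2 / e * nm u.2 ^+ 2.
    by rewrite ler_wpM2l // divr_ge0 ?sqr_ge0 ?(ltW e0).
  have h12 : 0 <= m' * nm u.2 ^+ 2 by rewrite mulr_ge0 ?sqr_ge0 // ltW.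
  rewrite h1' /L; move: h1 h2 h8 h9 h10 h11 h12.
  set a1 := ip (A (C' u.1)) (C' u.1); set a2 := ip (A (C' u.1)) (E u.2).
  set a3 := ip (A (E u.2)) (E u.2); set a4 := nm u.1 ^+ 2; set a5 := nm u.2 ^+ 2.
  set a6 := nm (E u.2) ^+ 2; set a7 := nm (C' u.1) ^+ 2.
  set a9 := (_ ^+ 2) / e; lra.
(* Testing at [(x, 0)] removes the corner [L], however large, and leaves an extra
   [f e * nm (E' x)^2 >= 0] on the left. *)
have h := opmon_fcalc opf lo0 lohi bB m0' mhi bG BG (x, 0).
have U'x : U' (x, 0) = (C' x, E' x) :> hsum H.
  by rewrite /U' /blk /= (lin0 lE) (lin0 lC) oppr0 !addr0.
have h1 := fcalc_diag (U' (x, 0)) cf lo0 lohi bA' be.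
have h2 := fcalc_diag (x, 0) cf m0' mhi bZ2 bL.
have h3 : ip (fcalc f A (C' x)) (C' x) <=
    ip (fcalc f (diag A (fun y : H => e%:C *: y)) (U' (x, 0))) (U' (x, 0)).
  rewrite h1 U'x hsum_ipE /= (fcalc_scalar H cf e0) ipZl ipxx lerDl.
  by rewrite mulr_ge0 ?sqr_ge0 // f0.
apply: le_trans h3 _; apply: le_trans (le_of_eq (esym (fB (x, 0)))) _.
apply: le_trans h _; apply: le_of_eq.
by rewrite h2 hsum_ipE /= ip0r addr0.
Qed.

Lemma hansen f m M (A C C' : H -> H) m' M' : operator_monotone f ->
  (forall t, 0 < t -> 0 <= f t) -> 0 < m -> m <= M -> bd m M A ->
  bounded_op C -> bounded_op C' -> (forall x y, ip (C x) y = ip x (C' y)) ->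
  nb 1 C -> 0 < m' -> m' <= M' -> bd m' M' (fun x => C (A (C' x))) ->
  forall x, ip (fcalc f A (C' x)) (C' x) <= ip (fcalc f (fun x => C (A (C' x))) x) x.
Proof.
move=> opf f0 m0 mM bA bC bC' ad nC m0' mM' bZ x; have [cf _] := opf.
apply/ler_addgt0Pr => e e0; have n0 := sqr_ge0 (nm x).
have M1 : m' <= M' + 3 by lra.
have h0 : 0 < e / (nm x ^+ 2 + 1) by rewrite divr_gt0 //; lra.
have [d [d0 hd]] := @FC_continuous R H m' (M' + 3) f M1 (@pcont_on _ f m' (M' + 3) cf m0') _ h0.
(* [k <= 1] keeps the perturbed operator between [m'] and [M' + 3], where [d] was found;
   [3 * k <= d] makes the perturbation admissible. *)
pose k := Num.min 1 (d / 3).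
have k0 : 0 < k by rewrite lt_min ltr01 divr_gt0.
have k1 : k <= 1 by rewrite ge_min lexx.
have kd : 3 * k <= d.
  have : k <= d / 3 by rewrite ge_min lexx orbT.
  lra.
have bZ1 : bd m' (M' + 3) (fun x => C (A (C' x))) by apply: bdW bZ => //; lra.
pose Z' y := C (A (C' y)) + (3 * k)%:C *: y.
have bZ' : bd m' (M' + 3) Z'.
  have [b1 s1 h1] := bZ; split; first by apply: bop_add => //; exact: bop_scale.
    by move=> y z; rewrite ipDl ipDr s1 ipZl ipZr.
  move=> y; rewrite ipDl ipZl ipxx; have /andP[h2 h3] := h1 y.
  have h4 : 0 <= k * nm y ^+ 2 by rewrite mulr_ge0 ?sqr_ge0 // ltW.
  have h5 : k * nm y ^+ 2 <= nm y ^+ 2 by rewrite ler_piMl ?sqr_ge0.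
  by apply/andP; split; lra.
have := hansen_eps opf f0 m0 mM bA bC bC' ad nC m0' mM' bZ k0 x.
rewrite -/Z' => h1; apply: le_trans h1 _; rewrite -lerBlDl -ipNl -ipDl.
apply: le_trans (ler_norm _) _.
have : nb d (fun y => Z' y - C (A (C' y))).
  move=> y; rewrite /Z' addrAC subrr add0r nmZ ger0_norm; last by lra.
  by rewrite ler_wpM2r ?nm_ge0.
move=> /(hd _ _ _ _ bZ' bZ1 (fFC cf m0' M1 bZ') (fFC cf m0' M1 bZ1))/(nb_ip x) h.
apply: le_trans h _; rewrite mulrAC ler_pdivrMr; last by lra.
by rewrite ler_wpM2l ?(ltW e0) //; lra.
Qed.

End hansen.

(** * Strict monotonicity *)

Section strict_monotonicity.
Context {R : realType} {H : hilbertType R}.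
Implicit Types (x y : H) (u v : hsum H) (a b c d e s t p : R).
Context (f : R -> R) (x0 : H) (opf : operator_monotone f) (x0_neq0 : nm x0 != 0).

Let cf : pcont f := opf.1.

Let n0 : 0 < nm x0 ^+ 2.
Proof. by rewrite exprn_gt0 // lt_def x0_neq0 nm_ge0. Qed.

(** Evaluation at the nonzero vector [x0] turns an inequality between scalar operators into one
    between scalars. *)
Lemma opmon_scalar s t : 0 < s -> s <= t -> f s <= f t.
Proof.
move=> s0 st; have t0 : 0 < t by exact: lt_le_trans st.
have := opmon_fcalc opf s0 (lexx s) (bd_scale H s) t0 (lexx t) (bd_scale H t) _ x0.
rewrite !fcalc_scalar // !ipZl !ipxx ler_pM2r //; apply=> x.
by rewrite !ipZl ipxx ler_wpM2r ?sqr_ge0.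
Qed.

Lemma quadform_ge0 a b c x y : 0 < a -> b ^+ 2 <= a * c ->
  0 <= a * nm x ^+ 2 + 2 * b * ip x y + c * nm y ^+ 2.
Proof.
move=> a0 bac; rewrite -(pmulr_rge0 _ a0).
have -> : a * (a * nm x ^+ 2 + 2 * b * ip x y + c * nm y ^+ 2) =
  nm (a%:C *: x + b%:C *: y) ^+ 2 + (a * c - b ^+ 2) * nm y ^+ 2.
  rewrite nm2D ipZl ipZr !nmZ !exprMn !real_normK ?num_real //; ring.
apply: addr_ge0; first exact: sqr_ge0.
by rewrite mulr_ge0 ?sqr_ge0 // subr_ge0.
Qed.

(** [B = W (diag a b) W] for the reflection [W] with rows [(c, s)] and [(s, -c)], its own adjoint
    and inverse. The first corner of [f(B)] is the mean of [f a] and [f b] with weights [c^2] and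
    [s^2]. *)
Lemma rotated_diag c s a b : c ^+ 2 + s ^+ 2 = 1 -> 0 < a -> 0 < b ->
  exists (B : hsum H -> hsum H) lo hi, [/\ 0 < lo, lo <= hi, bd lo hi B,
    forall u, ip (B u) u = (c ^+ 2 * a + s ^+ 2 * b) * nm u.1 ^+ 2
       + 2 * (c * s * (a - b)) * ip u.1 u.2 + (s ^+ 2 * a + c ^+ 2 * b) * nm u.2 ^+ 2 &
    ip (fcalc f B (x0, 0)) (x0, 0) = (c ^+ 2 * f a + s ^+ 2 * f b) * nm x0 ^+ 2].
Proof.
move=> cs a0 b0.
pose sc (k : R) := fun y : H => k%:C *: y.
pose W := blk (sc c) (sc s) (sc s) (sc (- c)).
have bW : bounded_op W by apply: bop_blk; exact: bop_scale.
have sW u v : ip (W u) v = ip u (W v) by apply: blk_adj => x y; rewrite ipZl ipZr.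
have W1 u : (W u).1 = c%:C *: u.1 + s%:C *: u.2 by [].
have W2 u : (W u).2 = s%:C *: u.1 + (- c)%:C *: u.2 by [].
have WK : cancel W W.
  move=> [x y]; apply: (f_equal2 pair); rewrite /= /sc !scalerDr !scalerA -!rmorphM addrACA -!scalerDl -!rmorphD /=.
    rewrite (_ : c * c + s * s = 1); last by rewrite -!expr2.
    by rewrite (_ : c * s + s * - c = 0) ?scale1r ?scale0r ?addr0 //; ring.
  rewrite (_ : s * s + - c * - c = 1); last by rewrite mulrNN addrC -!expr2.
  by rewrite (_ : s * c + - c * s = 0) ?scale1r ?scale0r ?add0r //; ring.
pose lo := Num.min a b; pose hi := Num.max a b.
have lo0 : 0 < lo by rewrite lt_min a0.
have lohi : lo <= hi by rewrite ge_min; apply/orP; left; rewrite le_max lexx.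
have ba : bd lo hi (sc a) by apply: bdW (bd_scale H a); rewrite ?ge_min ?le_max lexx.
have bb : bd lo hi (sc b) by apply: bdW (bd_scale H b); rewrite ?ge_min ?le_max lexx orbT.
have bD := bd_diag ba bb.
have [bB fB] := fcalc_unitary cf lo0 lohi bD bW bW sW WK WK.
have dE u v : ip (diag (sc a) (sc b) u) v = a * ip u.1 v.1 + b * ip u.2 v.2.
  by rewrite hsum_ipE /= !ipZl.
have fE u : ip (fcalc f (diag (sc a) (sc b)) u) u = f a * nm u.1 ^+ 2 + f b * nm u.2 ^+ 2.
  by rewrite (fcalc_diag u cf lo0 lohi ba bb) hsum_ipE /= !fcalc_scalar // !ipZl !ipxx.
exists (fun u => W (diag (sc a) (sc b) (W u))), lo, hi; split=> //.
  move=> u; rewrite sW dE W1 W2 !ipxx !nm2D.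
  by rewrite !ipZl !ipZr !nmZ !exprMn !real_normK ?num_real //; ring.
rewrite fB fE W1 W2 /= !scaler0 !addr0.
by rewrite !nmZ !exprMn !real_normK ?num_real //; ring.
Qed.

Lemma fcalc_scalar_diag a b : 0 < a -> 0 < b ->
  ip (fcalc f (diag (fun y : H => a%:C *: y) (fun y : H => b%:C *: y)) (x0, 0)) (x0, 0) =
  f a * nm x0 ^+ 2.
Proof.
move=> a0 b0; pose lo := Num.min a b; pose hi := Num.max a b.
have lo0 : 0 < lo by rewrite lt_min a0.
have lohi : lo <= hi by rewrite ge_min; apply/orP; left; rewrite le_max lexx.
have ba : bd lo hi (fun y : H => a%:C *: y).
  by apply: bdW (bd_scale H a); rewrite ?ge_min ?le_max lexx.
have bb : bd lo hi (fun y : H => b%:C *: y).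
  by apply: bdW (bd_scale H b); rewrite ?ge_min ?le_max lexx orbT.
rewrite (fcalc_diag (x0, 0) cf lo0 lohi ba bb) hsum_ipE /= !fcalc_scalar //.
by rewrite ip0r addr0 ipZl ipxx.
Qed.

(** [d] is the squared sine of the rotation. The last two hypotheses say that [B - diag p t] has a
    positive first entry and a nonnegative determinant, hence [diag p t <= B]; the first corners are
    then compared. *)
Lemma opmon_below d a b p t : 0 <= d <= 1 -> 0 < a -> 0 < b -> 0 < p -> 0 < t ->
  0 < (1 - d) * a + d * b - p ->
  d * (1 - d) * (a - b) ^+ 2 <= ((1 - d) * a + d * b - p) * (d * a + (1 - d) * b - t) ->
  f p <= (1 - d) * f a + d * f b.
Proof.
move=> /andP[d0 d1] a0 b0 p0 t0 h1 h2.
pose c := Num.sqrt (1 - d); pose s := Num.sqrt d.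
have c2 : c ^+ 2 = 1 - d by rewrite sqr_sqrtr // subr_ge0.
have s2 : s ^+ 2 = d by rewrite sqr_sqrtr.
have cs : c ^+ 2 + s ^+ 2 = 1 by rewrite c2 s2 subrK.
have [B [lo [hi [lo0 lohi bB qB fB]]]] := rotated_diag cs a0 b0.
pose lo' := Num.min p t; pose hi' := Num.max p t.
have lo0' : 0 < lo' by rewrite lt_min p0.
have lohi' : lo' <= hi' by rewrite ge_min; apply/orP; left; rewrite le_max lexx.
have bp : bd lo' hi' (fun y : H => p%:C *: y).
  by apply: bdW (bd_scale H p); rewrite ?ge_min ?le_max lexx.
have bt : bd lo' hi' (fun y : H => t%:C *: y).
  by apply: bdW (bd_scale H t); rewrite ?ge_min ?le_max lexx orbT.
have ord u : ip (diag (fun y : H => p%:C *: y) (fun y : H => t%:C *: y) u) u <= ip (B u) u.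
  rewrite qB hsum_ipE /= !ipZl !ipxx c2 s2.
  have := @quadform_ge0 ((1 - d) * a + d * b - p) (c * s * (a - b)) (d * a + (1 - d) * b - t) u.1 u.2 h1.
  rewrite !exprMn c2 s2 [(1 - d) * d]mulrC => /(_ h2).
  set X := nm u.1 ^+ 2; set Y := nm u.2 ^+ 2; set I := ip _ _; lra.
have h := opmon_fcalc opf lo0' lohi' (bd_diag bp bt) lo0 lohi bB ord (x0, 0).
have := le_trans (le_of_eq (esym (fcalc_scalar_diag p0 t0))) (le_trans h (le_of_eq fB)).
by rewrite ler_pM2r // c2 s2.
Qed.

(** Concavity of [f], up to a strict gap at [p]: in [B <= diag p L] the second entry is free, and
    [L] is taken large enough for the determinant. *)
Lemma opmon_above d a b p : 0 <= d <= 1 -> 0 < a -> 0 < b -> 0 < p ->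
  0 < p - ((1 - d) * a + d * b) -> (1 - d) * f a + d * f b <= f p.
Proof.
move=> /andP[d0 d1] a0 b0 p0 h1.
pose c := Num.sqrt (1 - d); pose s := Num.sqrt d.
have c2 : c ^+ 2 = 1 - d by rewrite sqr_sqrtr // subr_ge0.
have s2 : s ^+ 2 = d by rewrite sqr_sqrtr.
have cs : c ^+ 2 + s ^+ 2 = 1 by rewrite c2 s2 subrK.
have [B [lo [hi [lo0 lohi bB qB fB]]]] := rotated_diag cs a0 b0.
pose k := d * a + (1 - d) * b.
pose L := k + (1 - d) * d * (a - b) ^+ 2 / (p - ((1 - d) * a + d * b)) + 1.
have k0 : 0 <= k by rewrite addr_ge0 // mulr_ge0 ?(ltW a0) ?(ltW b0) // subr_ge0.
have L1 : 0 <= (1 - d) * d * (a - b) ^+ 2 / (p - ((1 - d) * a + d * b)).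
  by rewrite divr_ge0 ?(ltW h1) // mulr_ge0 ?sqr_ge0 // mulr_ge0 // subr_ge0.
have t0 : 0 < L by rewrite /L; lra.
pose lo' := Num.min p L; pose hi' := Num.max p L.
have lo0' : 0 < lo' by rewrite lt_min p0.
have lohi' : lo' <= hi' by rewrite ge_min; apply/orP; left; rewrite le_max lexx.
have bp : bd lo' hi' (fun y : H => p%:C *: y).
  by apply: bdW (bd_scale H p); rewrite ?ge_min ?le_max lexx.
have bt : bd lo' hi' (fun y : H => L%:C *: y).
  by apply: bdW (bd_scale H L); rewrite ?ge_min ?le_max lexx orbT.
have ord u : ip (B u) u <= ip (diag (fun y : H => p%:C *: y) (fun y : H => L%:C *: y) u) u.
  rewrite qB hsum_ipE /= !ipZl !ipxx c2 s2.
  have := @quadform_ge0 (p - ((1 - d) * a + d * b)) (- (c * s * (a - b))) (L - k) u.1 u.2 h1.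
  rewrite sqrrN !exprMn c2 s2.
  have hw : (1 - d) * d * (a - b) ^+ 2 <= (p - ((1 - d) * a + d * b)) * (L - k).
    rewrite /L; set w := (1 - d) * d * _.
    rewrite [leRHS](_ : _ = w + (p - ((1 - d) * a + d * b))); first by rewrite lerDl ltW.
    by field; lra.
  move=> /(_ hw); rewrite /k.
  set X := nm u.1 ^+ 2; set Y := nm u.2 ^+ 2; set I := ip _ _; lra.
have h := opmon_fcalc opf lo0 lohi bB lo0' lohi' (bd_diag bp bt) ord (x0, 0).
have := le_trans (le_of_eq (esym fB)) (le_trans h (le_of_eq (fcalc_scalar_diag p0 t0))).
by rewrite ler_pM2r // c2 s2.
Qed.

(* A matrix [diag p t] below a slightly rotated [diag a b]: flatness between [p]
   and [a] propagates to [b]. *)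
Lemma opmon_flat_below a b p : 0 < b -> b < p -> p < a -> f p = f a -> f p <= f b.
Proof.
move=> b0 bp pa fpa.
have ab : 0 < a - b by lra.
(* The first quotient keeps the corner gap at least [(a - p) / 2]; the second settles the
   determinant for the second entry [t = b / 2]. *)
pose d := Num.min 1 (Num.min ((a - p) / 2 / (a - b)) ((a - p) / 2 * (b / 2) / (a - b) ^+ 2)).
have d0 : 0 < d.
  by rewrite !lt_min ltr01 /=; apply/andP; split; rewrite divr_gt0 ?exprn_gt0 ?mulr_gt0 //; lra.
have d1 : d <= 1 by rewrite ge_min lexx.
have h1 : d * (a - b) <= (a - p) / 2.
  by rewrite -ler_pdivlMr // /d !ge_min lexx orbT.
have h2 : d * (a - b) ^+ 2 <= (a - p) / 2 * (b / 2).
  by rewrite -ler_pdivlMr ?exprn_gt0 // /d !ge_min lexx !orbT.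
have := @opmon_below d a b p (b / 2); rewrite (ltW d0) d1 => /(_ isT).
have h3 : 0 < (1 - d) * a + d * b - p by lra.
have h4 : d * (1 - d) * (a - b) ^+ 2 <= ((1 - d) * a + d * b - p) * (d * a + (1 - d) * b - b / 2).
  apply: (@le_trans _ _ (d * (a - b) ^+ 2)).
    by rewrite ler_wpM2r ?sqr_ge0 // ger_pMr //; lra.
  apply: le_trans h2 _; apply: ler_pM; [lra|lra|lra|].
  have : 0 <= d * (a - b) by rewrite mulr_ge0 // ltW.
  lra.
move=> /(_ ltac:(lra) ltac:(lra) ltac:(lra) ltac:(lra) h3 h4).
rewrite -fpa => h; have : d * f p <= d * f b by lra.
by rewrite ler_pM2l.
Qed.

(** The weight [d] puts the mean of [a] and [b] at the midpoint of [a] and [p], strictly below [p];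
    with [f a = f p] the concavity bound reduces to [d * f b <= d * f p]. *)
Lemma opmon_flat_above a b p : 0 < a -> a < p -> p < b -> f a = f p -> f b <= f p.
Proof.
move=> a0 ap pb fap.
have ab : 0 < b - a by lra.
pose d := (p - a) / 2 / (b - a).
have d0 : 0 < d by rewrite !divr_gt0 //; lra.
have h1 : d * (b - a) = (p - a) / 2 by rewrite divfK // gt_eqF.
have d1 : d <= 1 by rewrite /d ler_pdivrMr //; lra.
have := @opmon_above d a b p; rewrite (ltW d0) d1 => /(_ isT).
move=> /(_ ltac:(lra) ltac:(lra) ltac:(lra) ltac:(lra)).
rewrite fap => h; have : d * f b <= d * f p by lra.
by rewrite ler_pM2l.
Qed.

(** An equality [f s = f t] would spread below [s] and above [t] by the two flatness lemmas and make
    [f] constant on the half-line. *)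
Lemma opmon_strict : (exists2 a, 0 < a & f a != f 1) ->
  forall s t, 0 < s -> s < t -> f s < f t.
Proof.
move=> [a a0 fa1] s t s0 st; rewrite lt_neqAle opmon_scalar ?(ltW st) // andbT.
apply/eqP => fst.
have hconst b : 0 < b -> f b = f s.
  move=> b0; have [bs|sb] := ltP b s.
    apply/eqP; rewrite eq_le (opmon_scalar b0 (ltW bs)).
    exact: opmon_flat_below b0 bs st fst.
  have [bt|tb] := leP b t.
    apply/eqP; rewrite eq_le (opmon_scalar s0 sb) andbT fst.
    exact: opmon_scalar b0 bt.
  apply/eqP; rewrite eq_le (opmon_scalar s0 sb) andbT fst.
  exact: opmon_flat_above s0 st tb fst.
by move: fa1; rewrite (hconst a) // (hconst 1) // eqxx.
Qed.

End strict_monotonicity.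

(** * Kubo-Ando means *)

Section kubo_ando.
Context {R : realType} {H : hilbertType R}.
Implicit Types (x y : H) (a b c d e s t m M r : R) (f g : R -> R) (S T : H -> H).
Implicit Types A B X Y : posop H.

Lemma pos_bounds f m M : pcont f -> (forall t, 0 < t -> 0 < f t) -> 0 < m -> m <= M ->
  exists k K, [/\ 0 < k, k <= K & forall t, m <= t <= M -> k <= f t <= K].
Proof.
move=> cf pf m0 mM.
have cw : {within `[m, M], continuous f}.
  apply: continuous_in_subspaceT => x; rewrite inE /= in_itv /= => h.
  exact: pcont_on cf m0 _ h.
have [c] := EVT_max mM cw; have [c'] := EVT_min mM cw.
rewrite !in_itv /= => hc' h1 hc h2; exists (f c'), (f c); split.
- by apply: pf; case/andP: hc' => h _; exact: lt_le_trans h.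
- by apply: h1; rewrite in_itv.
- by move=> t ht; rewrite h1 ?h2 ?in_itv.
Qed.

Definition sqrtop X := op_pow X 2^-1.
Definition isqrtop X := op_pow X (- 2^-1).
Definition KA_arg X S : H -> H := fun x => isqrtop X (S (isqrtop X x)).

Lemma sqrtop_nm2 X x : nm (sqrtop X x) ^+ 2 = ip (X x) x.
Proof. by rewrite -ipxx op_pow_sa posop_sqr_half ipC. Qed.

Lemma isqrtop_nm2 X x : nm (isqrtop X x) ^+ 2 = ip (op_pow X (-1) x) x.
Proof. by rewrite -op_pow_nm2 mulN1r. Qed.

Lemma sqrtopK X x : isqrtop X (sqrtop X x) = x. Proof. exact: op_powNK. Qed.
Lemma isqrtopK X x : sqrtop X (isqrtop X x) = x. Proof. exact: op_powK. Qed.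

Lemma sqrtop_bop X : bounded_op (sqrtop X). Proof. exact: op_pow_bop. Qed.
Lemma isqrtop_bop X : bounded_op (isqrtop X). Proof. exact: op_pow_bop. Qed.
Lemma sqrtop_sa X : sa (sqrtop X). Proof. exact: op_pow_sa. Qed.
Lemma isqrtop_sa X : sa (isqrtop X). Proof. exact: op_pow_sa. Qed.

Lemma isqrtop_bd a b X : 0 < a -> a <= b -> bd a b X ->
  forall x, b^-1 * nm x ^+ 2 <= nm (isqrtop X x) ^+ 2 <= a^-1 * nm x ^+ 2.
Proof.
move=> a0 ab bX x; rewrite isqrtop_nm2.
have h : bd b^-1 a^-1 (op_pow X (-1)).
  apply: (FC_bd bX (op_powE _ a0 ab bX)) => t /andP[ta tb].
  have t0 : 0 < t by exact: lt_le_trans ta.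
  by rewrite powR_inv1 ?(ltW t0) // !lef_pV2 ?posrE ?ta ?tb // (lt_le_trans t0).
by case: h.
Qed.

Lemma KA_arg_bd a b m M X S : 0 < a -> a <= b -> bd a b X -> 0 < m -> m <= M ->
  bd m M S -> bd (m / b) (M / a) (KA_arg X S).
Proof.
move=> a0 ab bX m0 mM bS.
apply: (@bd_congr _ _ m M S (isqrtop X) (isqrtop X)) => //; try exact: isqrtop_bop.
- exact: ltW.
- by apply: ltW; exact: lt_le_trans mM.
- exact: isqrtop_sa.
- exact: isqrtop_bd.
Qed.

Lemma KA_arg_posop X A : exists m M, [/\ 0 < m, m <= M & bd m M (KA_arg X A)].
Proof.
have [a [b [a0 ab bX]]] := posop_bd X; have [m [M [m0 mM bA]]] := posop_bd A.
exists (m / b), (M / a); split; last exact: KA_arg_bd.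
  by rewrite divr_gt0 //; exact: lt_le_trans ab.
apply: ler_pM; rewrite ?(ltW m0) ?invr_ge0 ?(le_trans (ltW a0)) //.
by rewrite lef_pV2 ?posrE // (lt_le_trans a0).
Qed.

(** The bounds [k * a] and [K * b] are uniform over all [A] between [m] and [M], so a measure on
    some [Sigma e] is pushed to another; they also show that [to_posop] does not fall back on its
    default. *)
Lemma KA_mean_bd f a b m M X : pcont f -> (forall t, 0 < t -> 0 < f t) ->
  0 < a -> a <= b -> bd a b X -> 0 < m -> m <= M ->
  exists k K, [/\ 0 < k, k <= K & forall A, bd m M A ->
    bd k K (KA_mean f X A) /\
    KA_mean f X A = (fun x => sqrtop X (fcalc f (KA_arg X A) (sqrtop X x))) :> (H -> H)].
Proof.
move=> cf pf a0 ab bX m0 mM.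
have b0 : 0 < b by exact: lt_le_trans ab.
have lo0 : 0 < m / b by rewrite divr_gt0.
have lohi : m / b <= M / a.
  apply: ler_pM; rewrite ?(ltW m0) ?invr_ge0 ?(ltW b0) //.
  by rewrite lef_pV2 ?posrE.
have [k [K [k0 kK hk]]] := pos_bounds cf pf lo0 lohi.
have K0 : 0 < K by exact: lt_le_trans kK.
exists (k * a), (K * b); split.
- by rewrite mulr_gt0.
- by apply: ler_pM => //; exact: ltW.
move=> A bA; have bZ := KA_arg_bd a0 ab bX m0 mM bA.
have bf : bd k K (fcalc f (KA_arg X A)) by exact: FC_bd bZ (fFC cf lo0 lohi bZ) hk.
have bT : bd (k * a) (K * b) (fun x => sqrtop X (fcalc f (KA_arg X A) (sqrtop X x))).
  apply: (@bd_congr _ _ k K _ (sqrtop X) (sqrtop X)) => //; try exact: sqrtop_bop.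
  - exact: ltW.
  - exact: ltW.
  - exact: sqrtop_sa.
  - by move=> x; rewrite sqrtop_nm2; case: bX.
have e : KA_mean f X A = (fun x => sqrtop X (fcalc f (KA_arg X A) (sqrtop X x))) :> (H -> H).
  have h1 : 0 < k * a by rewrite mulr_gt0.
  have h2 : k * a <= K * b by apply: ler_pM => //; exact: ltW.
  exact: to_posopE h1 h2 bT.
by rewrite e.
Qed.

Lemma KA_meanE f X A : pcont f -> (forall t, 0 < t -> 0 < f t) ->
  KA_mean f X A = (fun x => sqrtop X (fcalc f (KA_arg X A) (sqrtop X x))) :> (H -> H).
Proof.
move=> cf pf; have [a [b [a0 ab bX]]] := posop_bd X; have [m [M [m0 mM bA]]] := posop_bd A.
by have [k [K [_ _ h]]] := KA_mean_bd cf pf a0 ab bX m0 mM; have [_ ->] := h A bA.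
Qed.

Lemma KA_mean_ip f X A x : pcont f -> (forall t, 0 < t -> 0 < f t) ->
  ip (KA_mean f X A x) x = ip (fcalc f (KA_arg X A) (sqrtop X x)) (sqrtop X x).
Proof. by move=> cf pf; rewrite KA_meanE // sqrtop_sa. Qed.

Lemma KA_mean_le f X Y A a b lo hi : operator_monotone f -> (forall t, 0 < t -> 0 < f t) ->
  0 < a -> (forall x, ip (X x) x <= a * ip (Y x) x) ->
  0 < lo -> lo <= hi -> bd lo hi (KA_arg Y A) ->
  (forall t, lo <= t <= hi -> f (a^-1 * t) <= b * f t) ->
  forall x, ip (KA_mean f X A x) x <= a * b * ip (KA_mean f Y A x) x.
Proof.
move=> opf pf a0 XY lo0 lohi bV hb x; have [cf _] := opf.
have [m [M [m0 mM bZ]]] := KA_arg_posop X A.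
pose k := Num.sqrt a^-1.
have k2 : k * k = a^-1 by rewrite -expr2 sqr_sqrtr // invr_ge0 ltW.
have k0 : 0 <= k by exact: sqrtr_ge0.
(* [C = a^(-1/2) Y^(-1/2) X^(1/2)] is a contraction because [X <= a Y], and it conjugates the
   argument of [X sigma A] into [1 / a] times that of [Y sigma A]. *)
pose C y := k%:C *: isqrtop Y (sqrtop X y); pose C' y := k%:C *: sqrtop X (isqrtop Y y).
have bC : bounded_op C by apply: bop_scalel; apply: bop_comp; [exact: isqrtop_bop|exact: sqrtop_bop].
have bC' : bounded_op C' by apply: bop_scalel; apply: bop_comp; [exact: sqrtop_bop|exact: isqrtop_bop].
have ad y z : ip (C y) z = ip y (C' z) by rewrite ipZl ipZr isqrtop_sa sqrtop_sa.
have nC' : nb 1 C'.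
  move=> y; rewrite mul1r; apply: ler_sq; first exact: nm_ge0.
  rewrite nmZ exprMn real_normK ?num_real // expr2 k2 sqrtop_nm2 mulrC ler_pdivrMr //.
  by apply: le_trans (XY _) _; rewrite mulrC -sqrtop_nm2 isqrtopK.
have nC : nb 1 C by apply: nb_adj nC' => y z; rewrite ipC -ad ipC.
have lS := bounded_op_lin (sqrtop_bop X); have lS' := bounded_op_lin (isqrtop_bop X).
have lA := posop_lin A; have lT := bounded_op_lin (isqrtop_bop Y).
have lT' := bounded_op_lin (sqrtop_bop Y).
have CE : (fun y => C (KA_arg X A (C' y))) = (fun y => a^-1%:C *: KA_arg Y A y).
  apply/funext => y; rewrite /C /C' /KA_arg (linZ _ _ lS') (linZ _ _ lA) (linZ _ _ lS').
  by rewrite (linZ _ _ lS) (linZ _ _ lT) scalerA -rmorphM k2 sqrtopK isqrtopK.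
have ai0 : 0 < a^-1 by rewrite invr_gt0.
have fV : FC lo hi (fun t => a^-1 * t) (KA_arg Y A) (fun y => a^-1%:C *: KA_arg Y A y).
  by apply: (FC_scale _ bV); apply: FC_id; case: bV.
have hit t : lo <= t <= hi -> a^-1 * lo <= a^-1 * t <= a^-1 * hi.
  by move=> /andP[h1 h2]; rewrite !ler_pM2l // h1 h2.
have bV' : bd (a^-1 * lo) (a^-1 * hi) (fun y => a^-1%:C *: KA_arg Y A y) := FC_bd bV fV hit.
have lo0' : 0 < a^-1 * lo by rewrite mulr_gt0.
have lohi' : a^-1 * lo <= a^-1 * hi by rewrite ler_pM2l.
have hh y : ip (fcalc f (KA_arg X A) (C' y)) (C' y) <= b * ip (fcalc f (KA_arg Y A) y) y.
  have bCE : bd (a^-1 * lo) (a^-1 * hi) (fun y => C (KA_arg X A (C' y))) by rewrite CE.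
  have := hansen opf (fun t h => ltW (pf t h)) m0 mM bZ bC bC' ad nC lo0' lohi' bCE y.
  rewrite CE => h; apply: le_trans h _; rewrite -ipZl.
  apply: (FC_le bV (FC_comp bV fV hit (fFC cf lo0' lohi' bV')) (FC_scale b bV (fFC cf lo0 lohi bV))).
  exact: hb.
(* The vector is chosen so that [C'] sends it to [X^(1/2) x]. *)
have := hh ((Num.sqrt a)%:C *: sqrtop Y x).
have ka : k * Num.sqrt a = 1 by rewrite -sqrtrM ?invr_ge0 ?(ltW a0) // mulVf ?sqrtr1 // gt_eqF.
have -> : C' ((Num.sqrt a)%:C *: sqrtop Y x) = sqrtop X x.
  by rewrite /C' (linZ _ _ lT) (linZ _ _ lS) sqrtopK scalerA -rmorphM /= ka scale1r.
rewrite -KA_mean_ip // (linZ _ _ (bounded_op_lin (fcalc_bop cf lo0 lohi bV))) ipZl ipZr -KA_mean_ip //.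
rewrite [X in _ <= b * X]mulrA -expr2 sqr_sqrtr ?(ltW a0) //.
by rewrite mulrCA mulrA.
Qed.

Lemma KA_power_pcont f s : pcont f -> pcont (KA_power f s).
Proof.
move=> cf x; rewrite inE /= => x0; apply: continuous_comp; first exact: cont_powR.
by apply: cf; rewrite inE /= powR_gt0.
Qed.

Lemma KA_power_gt0 f s : (forall t, 0 < t -> 0 < f t) -> forall t, 0 < t -> 0 < KA_power f s t.
Proof. by move=> pf t t0; apply: pf; exact: powR_gt0. Qed.

Lemma fcalc_power f s m M S : pcont f -> 0 < m -> m <= M -> bd m M S ->
  fcalc (KA_power f s) S = fcalc f (op_pow S s).
Proof.
move=> cf m0 mM bS; have [k [K [k0 kK hk]]] := powR_pos_bounds s m0 mM.
have fp := op_powE s m0 mM bS; have bp := FC_bd bS fp hk.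
apply: (fcalcE mM bS); exact: FC_comp bS fp hk (fFC cf k0 kK bp).
Qed.

End kubo_ando.

Lemma KA_power_opmon (R : realType) (f : R -> R) s : 0 <= s <= 1 ->
  operator_monotone f -> operator_monotone (KA_power f s).
Proof.
move=> s01 opf; have [cf _] := opf; split; first exact: KA_power_pcont.
move=> K A B AB.
have [m [M [m0 mM bA]]] := posop_bd A; have [m' [M' [m0' mM' bB]]] := posop_bd B.
rewrite (fcalc_power _ cf m0 mM bA) (fcalc_power _ cf m0' mM' bB) -!pow_posopE.
have [_ hf] := opf; apply: hf; apply/posop_leP => x; rewrite !pow_posopE.
exact: loewner_heinz.
Qed.

(** * Powers inside a Kubo-Ando mean *)

Section powers.
Context {R : realType} {H : hilbertType R}.
Implicit Types (A X : posop H) (f : R -> R) (r : R).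

Let root_opmon r : 1 <= r -> operator_monotone (fun t : R => t `^ r^-1).
Proof.
move=> r1; have r0 : 0 < r by exact: lt_le_trans r1.
by apply: powR_operator_monotone; rewrite invr_ge0 ltW //= invf_le1.
Qed.

Let root_pow A r : 1 <= r -> fcalc (fun t : R => t `^ r^-1) (pow_posop r A) = A.
Proof.
move=> r1; apply/funext => x; rewrite -/(op_pow _ _) op_pow_pow mulfV ?op_pow1 //.
by rewrite gt_eqF // (lt_le_trans ltr01).
Qed.

Lemma KA_power_ge f A X r : operator_monotone f -> (forall t, 0 < t -> 0 < f t) ->
  1 <= r -> op_le posop1 X ->
  op_le (KA_mean f X A) (KA_mean (KA_power f r^-1) X (pow_posop r A)).
Proof.
move=> opf pf r1 /posop_leP X1; have [cf _] := opf; apply/posop_leP => x.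
have cg := @KA_power_pcont _ f r^-1 cf; have pg := @KA_power_gt0 _ f r^-1 pf.
rewrite !KA_mean_ip //.
have [m [M [m0 mM bZ]]] := KA_arg_posop X A.
have [m' [M' [m0' mM' bZ']]] := KA_arg_posop X (pow_posop r A).
rewrite (fcalc_power _ cf m0' mM' bZ').
have [k [K [k0 kK bp]]] := pow_bd r^-1 m0' mM' bZ'.
apply: (opmon_fcalc opf m0 mM bZ k0 kK bp) => y.
have [l [L [l0 lL bA]]] := posop_bd (pow_posop r A).
have nS : nb 1 (isqrtop X).
  move=> z; rewrite mul1r; apply: ler_sq; first exact: nm_ge0.
  by rewrite -ipxx; apply: le_trans (X1 _) _; rewrite -sqrtop_nm2 isqrtopK.
have := hansen (root_opmon r1) (fun t _ => powR_ge0 _ _) l0 lL bA (isqrtop_bop X) (isqrtop_bop X)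
  (@isqrtop_sa _ _ X) nS m0' mM' bZ' y.
by rewrite root_pow // /KA_arg isqrtop_sa.
Qed.

(** Now [X^(1/2)] is the contraction: with [Z = X^(-1/2) A^r X^(-1/2)], Hansen gives [X^(1/2)
    Z^(1/r) X^(1/2) <= (X^(1/2) Z X^(1/2))^(1/r) = A], and testing at [X^(-1/2) y] yields
    [Z^(1/r) <= X^(-1/2) A X^(-1/2)]. *)
Lemma KA_power_le f A X r : operator_monotone f -> (forall t, 0 < t -> 0 < f t) ->
  1 <= r -> op_le X posop1 ->
  op_le (KA_mean (KA_power f r^-1) X (pow_posop r A)) (KA_mean f X A).
Proof.
move=> opf pf r1 /posop_leP X1; have [cf _] := opf; apply/posop_leP => x.
have cg := @KA_power_pcont _ f r^-1 cf; have pg := @KA_power_gt0 _ f r^-1 pf.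
rewrite !KA_mean_ip //.
have [m [M [m0 mM bZ]]] := KA_arg_posop X A.
have [m' [M' [m0' mM' bZ']]] := KA_arg_posop X (pow_posop r A).
rewrite (fcalc_power _ cf m0' mM' bZ').
have [k [K [k0 kK bp]]] := pow_bd r^-1 m0' mM' bZ'.
apply: (opmon_fcalc opf k0 kK bp m0 mM bZ) => y.
have [l [L [l0 lL bA]]] := posop_bd (pow_posop r A).
have nS : nb 1 (sqrtop X).
  move=> z; rewrite mul1r; apply: ler_sq; first exact: nm_ge0.
  by rewrite -[leRHS]ipxx sqrtop_nm2; exact: X1.
have e : (fun z => sqrtop X (KA_arg X (pow_posop r A) (sqrtop X z))) = pow_posop r A.
  by apply/funext => z; rewrite /KA_arg sqrtopK isqrtopK.
have bA' : bd l L (fun z => sqrtop X (KA_arg X (pow_posop r A) (sqrtop X z))) by rewrite e.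
have := hansen (root_opmon r1) (fun t _ => powR_ge0 _ _) m0' mM' bZ' (sqrtop_bop X) (sqrtop_bop X)
  (@sqrtop_sa _ _ X) nS l0 lL bA' (isqrtop X y).
by rewrite e root_pow // isqrtopK /KA_arg isqrtop_sa.
Qed.

End powers.

(** * Borel measures on positive operators *)

Section borel_measures.
Context {R : realType} {H : hilbertType R}.
Implicit Types (A B X : posop H) (U V : set (posop H)) (e d m M : R).
Implicit Types (mu nu : probability (borel_posop H) R) (g h : posop H -> posop H).

Lemma posop_ballP A B d : ball A d B <-> posop_dist A B < d.
Proof. by rewrite ballEmdist. Qed.

Lemma posop_continuousP g :
  (forall A e, 0 < e -> exists d, 0 < d /\ forall B,
     nb d (fun x => A x - B x) -> nb e (fun x => g A x - g B x)) ->
  continuous g.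
Proof.
move=> hg A U /nbhs_ballP[e /= e0 hU].
have e20 : 0 < e / 2 by rewrite divr_gt0.
have [d [d0 hd]] := hg A _ e20; change (nbhs A (g @^-1` U)).
apply/nbhs_ballP; exists d => //= B /posop_ballP AB.
apply: hU; apply/posop_ballP; apply: (@le_lt_trans _ _ (e / 2)); last by lra.
apply/posop_distP; first exact: ltW.
by apply: hd; apply/posop_distP; exact: ltW.
Qed.

Lemma Sigma_closed e : closed (Sigma e : set (posop H)).
Proof.
rewrite -openC openE => A /= nA; apply: contrapT => hA; apply: nA.
have hB d : 0 < d -> exists B, Sigma e B /\ nb d (fun x => A x - B x).
  move=> d0; apply: contrapT => hn; apply: hA; apply/nbhs_ballP; exists d => //= B /posop_ballP AB SB.
  by apply: hn; exists B; split=> //; apply/posop_distP; exact: ltW.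
apply/SigmaP; split; [exact: posop_bounded|exact: posop_sa|move=> x].
have n0 := sqr_ge0 (nm x).
have key d : 0 < d -> e * nm x ^+ 2 - d <= ip (A x) x <= e^-1 * nm x ^+ 2 + d.
  move=> d0; have h0 : 0 < d / (nm x ^+ 2 + 1) by rewrite divr_gt0 //; lra.
  have [B [/SigmaP[_ _ /(_ x)/andP[h1 h2]] hn]] := hB _ h0.
  have := nb_ip x hn; rewrite ipDl ipNl.
  have h3 : d / (nm x ^+ 2 + 1) * nm x ^+ 2 <= d.
    by rewrite mulrAC ler_pdivrMr ?ler_wpM2l ?(ltW d0) //; lra.
  by rewrite ler_norml => /andP[h4 h5]; apply/andP; split; lra.
apply/andP; split; apply/ler_addgt0Pr => d d0; have /andP[] := key d d0; lra.
Qed.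

Lemma open_borel U : open U -> measurable (U : set (borel_posop H)).
Proof. by move=> oU; exact: sub_sigma_algebra. Qed.

Lemma closed_borel U : closed U -> measurable (U : set (borel_posop H)).
Proof.
move=> cU; rewrite -[U]setCK.
by apply: (@measurableC _ (borel_posop H)); apply: open_borel; exact: closed_openC.
Qed.

Lemma continuous_borel g : continuous g ->
  measurable_fun [set: borel_posop H] (g : borel_posop H -> borel_posop H).
Proof.
move=> cg.
apply: (@measurability _ _ (borel_posop H) (borel_posop H) setT g (@open (posop H))) => //.
move=> _ [U oU <-]; rewrite setTI; apply: open_borel.
by move/continuousP: cg; apply.
Qed.

(** Continuity decides the measurability test in [push], so the dummy branch never occurs. *)
Lemma pushE g mu U : continuous g -> push g mu U = mu (g @^-1` U).
Proof.
move=> /continuous_borel mg; rewrite /push; case: pselect => [mg'|//].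
by [].
Qed.

Lemma supp_closed mu : closed (supp mu).
Proof.
rewrite -openC openE => A /= /existsNP[U /not_implyP[oU /not_implyP[UA /negP h]]].
have U0 : mu U = 0%E.
  by apply/eqP; rewrite eq_le measure_ge0 andbT leNgt.
have := open_nbhs_nbhs (conj oU UA); apply: filterS => B UB /(_ U oU UB).
by rewrite U0 ltxx.
Qed.

Lemma mu_suppC mu : Pinf mu -> mu (~` supp mu) = 0%E.
Proof.
move=> [h _]; rewrite probability_setC; first by rewrite h subee.
apply: closed_borel; exact: supp_closed.
Qed.

(** The complement of the support is null, so an inclusion has to be checked on the support only;
    this is how pointwise bounds on operators become [sto_le]. *)
Lemma mu_supp_le mu U V : Pinf mu ->
  measurable (U : set (borel_posop H)) -> measurable (V : set (borel_posop H)) ->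
  (forall A, supp mu A -> U A -> V A) -> (mu U <= mu V)%E.
Proof.
move=> Pmu mU mV UV.
have ms : measurable (~` supp mu : set (borel_posop H)).
  by apply: open_borel; apply: closed_openC; exact: supp_closed.
rewrite -(measureU0 mV ms (mu_suppC Pmu)).
apply: le_measure; rewrite ?inE //; first exact: measurableU.
by move=> A UA; have [sA|sA] := pselect (supp mu A); [left; exact: UV|right].
Qed.

Lemma Pinf_push g mu : continuous g -> Pinf mu ->
  (forall e, 0 < e < 1 -> exists e', 0 < e' < 1 /\ forall A, Sigma e A -> Sigma e' (g A)) ->
  Pinf (push g mu).
Proof.
move=> cg Pmu hg; have [mu1 [e [e01 se]]] := Pmu.
have msp : measurable (supp (push g mu) : set (borel_posop H)).
  apply: closed_borel; exact: supp_closed.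
have cpre V : closed V -> closed (g @^-1` V).
  by move=> cV; apply: closed_comp => // A _; exact: cg.
split.
  apply/eqP; rewrite eq_le probability_le1 //= pushE // -mu1; apply: mu_supp_le => //.
  - apply: closed_borel; exact: supp_closed.
  - apply: closed_borel; apply: cpre; exact: supp_closed.
  - move=> A sA _ V oV VA; rewrite pushE //; apply: sA => //.
    by move/continuousP: cg; apply.
have [e' [e'01 hS]] := hg e e01; exists e'; split=> // B sB; apply: contrapT => nB.
(* The complement of [Sigma e'] is open and its preimage misses the support of [mu], so it is null
   and contains no support point. *)
have := sB (~` Sigma e') (closed_openC (@Sigma_closed e')) nB.
rewrite pushE // lt_neqAle => /andP[/eqP h _]; apply: h; apply/esym/eqP.
rewrite eq_le measure_ge0 andbT -[X in (_ <= X)%E](measure0 mu).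
apply: mu_supp_le => //.
- by apply: open_borel; move/continuousP: cg; apply; apply: closed_openC; exact: Sigma_closed.
- by move=> A /se SA nA; apply: nA; exact: hS.
Qed.

Lemma bd_Sigma m M : 0 < m -> m <= M ->
  exists e, 0 < e < 1 /\ forall A, bd m M A -> Sigma e A.
Proof.
move=> m0 mM; have M0 : 0 < M by exact: lt_le_trans mM.
exists (Num.min 2^-1 (Num.min m M^-1)); split.
  rewrite !lt_min !invr_gt0 M0 m0 ltr0n /= gt_min; apply/orP; left.
  by rewrite invf_lt1 // ltr1n.
move=> A bA; apply/SigmaP; apply: bdW bA; first by rewrite !ge_min lexx orbT.
rewrite -lef_pV2 ?posrE ?invr_gt0 //; last by rewrite !lt_min !invr_gt0 M0 m0 ltr0n.
by rewrite invrK !ge_min lexx !orbT.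
Qed.

Lemma Pinf_dirac : Pinf (dirac (posop1 : borel_posop H) : probability (borel_posop H) R).
Proof.
set P := (X in Pinf X).
have PE (U : set (posop H)) : P U = ((posop1 \in U)%:R)%:E by exact: diracE.
have e01 : 0 < (2^-1 : R) < 1 by rewrite invr_gt0 ltr0n invf_lt1 // ltr1n.
have S1 : Sigma (2^-1 : R) (posop1 : posop H).
  apply/SigmaP; split; [exact: posop_bounded|exact: posop_sa|move=> x /=].
  by rewrite ipxx invrK; have := sqr_ge0 (nm x) => h; apply/andP; split; lra.
split.
  by rewrite PE mem_set // => U _ U1; rewrite PE mem_set // lte01.
exists 2^-1; split=> // B sB; apply: contrapT => nB.
have := sB (~` Sigma 2^-1) (closed_openC (@Sigma_closed _)) nB.
by rewrite PE memNset ?ltxx.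
Qed.

Lemma scale_posopE a A : 0 < a -> scale_posop a A = (fun x => a%:C *: A x) :> (H -> H).
Proof.
move=> a0; have [m [M [m0 mM bA]]] := posop_bd A.
apply: (@to_posopE _ _ (a * m) (a * M)); rewrite ?mulr_gt0 ?ler_pM2l //.
apply: (FC_bd bA (FC_scale a bA (FC_id m M _))); first by case: bA.
by move=> t /andP[h1 h2]; rewrite !ler_pM2l // h1 h2.
Qed.

Lemma scale_posop_continuous a : 0 < a -> continuous (@scale_posop R H a).
Proof.
move=> a0; apply: posop_continuousP => A e e0; exists (e / a); split; first exact: divr_gt0.
move=> B hB x; rewrite !scale_posopE // -scalerBr nmZ gtr0_norm //.
by rewrite -ler_pdivlMl // mulrA [a^-1 * e]mulrC.
Qed.

Lemma scale_posop_Sigma a : 0 < a -> forall e, 0 < e < 1 ->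
  exists e', 0 < e' < 1 /\ forall A, Sigma e A -> Sigma e' (scale_posop a A).
Proof.
move=> a0 e /andP[e0 e1].
have ei : e <= e^-1 by apply: (@le_trans _ _ 1); rewrite ?invf_ge1 // ltW.
have [e' [e'01 h]] := @bd_Sigma (a * e) (a * e^-1) (mulr_gt0 a0 e0) ltac:(by rewrite ler_pM2l).
exists e'; split=> // A /SigmaP bA; apply: h; rewrite scale_posopE //.
apply: (FC_bd bA (FC_scale a bA (FC_id _ _ _))); first by case: bA.
by move=> t /andP[h1 h2]; rewrite !ler_pM2l // h1 h2.
Qed.

Lemma bd_perturb m M d A B : bd m M A -> nb d (fun x => A x - B x) -> bd (m - d) (M + d) B.
Proof.
move=> [_ _ hA] hd; split; [exact: posop_bounded|exact: posop_sa|move=> x].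
have /andP[h1 h2] := hA x; have := nb_ip x hd; rewrite ipDl ipNl ler_norml => /andP[h3 h4].
by apply/andP; split; lra.
Qed.

Lemma KA_mean_continuous f X : pcont f -> (forall t, 0 < t -> 0 < f t) -> continuous (KA_mean f X).
Proof.
move=> cf pf; apply: posop_continuousP => A e e0.
have [a [b [a0 ab bX]]] := posop_bd X; have [m [M [m0 mM bA]]] := posop_bd A.
have b0 : 0 < b by exact: lt_le_trans ab.
(* [A] and every [B] within [m / 2] of it lie between [m'] and [M'], with [m' > 0], so
   [FC_continuous] applies on a single interval. *)
pose m' := m / 2; pose M' := M + m / 2.
have m0' : 0 < m' by rewrite divr_gt0.
have mM' : m' <= M' by rewrite /m' /M'; lra.
have lo0 : 0 < m' / b by rewrite divr_gt0.
have lohi : m' / b <= M' / a.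
  apply: ler_pM; rewrite ?(ltW m0') ?invr_ge0 ?(ltW b0) //.
  by rewrite lef_pV2 ?posrE.
have [c [c0 hc]] := bounded_op_nb (sqrtop_bop X); have [k [k0 hk]] := bounded_op_nb (isqrtop_bop X).
have e1 : 0 < e / (c * c) by rewrite divr_gt0 ?mulr_gt0.
have [d [d0 hd]] := @FC_continuous R H _ _ f lohi (@pcont_on _ f _ _ cf lo0) _ e1.
pose d' := Num.min (m / 2) (d / (k * k)).
have d0' : 0 < d' by rewrite lt_min !divr_gt0 ?mulr_gt0.
exists d'; split=> // B hB.
have bA' : bd m' M' A by apply: bdW bA; rewrite /m' /M'; lra.
have bB : bd m' M' B.
  have dm : d' <= m / 2 by rewrite ge_min lexx.
  by apply: bdW (bd_perturb bA hB); rewrite /m' /M'; lra.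
have bZ := KA_arg_bd a0 ab bX m0' mM' bA'; have bZ' := KA_arg_bd a0 ab bX m0' mM' bB.
have lN := bounded_op_lin (isqrtop_bop X); have lS := bounded_op_lin (sqrtop_bop X).
have nZ : nb d (fun x => KA_arg X A x - KA_arg X B x).
  move=> x; rewrite /KA_arg -(linB _ _ lN).
  have := nbM (ltW k0) hk (nbM (ltW d0') hB hk) x => h; apply: le_trans h _.
  rewrite ler_wpM2r ?nm_ge0 // mulrCA -ler_pdivlMr ?mulr_gt0 //.
  by rewrite ge_min lexx orbT.
have := hd _ _ _ _ bZ bZ' (fFC cf lo0 lohi bZ) (fFC cf lo0 lohi bZ') nZ => hf x.
rewrite !KA_meanE // -(linB _ _ lS).
have := nbM (ltW c0) hc (nbM (ltW e1) hf hc) x => h; apply: le_trans h _.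
by rewrite ler_wpM2r ?nm_ge0 // mulrCA divfK // gt_eqF // mulr_gt0.
Qed.

Lemma KA_mean_Sigma f X : pcont f -> (forall t, 0 < t -> 0 < f t) -> forall e, 0 < e < 1 ->
  exists e', 0 < e' < 1 /\ forall A, Sigma e A -> Sigma e' (KA_mean f X A).
Proof.
move=> cf pf e /andP[e0 e1]; have [a [b [a0 ab bX]]] := posop_bd X.
have ei : e <= e^-1 by apply: (@le_trans _ _ 1); rewrite ?invf_ge1 // ltW.
have [k [K [k0 kK h]]] := KA_mean_bd cf pf a0 ab bX e0 ei.
have [e' [e'01 h']] := bd_Sigma k0 kK.
by exists e'; split=> // A /SigmaP bA; apply: h'; have [] := h A bA.
Qed.

Lemma Pinf_KA f X mu : pcont f -> (forall t, 0 < t -> 0 < f t) -> Pinf mu ->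
  Pinf (push (KA_mean f X) mu).
Proof.
by move=> cf pf Pmu; apply: Pinf_push => //; [exact: KA_mean_continuous|exact: KA_mean_Sigma].
Qed.

Lemma pow_posop_continuous r : continuous (@pow_posop R H r).
Proof.
apply: posop_continuousP => A e e0; have [m [M [m0 mM bA]]] := posop_bd A.
pose m' := m / 2; pose M' := M + m / 2.
have m0' : 0 < m' by rewrite divr_gt0.
have mM' : m' <= M' by rewrite /m' /M'; lra.
have [d [d0 hd]] := @FC_continuous R H _ _ _ mM' (@cont_on_powR _ _ M' r m0') _ e0.
pose d' := Num.min (m / 2) d.
have d0' : 0 < d' by rewrite lt_min divr_gt0.
exists d'; split=> // B hB.
have bA' : bd m' M' A by apply: bdW bA; rewrite /m' /M'; lra.
have bB : bd m' M' B.
  have dm : d' <= m / 2 by rewrite ge_min lexx.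
  by apply: bdW (bd_perturb bA hB); rewrite /m' /M'; lra.
rewrite !pow_posopE; apply: (hd _ _ _ _ bA' bB (op_powE _ m0' mM' bA') (op_powE _ m0' mM' bB)).
by apply: nbW hB; rewrite ge_min lexx orbT.
Qed.

Lemma pow_posop_Sigma r e : 0 < e < 1 ->
  exists e', 0 < e' < 1 /\ forall A, Sigma e A -> Sigma e' (@pow_posop R H r A).
Proof.
move=> /andP[e0 e1].
have ei : e <= e^-1 by apply: (@le_trans _ _ 1); rewrite ?invf_ge1 // ltW.
have [k [K [k0 kK hk]]] := powR_pos_bounds r e0 ei.
have [e' [e'01 h']] := bd_Sigma k0 kK.
exists e'; split=> // A /SigmaP bA; apply: h'; rewrite pow_posopE.
exact: FC_bd bA (op_powE r e0 ei bA) hk.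
Qed.

End borel_measures.

(** * Fixed points *)

Section deformed_means.
Context {R : realType} {H : hilbertType R}.
Context (M : probability (borel_posop H) R -> posop H) (opM : operator_mean M).
Implicit Types (X Y A : posop H) (a b e t : R) (mu : probability (borel_posop H) R).

(** The logarithm of the least such [a] is a one-sided Thompson distance. *)
Definition pos_le a X Y := forall x, ip (X x) x <= a * ip (Y x) x.

Lemma posop_ip_ge0 X x : 0 <= ip (X x) x.
Proof. by rewrite -sqrtop_nm2 sqr_ge0. Qed.

Lemma pos_le1 X Y : pos_le 1 X Y <-> op_le X Y.
Proof. by rewrite posop_leP; split=> h x; have := h x; rewrite mul1r. Qed.

Lemma pos_le_trans a b X Y Z : 0 <= a -> pos_le a X Y -> pos_le b Y Z -> pos_le (a * b) X Z.
Proof. by move=> a0 h1 h2 x; apply: le_trans (h1 x) _; rewrite -mulrA ler_wpM2l. Qed.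

Lemma pos_le_lim X Y : (forall a, 1 < a -> pos_le a X Y) -> op_le X Y.
Proof.
move=> h; apply/posop_leP => x; apply/ler_addgt0Pr => e e0; have q0 := posop_ip_ge0 Y x.
have d0 : 0 < e / (ip (Y x) x + 1) by rewrite divr_gt0 //; lra.
apply: le_trans (h (1 + e / (ip (Y x) x + 1)) _ x) _; first by lra.
by rewrite mulrDl mul1r lerD2l mulrAC ler_pdivrMr ?ler_wpM2l ?(ltW e0) //; lra.
Qed.

Lemma push_preim_closed (g : posop H -> posop H) (V : set (posop H)) :
  continuous g -> closed V -> closed (g @^-1` V).
Proof. by move=> cg cV; apply: closed_comp => // A _; exact: cg. Qed.

Lemma dirac1E (U : set (posop H)) :
  (dirac (posop1 : borel_posop H) : probability (borel_posop H) R) U = ((posop1 \in U)%:R)%:E.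
Proof. exact: diracE. Qed.

(** The scalar [c I] is itself a mean, that of the point mass at [I] scaled by [c]. A closed upper
    set either contains [c I] and has full point mass, or it contains no [g A] with [A] in the
    support. *)
Lemma mean_const_le mu g c : Pinf mu -> continuous g -> Pinf (push g mu) -> 0 < c ->
  (forall A, supp mu A -> op_le (g A) (scale_posop c posop1)) ->
  op_le (M (push g mu)) (scale_posop c posop1).
Proof.
move=> Pmu cg Pg c0 h; rewrite -(om_id opM) -(om_homo opM c0 Pinf_dirac).
apply: (om_mono opM) => //.
  apply: Pinf_push; [exact: scale_posop_continuous|exact: Pinf_dirac|exact: scale_posop_Sigma].
move=> U cU uU; rewrite pushE // pushE; last exact: scale_posop_continuous.
rewrite dirac1E; have [Uc|Uc] := pselect (U (scale_posop c posop1)).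
  rewrite mem_set //; apply: probability_le1; apply: closed_borel; exact: push_preim_closed.
rewrite memNset // -[leRHS]/(0%E) -(measure0 mu); apply: mu_supp_le => //.
  by apply: closed_borel; exact: push_preim_closed.
by move=> A /h gc UA; apply: Uc; exact: uU gc.
Qed.

Lemma mean_const_ge mu g c : Pinf mu -> continuous g -> Pinf (push g mu) -> 0 < c ->
  (forall A, supp mu A -> op_le (scale_posop c posop1) (g A)) ->
  op_le (scale_posop c posop1) (M (push g mu)).
Proof.
move=> Pmu cg Pg c0 h; rewrite -{1}(om_id opM) -(om_homo opM c0 Pinf_dirac).
apply: (om_mono opM) => //.
  apply: Pinf_push; [exact: scale_posop_continuous|exact: Pinf_dirac|exact: scale_posop_Sigma].
move=> U cU uU; rewrite pushE ?pushE //; last exact: scale_posop_continuous.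
rewrite dirac1E; have [Uc|Uc] := pselect (U (scale_posop c posop1)); last first.
  by rewrite memNset // measure_ge0.
rewrite mem_set // -[leLHS]/(1%E) -Pmu.1; apply: mu_supp_le => //.
- by apply: closed_borel; exact: supp_closed.
- by apply: closed_borel; exact: push_preim_closed.
- by move=> A sA _; exact: uU (h A sA).
Qed.

(** * The fixed-point map and its contraction of ratios *)

Section fixed_point.
Context (f : R -> R) (opf : operator_monotone f) (pf : forall t, 0 < t -> 0 < f t)
  (f1 : f 1 = 1) (sf : forall s t, 0 < s -> s < t -> f s < f t).
Context (mu : probability (borel_posop H) R) (Pmu : Pinf mu).

Let cf : pcont f := opf.1.

Definition dmap X := M (push (KA_mean f X) mu).

(** [b] is the maximum of [f (t / a) / f t] over the compact interval, below [1] because [f] is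
    strictly increasing and [1 / a < 1]. *)
Lemma strict_factor lo hi a : 0 < lo -> lo <= hi -> 1 < a ->
  exists b, 0 < b < 1 /\ forall t, lo <= t <= hi -> f (a^-1 * t) <= b * f t.
Proof.
move=> lo0 lohi a1; have a0 : 0 < a by exact: lt_trans a1.
have ai0 : 0 < a^-1 by rewrite invr_gt0.
pose g t := f (a^-1 * t) / f t.
have cg : {within `[lo, hi], continuous g}.
  apply: continuous_in_subspaceT => t; rewrite inE /= in_itv /= => /andP[lt _].
  have t0 : 0 < t by exact: lt_le_trans lt.
  apply: cvgM.
    apply: (@continuous_comp _ _ _ (fun t => a^-1 * t) f); first exact: mulrl_continuous.
    by apply: cf; rewrite inE /= mulr_gt0.
  by apply: cvgV; [rewrite gt_eqF // pf|apply: cf; rewrite inE].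
have [c] := EVT_max lohi cg; rewrite in_itv /= => /andP[loc _] hc.
have c0 : 0 < c by exact: lt_le_trans loc.
exists (g c); split.
  rewrite divr_gt0 ?pf ?mulr_gt0 //= ltr_pdivrMr ?pf // mul1r; apply: sf; first exact: mulr_gt0.
  by rewrite mulrC ltr_pdivrMr // ltr_pMr.
move=> t ht; have t0 : 0 < t by case/andP: ht => h _; exact: lt_le_trans h.
by rewrite -ler_pdivrMr ?pf //; apply: hc; rewrite in_itv.
Qed.

(** For [A] in [Sigma e] the argument of [Y sigma A] lies between [e / y2] and [e^-1 / y1], the
    interval on which the factor [b] is asked for. *)
Lemma dmap_le e X Y a b y1 y2 : 0 < e < 1 -> supp mu `<=` Sigma e -> 0 < a -> 0 < b ->
  pos_le a X Y -> 0 < y1 -> y1 <= y2 -> bd y1 y2 Y ->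
  (forall t, e / y2 <= t <= e^-1 / y1 -> f (a^-1 * t) <= b * f t) ->
  pos_le (a * b) (dmap X) (dmap Y).
Proof.
move=> /andP[e0 e1] se a0 b0 XY y10 y12 bY hb x; have ab0 : 0 < a * b by rewrite mulr_gt0.
have ei : e <= e^-1 by apply: (@le_trans _ _ 1); rewrite ?invf_ge1 // ltW.
have y20 : 0 < y2 by exact: lt_le_trans y12.
have lo0 : 0 < e / y2 by rewrite divr_gt0.
have lohi : e / y2 <= e^-1 / y1.
  apply: ler_pM; rewrite ?(ltW e0) ?invr_ge0 ?(ltW y20) //.
  by rewrite lef_pV2 ?posrE.
have h : op_le (dmap X) (scale_posop (a * b) (dmap Y)).
  rewrite -(om_homo opM ab0 (Pinf_KA Y cf pf Pmu)); apply: (om_mono opM); first exact: Pinf_KA.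
    apply: Pinf_push; [exact: scale_posop_continuous|exact: Pinf_KA|exact: scale_posop_Sigma].
  move=> U cU uU.
  have cK Z : continuous (KA_mean f Z) by exact: KA_mean_continuous.
  rewrite pushE; last exact: KA_mean_continuous.
  rewrite pushE; last exact: scale_posop_continuous.
  rewrite pushE; last exact: KA_mean_continuous.
  apply: mu_supp_le => //.
  - by apply: closed_borel; exact: push_preim_closed.
  - apply: closed_borel; apply: push_preim_closed => //.
    by apply: push_preim_closed => //; exact: scale_posop_continuous.
  move=> A sA UA; apply: (uU _ _ UA); apply/posop_leP => z.
  have bA : bd e e^-1 A by apply/SigmaP; exact: se.
  rewrite scale_posopE // ipZl.
  exact: (KA_mean_le opf pf a0 XY lo0 lohi (KA_arg_bd y10 y12 bY e0 ei bA) hb).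
by move/posop_leP : h => /(_ x); rewrite scale_posopE // ipZl.
Qed.

Lemma f_mono s t : 0 < s -> s <= t -> f s <= f t.
Proof. by move=> s0; rewrite le_eqVlt => /orP[/eqP->//|st]; apply: ltW; exact: sf. Qed.

Lemma dmap_mono X Y : op_le X Y -> op_le (dmap X) (dmap Y).
Proof.
move=> /pos_le1 XY; have [_ [e [e01 se]]] := Pmu.
have [y1 [y2 [y10 y12 bY]]] := posop_bd Y; apply/pos_le1.
have := dmap_le e01 se ltr01 ltr01 XY y10 y12 bY; rewrite mul1r; apply=> t _.
by rewrite invr1 !mul1r.
Qed.

(** The least ratio [a] of [X] over [Y] is attained. If [a > 1], then [X <= F X <= a b F Y <= a b Y]
    with [b < 1] contradicts minimality. *)
Lemma dmap_compare X Y : op_le X (dmap X) -> op_le (dmap Y) Y -> op_le X Y.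
Proof.
move=> /pos_le1 XF /pos_le1 FY; have [_ [e [e01 se]]] := Pmu.
have [x1 [x2 [x10 x12 [_ _ bX]]]] := posop_bd X.
have [y1 [y2 [y10 y12 bY]]] := posop_bd Y.
have x20 : 0 < x2 by exact: lt_le_trans x12.
have y20 : 0 < y2 by exact: lt_le_trans y12.
pose E := [set a | 0 <= a /\ pos_le a X Y].
have E0 : E !=set0.
  exists (x2 / y1); split; first by rewrite divr_ge0 // ltW.
  move=> x; have /andP[_ h1] := bX x; have [_ _ /(_ x)/andP[h2 _]] := bY.
  apply: le_trans h1 _; rewrite -mulrA ler_pM2l // mulrC ler_pdivlMr //.
  by rewrite mulrC.
have lE : has_lbound E by exists 0 => a [].
pose a := inf E.
have a0 : 0 <= a by apply: lb_le_inf => // c [].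
have aE : pos_le a X Y.
  move=> x; have q0 := posop_ip_ge0 Y x.
  move: (q0); rewrite le_eqVlt => /orP[/eqP qe|qp].
    by have [c [_ /(_ x)]] := E0; rewrite -qe !mulr0.
  rewrite -ler_pdivrMr //; apply: lb_le_inf => // c [_ hc].
  by rewrite ler_pdivrMr.
have [a1|a1] := leP a 1.
  apply/pos_le1 => x; apply: le_trans (aE x) _.
  by rewrite ler_wpM2r // posop_ip_ge0.
exfalso.
have ap : 0 < a by exact: lt_trans a1.
have e0 : 0 < e by case/andP: e01.
have ei : e <= e^-1.
  by case/andP: e01 => _ e1; apply: (@le_trans _ _ 1); rewrite ?invf_ge1 // ltW.
have lo0 : 0 < e / y2 by rewrite divr_gt0.
have lohi : e / y2 <= e^-1 / y1.
  apply: ler_pM; rewrite ?(ltW e0) ?invr_ge0 ?(ltW y20) //.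
  by rewrite lef_pV2 ?posrE.
have [b [/andP[b0 b1] hb]] := strict_factor lo0 lohi a1.
have h := dmap_le e01 se ap b0 aE y10 y12 bY hb.
have ab0 : 0 <= a * b by rewrite mulr_ge0 // ltW.
have := pos_le_trans ler01 XF (pos_le_trans ab0 h FY); rewrite mul1r mulr1 => h2.
have : a <= a * b by apply: ge_inf.
by rewrite ler_pMr // leNgt b1.
Qed.

(** [A <= X] says that the argument of [f] is at most [I], and [f 1 = 1]. With [KA_ge_self] this
    makes [e^-1 I] a supersolution and [e I] a subsolution. *)
Lemma KA_le_self X A : op_le A X -> op_le (KA_mean f X A) X.
Proof.
move=> /posop_leP AX; apply/posop_leP => x; rewrite KA_mean_ip //.
have [m [N [m0 mN bZ]]] := KA_arg_posop X A.
rewrite -sqrtop_nm2; set y := sqrtop X x.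
have := opmon_fcalc opf m0 mN bZ ltr01 (lexx (1 : R)) (bd_scale H 1) _ y.
rewrite fcalc_scalar // f1 scale1r ipxx; apply=> z.
by rewrite scale1r /KA_arg isqrtop_sa; apply: le_trans (AX _) _; rewrite -sqrtop_nm2 isqrtopK ipxx.
Qed.

Lemma KA_ge_self X A : op_le X A -> op_le X (KA_mean f X A).
Proof.
move=> /posop_leP AX; apply/posop_leP => x; rewrite KA_mean_ip //.
have [m [N [m0 mN bZ]]] := KA_arg_posop X A.
rewrite -sqrtop_nm2; set y := sqrtop X x.
have := opmon_fcalc opf ltr01 (lexx (1 : R)) (bd_scale H 1) m0 mN bZ _ y.
rewrite fcalc_scalar // f1 scale1r ipxx; apply=> z.
by rewrite scale1r /KA_arg isqrtop_sa; apply: le_trans (AX _); rewrite -sqrtop_nm2 isqrtopK ipxx.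
Qed.

Lemma dmap_fixed_exists : exists X, X = dmap X.
Proof.
have [_ [e [e01 se]]] := Pmu; have /andP[e0 e1] := e01.
have ei0 : 0 < e^-1 by rewrite invr_gt0.
have ei : e <= e^-1 by apply: (@le_trans _ _ 1); rewrite ?invf_ge1 // ltW.
have cK X : continuous (KA_mean f X) by exact: KA_mean_continuous.
pose X0 : posop H := scale_posop e^-1 posop1; pose Y0 : posop H := scale_posop e posop1.
have X0E x : ip (X0 x) x = e^-1 * nm x ^+ 2 by rewrite /X0 scale_posopE //= ipZl ipxx.
have Y0E x : ip (Y0 x) x = e * nm x ^+ 2 by rewrite /Y0 scale_posopE //= ipZl ipxx.
have sX0 A : supp mu A -> op_le A X0.
  by move=> /se/SigmaP[_ _ h]; apply/posop_leP => x; rewrite X0E; have /andP[] := h x.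
have sY0 A : supp mu A -> op_le Y0 A.
  by move=> /se/SigmaP[_ _ h]; apply/posop_leP => x; rewrite Y0E; have /andP[] := h x.
have FX0 : op_le (dmap X0) X0.
  apply: mean_const_le => //; first exact: Pinf_KA.
  by move=> A sA; apply: KA_le_self; exact: sX0.
have FY0 : op_le Y0 (dmap Y0).
  apply: mean_const_ge => //; first exact: Pinf_KA.
  by move=> A sA; apply: KA_ge_self; exact: sY0.
clearbody X0 Y0.
have [X [XE0 XE]] : exists X : nat -> posop H, X 0%N = X0 /\ forall n, X n.+1 = dmap (X n).
  by exists (fun n => iter n dmap X0); split; [exact: erefl|move=> n; exact: erefl].
have [Y [YE0 YE]] : exists Y : nat -> posop H, Y 0%N = Y0 /\ forall n, Y n.+1 = dmap (Y n).
  by exists (fun n => iter n dmap Y0); split; [exact: erefl|move=> n; exact: erefl].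
have XS n : op_le (X n.+1) (X n).
  by elim: n => [|n /dmap_mono]; [rewrite XE XE0|rewrite -!XE].
have YS n : op_le (Y n) (Y n.+1).
  by elim: n => [|n /dmap_mono]; [rewrite YE YE0|rewrite -!YE].
have YX n : op_le (Y n) (X n).
  elim: n => [|n /dmap_mono]; last by rewrite -XE -YE.
  by apply/posop_leP => x; rewrite XE0 YE0 X0E Y0E ler_wpM2r ?sqr_ge0.
have Xdec n k : (n <= k)%N -> op_le (X k) (X n).
  move=> /subnK <-; elim: (k - n)%N => [|j IH]; first exact: posop_le_refl.
  exact: posop_le_trans (XS _) IH.
have Yinc n k : (n <= k)%N -> op_le (Y n) (Y k).
  move=> /subnK <-; elim: (k - n)%N => [|j IH]; first exact: posop_le_refl.
  exact: posop_le_trans IH (YS _).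
have YleX n k : op_le (Y n) (X k).
  apply: posop_le_trans (Yinc _ _ (leq_maxl n k)) _.
  apply: posop_le_trans (YX _) _; exact: Xdec (leq_maxr n k).
have bXY (Z : posop H) n k : op_le (Y n) Z -> op_le Z (X k) -> bd e e^-1 Z.
  move=> h1 h2; have := posop_le_trans (Yinc 0%N n isT) h1.
  have := posop_le_trans h2 (Xdec 0%N k isT).
  rewrite XE0 YE0 !posop_leP => h3 h4; split; [exact: posop_bounded|exact: posop_sa|].
  by move=> x; rewrite -X0E -Y0E h3 h4.
have bY n : bd e e^-1 (Y n) by exact: bXY (posop_le_refl _) (YX n).
(* the ratio between [X n] and [Y n] contracts by [b < 1] as long as it exceeds [a] *)
have key a : 1 < a -> exists n, pos_le a (X n) (Y n).
  move=> a1; have a0 : 0 < a by exact: lt_trans a1.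
  have lo0 : 0 < e / e^-1 by rewrite divr_gt0.
  have lohi : e / e^-1 <= e^-1 / e.
    by apply: ler_pM; rewrite ?invr_ge0 ?(ltW e0) ?(ltW ei0) // invrK.
  have [b [/andP[b0 b1] hb]] := strict_factor lo0 lohi a1.
  have hn n : pos_le (Num.max a (b ^+ n * (e^-1 / e))) (X n) (Y n).
    elim: n => [|n IH].
      move=> x; rewrite XE0 YE0 X0E Y0E expr0 mul1r.
      rewrite [leLHS](_ : _ = e^-1 / e * (e * nm x ^+ 2)); last by field; lra.
      apply: ler_wpM2r; last by rewrite le_max lexx orbT.
      by apply: mulr_ge0; [exact: ltW|exact: sqr_ge0].
    set c := Num.max a _ in IH; have ac : a <= c by rewrite le_max lexx.
    have c0 : 0 < c by exact: lt_le_trans ac.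
    (* [f] is increasing and [c >= a], so the factor [b] found for [a] also serves the current ratio
       [c]. *)
    have hc t : e / e^-1 <= t <= e^-1 / e -> f (c^-1 * t) <= b * f t.
      move=> ht; have t0 : 0 < t by case/andP: ht => h _; exact: lt_le_trans h.
      apply: le_trans (hb t ht); apply: f_mono; first by rewrite mulr_gt0 ?invr_gt0.
      by rewrite ler_pM2r // lef_pV2 ?posrE.
    move=> x; rewrite XE YE; apply: le_trans (dmap_le e01 se c0 b0 IH e0 ei (bY n) hc x) _.
    rewrite ler_wpM2r ?posop_ip_ge0 // /c maxr_pMl ?(ltW b0) // ge_max !le_max.
    apply/andP; split; first by rewrite ger_pMr // (ltW b1).
    by apply/orP; right; rewrite exprSr [leLHS]mulrAC.
  have [n hb'] : exists n : nat, b ^+ n * (e^-1 / e) <= a.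
    have : `|b| < 1 by rewrite gtr0_norm.
    move=> /cvg_expr/cvgrPdist_le/(_ (a / (e^-1 / e))) [].
      by rewrite !divr_gt0.
    move=> n _ /(_ n (leqnn n)); rewrite /= sub0r normrN ger0_norm ?exprn_ge0 ?(ltW b0) //.
    by rewrite ler_pdivlMr ?divr_gt0 // => h; exists n.
  by exists n => x; have := hn n x; rewrite max_l.
have hcauchy d : 0 < d -> exists N, forall n k, (N <= n)%N -> (N <= k)%N ->
    nb d (fun x => X n x - X k x).
  (* Beyond [N] the forms of [X n] and [X k] both lie between those of [Y N] and [(1 + c) Y N], so
     they differ by at most [c e^-1 = d / 2] times [nm x ^+ 2]; [bd_nb] bounds the norm by twice
     [d / 2]. *)
  move=> d0; pose c := d / 2 * e.
  have c0 : 0 < c by rewrite mulr_gt0 // divr_gt0.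
  have [|N hN] := key (1 + c); first by lra.
  exists N => n k nN kN.
  have h x : `|ip (X n x - X k x) x| <= d / 2 * nm x ^+ 2.
    have h1 n' : (N <= n')%N -> ip (Y N x) x <= ip (X n' x) x <= (1 + c) * ip (Y N x) x.
      move=> nN'; have /posop_leP/(_ x) -> := YleX N n'.
      by have /posop_leP/(_ x) h := Xdec _ _ nN'; apply: le_trans h (hN x).
    have /andP[h2 h3] := h1 _ nN; have /andP[h4 h5] := h1 _ kN.
    have h6 : c * ip (Y N x) x <= d / 2 * nm x ^+ 2.
      have [_ _ /(_ x)/andP[_ h6]] := bY N.
      apply: le_trans (ler_wpM2l (ltW c0) h6) _.
      by rewrite /c mulrA mulfK // gt_eqF.
    by rewrite ipDl ipNl ler_norml; apply/andP; split; lra.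
  have bD : bd (- (d / 2)) (d / 2) (fun x => X n x - X k x).
    split; first by apply: bop_sub; exact: posop_bounded.
      by move=> x y; rewrite ipDl ipDr ipNl ipNr !posop_sa.
    by move=> x; have := h x; rewrite ler_norml mulNr.
  have := bd_nb bD; rewrite normrN gtr0_norm ?divr_gt0 //.
  by have -> : d / 2 + d / 2 = d by lra.
have [L [bL hL]] := @op_lim _ _ (fun n => X n : H -> H) (fun n => posop_bounded _) hcauchy.
have sL : sa L.
  apply: sa_lim => d /hL[N hN]; exists (X N); split; first exact: posop_sa.
  exact: hN.
have near x d : 0 < d -> exists N, forall n, (N <= n)%N -> `|ip (L x) x - ip (X n x) x| <= d.
  move=> d0; have n0 := sqr_ge0 (nm x).
  have h0 : 0 < d / (nm x ^+ 2 + 1) by rewrite divr_gt0 //; lra.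
  have [N hN] := hL _ h0; exists N => n nN.
  have := nb_ip x (hN n nN); rewrite ipDl ipNl => h; apply: le_trans h _.
  by rewrite mulrAC ler_pdivrMr ?ler_wpM2l ?(ltW d0) //; lra.
have Lle n x : ip (L x) x <= ip (X n x) x.
  apply/ler_addgt0Pr => d d0; have [N hN] := near x d d0.
  have := hN _ (leq_maxl N n); have /posop_leP/(_ x) := Xdec _ _ (leq_maxr N n).
  by rewrite ler_norml => h1 /andP[_ h2]; lra.
have Lge n x : ip (Y n x) x <= ip (L x) x.
  apply/ler_addgt0Pr => d d0; have [N hN] := near x d d0.
  have := hN _ (leqnn N); have /posop_leP/(_ x) := YleX n N.
  by rewrite ler_norml => h1 /andP[h2 _]; lra.
have bdL : bd e e^-1 L by split=> // x; rewrite -X0E -Y0E -XE0 -YE0 Lge Lle.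
pose Z : posop H := to_posop L.
have ZE : Z = L :> (H -> H) by exact: to_posopE e0 ei bdL.
have ZX n : op_le Z (X n) by apply/posop_leP => x; rewrite ZE.
have YZ n : op_le (Y n) Z by apply/posop_leP => x; rewrite ZE.
(* No limit is taken inside [F]: for every [a > 1] some [n] gives
   [Z <= X n <= a Y n <= a F (Y n) <= a F Z], and dually [F Z <= F (X n) <= X n <= a Y n <= a Z]. *)
exists Z; apply: posop_le_anti; apply: pos_le_lim => a a1.
  have [n hn] := key a a1; have a0 : 0 <= a by exact/ltW/(lt_trans ltr01).
  have FYZ : op_le (Y n.+1) (dmap Z) by rewrite YE; exact: dmap_mono.
  have h1 := pos_le_trans a0 hn ((pos_le1 _ _).2 (YS n)).
  have h2 := pos_le_trans ler01 ((pos_le1 _ _).2 (ZX n)) h1.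
  have := pos_le_trans _ h2 ((pos_le1 _ _).2 FYZ).
  by rewrite mul1r !mulr1; apply.
have [n hn] := key a a1; have a0 : 0 <= a by exact/ltW/(lt_trans ltr01).
have h1 := pos_le_trans a0 hn ((pos_le1 _ _).2 (YZ n)).
have FZX : op_le (dmap Z) (X n.+1) by rewrite XE; exact: dmap_mono.
have h2 := pos_le_trans ler01 ((pos_le1 _ _).2 (XS n)) h1.
have := pos_le_trans ler01 ((pos_le1 _ _).2 FZX) h2.
by rewrite !mul1r !mulr1.
Qed.

(** [xget] would return [posop1] if there were no solution; existence rules this out. *)
Lemma deformed_meanE : deformed_mean M f mu = dmap (deformed_mean M f mu).
Proof.
rewrite {1}/deformed_mean; have [X hX] := dmap_fixed_exists.
by case: xgetP => [Y -> //|/(_ X)].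
Qed.

End fixed_point.
End deformed_means.

(** On the zero space all operators coincide, and for [f] constantly [1] the mean is
    [X^(1/2) X^(1/2) = X]; either would make sigma the left mean. *)
Lemma nontrivial_mean (R : realType) (H : hilbertType R) (f : R -> R) : pcont f ->
  (forall t, 0 < t -> 0 < f t) -> f 1 = 1 -> KA_mean f <> @left_mean R H ->
  (exists x0 : H, nm x0 != 0) /\ exists2 a, 0 < a & f a != f 1.
Proof.
move=> cf pf f1 hf; split; apply: contrapT => hn; apply: hf.
  apply/funext => X; apply/funext => A; apply: val_inj; apply/funext => x.
  have h0 (y : H) : y = 0.
    by apply: nm_eq0; apply: contrapT => /eqP h; apply: hn; exists y.
  by rewrite [LHS]h0 [RHS]h0.
apply/funext => X; apply/funext => A; apply: val_inj; apply/funext => x.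
have [m [M [m0 mM bZ]]] := KA_arg_posop X A; have [bZ1 _ _] := bZ.
have -> : \val (KA_mean f X A) = (fun x => sqrtop X (fcalc f (KA_arg X A) (sqrtop X x))).
  exact: KA_meanE.
have -> : fcalc f (KA_arg X A) = (fun y => 1%:C *: y).
  apply: (fcalcE mM bZ); apply: FC_ext (FC_cst m M 1 bZ1) => t /andP[mt _].
  apply: contrapT => h; apply: hn; exists t; first exact: lt_le_trans mt.
  by rewrite f1 eq_sym; apply/eqP.
by rewrite scale1r; exact: posop_sqr_half.
Qed.

(** * Comparison of the fixed-point maps of [mu] and [mu^r] *)

Section order_transfer.
Context {R : realType} {H : hilbertType R} (M : probability (borel_posop H) R -> posop H).
Context (opM : operator_mean M) (mu : probability (borel_posop H) R) (Pmu : Pinf mu).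
Context (f : R -> R) (opf : operator_monotone f) (pf : forall t, 0 < t -> 0 < f t) (r : R).
Implicit Types X : posop H.

Let g := KA_power f r^-1.
Let nu := push (pow_posop r) mu.

Let cf : pcont f := opf.1.
Let cg : pcont g. Proof. exact: KA_power_pcont. Qed.
Let pg t : 0 < t -> 0 < g t. Proof. exact: KA_power_gt0. Qed.

Lemma Pinf_pow : Pinf nu.
Proof.
apply: Pinf_push => //; first exact: pow_posop_continuous.
by move=> e e01; exact: pow_posop_Sigma.
Qed.

Let KA_pow_measurable X U : closed U ->
  measurable ((pow_posop r @^-1` (KA_mean g X @^-1` U)) : set (borel_posop H)).
Proof.
move=> cU; apply: closed_borel; apply: push_preim_closed; first exact: pow_posop_continuous.
by apply: push_preim_closed => //; exact: KA_mean_continuous.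
Qed.

Let KA_measurable X U : closed U -> measurable ((KA_mean f X @^-1` U) : set (borel_posop H)).
Proof.
by move=> cU; apply: closed_borel; apply: push_preim_closed => //; exact: KA_mean_continuous.
Qed.

Let pushgE X U : push (KA_mean g X) nu U = mu (pow_posop r @^-1` (KA_mean g X @^-1` U)).
Proof.
by rewrite pushE; [rewrite pushE //; exact: pow_posop_continuous|exact: KA_mean_continuous].
Qed.

Let pushfE X U : push (KA_mean f X) mu U = mu (KA_mean f X @^-1` U).
Proof. by rewrite pushE //; exact: KA_mean_continuous. Qed.

Lemma dmap_pow_ge X : (forall A, op_le (KA_mean f X A) (KA_mean g X (pow_posop r A))) ->
  op_le (dmap M f mu X) (dmap M g nu X).
Proof.
move=> h; apply: (om_mono opM); [exact: Pinf_KA|exact: (Pinf_KA X cg pg Pinf_pow)|].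
move=> U cU uU; rewrite pushfE pushgE; apply: mu_supp_le => //; first exact: KA_measurable.
  exact: KA_pow_measurable.
by move=> A _ UA; exact: uU (h A).
Qed.

Lemma dmap_pow_le X : (forall A, op_le (KA_mean g X (pow_posop r A)) (KA_mean f X A)) ->
  op_le (dmap M g nu X) (dmap M f mu X).
Proof.
move=> h; apply: (om_mono opM); [exact: (Pinf_KA X cg pg Pinf_pow)|exact: Pinf_KA|].
move=> U cU uU; rewrite pushfE pushgE; apply: mu_supp_le => //; last first.
  by move=> A _ UA; exact: uU (h A).
- exact: KA_measurable.
- exact: KA_pow_measurable.
Qed.

End order_transfer.

Theorem theorem6p11 (R : realType) (H : hilbertType R)
  (M : probability (borel_posop H) R -> posop H) (f : R -> R)
  (mu : probability (borel_posop H) R) :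
  separable_space H ->
  operator_mean M ->
  congruence_invariant M ->
  representing_function f ->
  KA_mean f <> @left_mean R H ->
  Pinf mu ->
  (op_le posop1 (deformed_mean M f mu) ->
     forall r : R, 1 <= r ->
       op_le (deformed_mean M f mu)
         (deformed_mean M (KA_power f r^-1) (push (pow_posop r) mu))) /\
  (op_le (deformed_mean M f mu) posop1 ->
     forall r : R, 1 <= r ->
       op_le (deformed_mean M (KA_power f r^-1) (push (pow_posop r) mu))
         (deformed_mean M f mu)).
Proof.
move=> _ opM _ [pf opf f1] fl Pmu.
have [[x0 hx0] fnc] := nontrivial_mean opf.1 pf f1 fl.
have sf := opmon_strict opf hx0 fnc.
have XE := deformed_meanE opM opf pf f1 sf Pmu.
set X := deformed_mean M f mu in XE *.
have hg r : 1 <= r -> [/\ operator_monotone (KA_power f r^-1),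
    forall t, 0 < t -> 0 < KA_power f r^-1 t, KA_power f r^-1 1 = 1 &
    forall s t, 0 < s -> s < t -> KA_power f r^-1 s < KA_power f r^-1 t].
  move=> r1; have r0 : 0 < r by exact: lt_le_trans r1.
  split; [|exact: KA_power_gt0|by rewrite /KA_power powR1|].
    by apply: KA_power_opmon => //; rewrite invr_ge0 (ltW r0) invf_le1.
  move=> s t s0 st; apply: sf; first exact: powR_gt0.
  apply: gt0_ltr_powR => //; rewrite ?invr_gt0 ?nnegrE ?(ltW s0) //.
  by rewrite ltW // (lt_trans s0).
split=> X1 r r1; have [opg pg g1 sg] := hg r r1; have Pnu := Pinf_pow Pmu r.
  have YE := deformed_meanE opM opg pg g1 sg Pnu.
  apply: (dmap_compare opM opg pg sg Pnu).
    rewrite {1}XE; apply: dmap_pow_ge => // A; exact: KA_power_ge.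
  by rewrite -YE; exact: posop_le_refl.
have YE := deformed_meanE opM opg pg g1 sg Pnu.
apply: (dmap_compare opM opg pg sg Pnu).
  by rewrite -YE; exact: posop_le_refl.
rewrite {2}XE; apply: dmap_pow_le => // A; exact: KA_power_le.
Qed.
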